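(* Let $n\ge 2$ and $\ell=2^n-1$. Fix real parameters $1\le R_2\le R_3\le\dots\le R_\ell$. For $X>0$ let $\mathcal F(X,R_2,\dots,R_\ell)$ be the number of totally real multiquadratic number fields $K_n$ of degree $2^n$ such that $\Delta_{K_n}\le X$, $2$ is unramified in $K_n$, and $\operatorname{sh}(K_n)\in W(R_2,\dots,R_\ell)$. Then $$\mathcal F(X,R_2,\dots,R_\ell)\sim C_\ell\,F(R_2,\dots,R_\ell)\,X^{1/2^{n-1}}\qquad (X\to\infty),$$ where $$C_\ell=\frac{\omega_1\,c_\ell\,\ell!}{4^\ell\,\#\mathrm{GL}_n(\mathbb F_2)}\prod_{p>2}\left(1-\frac1p\right)^\ell\left(1+\frac{\ell}{p}\right),$$ the product being over odd primes $p$.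
   Context: A totally real multiquadratic field of degree $2^n$ is a Galois extension $K_n/\mathbb Q$ of the form $K_n=\mathbb Q(\sqrt{a_1},\dots,\sqrt{a_n})$ with $a_i>1$ squarefree integers and $\mathrm{Gal}(K_n/\mathbb Q)\simeq\mathbb F_2^n$. Fields are counted up to isomorphism (equivalently, as subfields of $\mathbb R$). $\Delta_{K_n}$ is the absolute discriminant. The notation $f\sim g$ means $f=(1+o(1))g$. Shape condition. $K_n$ has exactly $\ell$ quadratic subfields $\mathbb Q(\sqrt{D})$ with $D>1$ squarefree. List their radicands in increasing order, $D_{(1)}<D_{(2)}<\dots<D_{(\ell)}$, and set $\lambda_j=D_{(j)}/D_{(1)}$ for $2\le j\le\ell$. When $2$ is unramified in $K_n$, the shape of $K_n$ is described by these parameters and written $\operatorname{sh}(K_n)=\operatorname{sh}(\lambda_2,\dots,\lambda_\ell)$. The condition $\operatorname{sh}(K_n)\in W(R_2,\dots,R_\ell)$ means $$\lambda_2<\dots<\lambda_\ell\le R_\ell,\qquad R_j\le\lambda_j\quad(2\le j\le\ell-1).$$ The function $F$. $$F(R_2,\dots,R_\ell)=\int_{R_{\ell-1}}^{R_\ell}\int_{R_{\ell-1}}^{a_\ell}\int_{R_{\ell-2}}^{a_{\ell-1}}\cdots\int_{R_2}^{a_3}\frac{da_2}{a_2}\cdots\frac{da_\ell}{a_\ell},$$ i.e. the integral of $\prod_{j=2}^\ell da_j/a_j$ over the region $a_2\le a_3\le\dots\le a_\ell\le R_\ell$, $a_j\ge R_j$ for $2\le j\le\ell-1$. The constants. For $0\le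 j\le\ell$ with binary expansion $j=\sum_{t=1}^n b_t2^{t-1}$ let $\mathbf v_j=(b_1,\dots,b_n)\in\mathbb F_2^n$. Let $\mathbf v_i\cdot\mathbf v_j\in\mathbb F_2$ be the standard dot product and let $\widetilde{a}\in\{0,1\}\subset\mathbb Z$ denote the lift of $a\in\mathbb F_2$. Let $C$ be the $\ell\times\ell$ matrix whose first row is $(1,\dots,1)$ and whose $(j,i)$ entry, for $2\le j\le\ell$ and $1\le i\le\ell$, is $\widetilde{\mathbf v_i\cdot\mathbf v_j}-\widetilde{\mathbf v_i\cdot\mathbf v_1}$. Then $c_\ell:=|\det C|^{-1}$ (and $\det C\ne0$). For $(g_1,\dots,g_\ell)$ put $D_j=\prod_{1\le i\le\ell,\ \mathbf v_i\cdot\mathbf v_j=1}g_i$ and $a_j=D_{2^{j-1}}$ for $1\le j\le n$. Then $\omega_1$ is the number of residue classes $(g_1,\dots,g_\ell)\in(\mathbb Z/4\mathbb Z)^\ell$ for which $a_j\equiv1\pmod 4$ for all $1\le j\le n$. *)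

(* Defs.v *)
From HB Require Import structures.
From mathcomp Require Import all_boot all_order all_algebra all_fingroup.
From mathcomp Require Import all_solvable all_field.
From mathcomp Require Import finmap.
From mathcomp Require Import all_classical all_reals all_analysis.

Set Implicit Arguments.
Unset Strict Implicit.
Unset Printing Implicit Defensive.

Import Order.TTheory GRing.Theory Num.Theory.
Import numFieldNormedType.Exports.

Local Open Scope classical_set_scope.
Local Open Scope ring_scope.

(* Makes the library's asymptotic equivalence f ~_F g usable with F := +oo. *)
Canonical pinfty_filter_on (R : numFieldType) :=
  FilterType (pinfty_nbhs R) (@filter_filter R _ proper_pinfty_nbhs).

Definition squarefree (m : nat) : Prop :=
  forall d : nat, (d ^ 2 %| m)%N -> d = 1%N.

Section NumberField.
Variable L : fieldExtType rat.

Definition int_ring : set L := [set x | integralOver (intr : int -> L) x].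

Definition field_trace (x : L) : rat :=
  \tr (passmx.mxof (vbasis {:L}) (vbasis {:L}) (amulr x)).

Definition is_integral_basis (b : (\dim {:L}).-tuple L) : Prop :=
  basis_of {:L} b /\
  forall x : L, int_ring x <->
    exists c : 'I_(\dim {:L}) -> int, x = \sum_(i < \dim {:L}) b`_i *~ c i.

Definition disc_basis (b : (\dim {:L}).-tuple L) : rat :=
  \det (\matrix_(i < \dim {:L}, j < \dim {:L}) field_trace (b`_i * b`_j)).

(* The default value 0 is never taken: integral bases exist and all of them
   have the same discriminant. *)
Definition field_disc : rat :=
  xget 0 [set disc_basis b | b in is_integral_basis].

Definition is_ideal (I : set L) : Prop :=
  [/\ I `<=` int_ring, I 0,
      (forall x y, I x -> I y -> I (x + y)) &
      (forall a x, int_ring a -> I x -> I (a * x))].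

Definition ideal_mul (I J : set L) : set L :=
  [set x | exists s : seq (L * L),
     (forall u, u \in s -> I u.1 /\ J u.2) /\ x = \sum_(u <- s) u.1 * u.2].

Definition is_nonzero_prime (P : set L) : Prop :=
  [/\ is_ideal P, P <> [set 0], ~ P 1 &
      forall x y, int_ring x -> int_ring y -> P (x * y) -> P x \/ P y].

Definition principal_ideal (a : L) : set L :=
  [set a * x | x in int_ring].

(* All ramification indices are 1: the ideal generated by p is a product of
   pairwise distinct nonzero primes. *)
Definition unramified (p : nat) : Prop :=
  exists (k : nat) (P : 'I_k -> set L),
    [/\ injective P, (forall i, is_nonzero_prime (P i)) &
        principal_ideal p%:R = \big[ideal_mul/int_ring]_(i < k) P i].

Definition radicands : set nat :=
  [set D | [/\ (1 < D)%N, squarefree D &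
     exists E : {subfield L}, \dim E = 2%N /\
       exists2 x : L, x ^+ 2 = D%:R & E = <<1; x>>%VS :> {vspace L}]].

End NumberField.

(* The generators x i are the square roots of the a i. *)
Definition totally_real_multiquadratic (n : nat)
    (L : splittingFieldType rat) : Prop :=
  [/\ galois 1%VS {:L},
      'Gal({:L} / 1%VS)%g \isog [set: 'rV['F_2]_n]%SET &
      exists (a : 'I_n -> nat) (x : n.-tuple L),
        [/\ forall i, (1 < a i)%N, forall i, squarefree (a i),
            forall i : 'I_n, x`_i ^+ 2 = (a i)%:R &
            {:L}%VS = <<1 & x>>%VS]].

Definition ell (n : nat) : nat := (2 ^ n - 1)%N.

Section Shape.
Variables (R : realType) (n : nat).

(* Families indexed by 2 <= j <= ell, such as the R_j and the lambda_j, are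
   functions on nat whose other values are never used. *)
Variable Rs : nat -> R.

Definition lambda (s : seq nat) (j : nat) : R :=
  (nth 0%N s j.-1)%:R / (nth 0%N s 0)%:R.

Definition shape_in (lam : nat -> R) : Prop :=
  [/\ forall j, (2 <= j < ell n)%N -> lam j < lam j.+1,
      lam (ell n) <= Rs (ell n) &
      forall j, (2 <= j <= (ell n).-1)%N -> Rs j <= lam j].

Definition sh_in (L : fieldExtType rat) : Prop :=
  exists s : seq nat,
    [/\ sorted ltn s, size s = ell n,
        forall D, D \in s <-> radicands L D & shape_in (lambda s)].

(* A totally real multiquadratic field is normal, so all the embeddings of L
   have the same image: L, up to isomorphism, is a subfield of R. *)
Definition field_family (X : R) : set (set R) :=
  [set K | exists (L : splittingFieldType rat) (iota : {rmorphism L -> R}),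
     K = range iota /\
     [/\ totally_real_multiquadratic n L, ratr (field_disc L) <= X,
         unramified L 2 & sh_in L]].

Definition field_count (X : R) : nat := #|` fset_set (field_family X)|%N.

(* inner_int k b is the integral over a_(k+1) from R_(k+1) to b, ...,
   a_2 from R_2 to a_3. *)
Fixpoint inner_int (k : nat) (b : R) : R :=
  if k is k'.+1 then
    \int[lebesgue_measure]_(a in `[Rs k.+1, b]) (inner_int k' a / a)
  else 1.

Definition F_int : R :=
  \int[lebesgue_measure]_(a in `[Rs (ell n).-1, Rs (ell n)])
    (inner_int (ell n - 2) a / a).

End Shape.

Section Constants.
Variable n : nat.

Definition vbits (j : nat) : 'rV['F_2]_n :=
  \row_(t < n) (odd (j %/ 2 ^ t))%:R.

Definition dotv (i j : nat) : 'F_2 := (vbits i *m (vbits j)^T) 0 0.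

Definition dotZ (i j : nat) : int := (dotv i j : nat)%:Z.

(* Ordinals start at 0: the entry (j, i) below is the entry (j+1, i+1) of C,
   and the component g i is g_(i+1). *)
Definition Cmx : 'M[int]_(ell n) :=
  \matrix_(j, i) if j == 0%N :> nat then 1
                 else dotZ i.+1 j.+1 - dotZ i.+1 1.

Definition c_ell (R : realType) : R := `|(\det Cmx)%:~R|^-1.

Definition Dprod (g : {ffun 'I_(ell n) -> 'Z_4}) (j : nat) : 'Z_4 :=
  \prod_(i < ell n | dotv i.+1 j == 1) g i.

Definition omega1 : nat :=
  #|[set g : {ffun 'I_(ell n) -> 'Z_4} |
      [forall j : 'I_n, Dprod g (2 ^ j)%N == 1]]|%SET.

Definition euler_product (R : realType) : R :=
  limn (fun N : nat => \prod_(0 <= p < N | prime p && (2 < p)%N)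
    ((1 - p%:R^-1) ^+ ell n * (1 + (ell n)%:R / p%:R)) : R).

Definition C_ell (R : realType) : R :=
  omega1%:R * c_ell R * (ell n)`!%:R
    / (4 ^+ ell n * #|'GL_n(2)|%g%:R) * euler_product R.

End Constants.

(* Main.v *)
(* A field K_n of the family is determined by its radicands, and these are the
   products D_w of the g_i with <v_i, w> = 1, for a tuple of pairwise coprime
   squarefree g_i. Each field comes from #GL_n(F_2) tuples. Computing an integral
   basis locally shows that 2 is unramified iff all the radicands are 1 mod 4,
   and that the discriminant is then (g_1 ... g_l)^(2^(n-1)); so one counts the
   tuples with g_1 ... g_l <= T^l = X^(1/2^(n-1)) satisfying the shape condition.
   Splitting according to the permutation that sorts the radicands, the shape
   condition becomes a condition on C_s (ln g_i), where C_s is an integer matrix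
   with |det C_s| = |det C|.

   The admissible tuples have a density in boxes: truncate the local conditions
   to the primes below z, use the Chinese remainder theorem, and bound the error
   by the sum of 1/p^2 over p >= z. Cut the region into boxes
   [e^(eps k_i) T, e^(eps (k_i + 1)) T) with k in Z^l. Writing each w in Z^l
   uniquely as xi_x + C k, where x runs over |det C| cosets (Smith normal form),
   the region becomes, up to a bounded shift of w, the set of the w with w_0 <= 0
   and w_1 <= ... <= w_(l-1) a chain subject to the thresholds. The sum over w_0
   is a geometric series, and the number of chains is compared with the iterated
   integral cell by cell; finally eps tends to 0. *)

Require Import Defs.
From HB Require Import structures.
From mathcomp Require Import all_boot all_order all_algebra all_fingroup.
From mathcomp Require Import all_solvable all_field.
From mathcomp Require Import finmap.
From mathcomp Require Import all_classical all_reals all_analysis.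
From mathcomp Require Import measurable_realfun ring lra zify.

Set Implicit Arguments.
Unset Strict Implicit.
Unset Printing Implicit Defensive.

Import Order.TTheory GRing.Theory Num.Theory.
Import numFieldNormedType.Exports.

Local Open Scope classical_set_scope.
Local Open Scope ring_scope.

(** * Traces and integral bases *)

(** Discriminants are found one prime at a time. For odd [p], generators of which at most one is
    divisible by [p] span, through their products, a lattice of index prime to [p]; for 2 the
    products of the (1 + sqrt a) / 2 do. Ramification at 2 is read on the finite ring O / 2O:
    unramified forces it to be reduced, and y^4 = y there gives back the primes.

    In the counting, densities hold for finitely many fixed boxes as T grows, while w_0 is unbounded
    below. Only U layers of w_0 are kept: on the region no g_i exceeds the geometric mean by more
    than a bounded factor, so the tuples left out lie in a cube and number O(T^l exp(- eps U)). A
    box locates C_s (ln g_i) up to a number of steps of length eps that does not depend on eps.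
    Shifting w_0 and stretching the chains by a constant absorbs this error, at the cost of
    multiplying R_l by exp(+- const eps); continuity of the iterated integral removes that factor.
    As the first row of C_s is (1, ..., 1), the volume of a box depends on w_0 and the coset alone,
    so the sum over w splits into a geometric series and a number of chains.

    When R_(l-1) = R_l the constant is 0 and the equivalence asks for a count that vanishes
    outright. *)

Section Galois.
Variable L : splittingFieldType rat.
Hypothesis galL : galois 1 {:L}.
Local Notation G := 'Gal({:L} / 1)%g.
Implicit Types (y z : L) (s : gal_of {:L}).

Lemma gal_fixed_rat y : (forall s, s \in G -> s y = y) -> exists c : rat, y = c%:A.
Proof.
move=> fixy; have /vlineP[c ->] : y \in 1%VS; last by exists c.
have /galois_fixedField <- := galL.
by apply/fixedFieldP; [exact: memvf | ].
Qed.

Lemma ratA_inj : injective (fun c : rat => c%:A : L).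
Proof. by move=> c d /(fmorph_inj (in_alg L)). Qed.

Lemma field_traceD y z : field_trace (y + z) = field_trace y + field_trace z.
Proof.
rewrite /field_trace.
have -> : amulr (y + z) = amulr y + amulr z by exact: linearD.
have -> (f g : 'End(L)) (b : (\dim {:L}).-tuple L) : passmx.mxof b b (f + g) = passmx.mxof b b f + passmx.mxof b b g.
  by have := passmx.mxof_linear b b 1 f g; rewrite !scale1r.
exact: mxtraceD.
Qed.

Lemma field_traceZ (c : rat) y : field_trace (c *: y) = c * field_trace y.
Proof.
rewrite /field_trace.
have -> : amulr (c *: y) = c *: amulr y by exact: linearZ.
have -> (f : 'End(L)) (b : (\dim {:L}).-tuple L) : passmx.mxof b b (c *: f) = c *: passmx.mxof b b f.
  have E : passmx.mxof b b 0 = 0.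
    by have := passmx.mxof_linear b b (-1) 0 0; rewrite scaler0 addr0 scaleN1r addNr.
  by have := passmx.mxof_linear b b c f 0; rewrite E !addr0.
exact: mxtraceZ.
Qed.

Lemma field_trace_sum (I : Type) (r : seq I) (P : pred I) (f : I -> L) :
  field_trace (\sum_(i <- r | P i) f i) = \sum_(i <- r | P i) field_trace (f i).
Proof.
elim/big_rec2: _ => [|i t u _ <-]; last by rewrite field_traceD.
by have := field_traceZ 0 0; rewrite scale0r mul0r.
Qed.

Lemma field_trace1 : field_trace (1 : L) = (\dim {:L})%:R.
Proof.
rewrite /field_trace rmorph1 [X in \tr X](_ : _ = 1%:M) ?mxtrace1 //.
exact: (passmx.mxof1 (basis_free (vbasisP _))).
Qed.

(** Multiplication by [s y] is multiplication by [y] conjugated by [s]. *)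
Lemma field_trace_galV s y : s \in G -> field_trace (s y) = field_trace y.
Proof.
move=> sG; have bP := vbasisP {:L}.
have E : (amulr (s y) \o s)%VF = (s \o amulr y)%VF.
  by apply/lfunP => z; rewrite !comp_lfunE /= !lfunE /= rmorphM.
have E2 : (s \o s^-1)%VF = \1%VF.
  have /(lker0_compfV) := AEnd_lker0 s; exact.
have E1 : (s^-1 \o s)%VF = \1%VF.
  have /(lker0_compVf) := AEnd_lker0 s; exact.
have D : amulr (s y) = (s \o amulr y \o s^-1)%VF.
  by rewrite -E -comp_lfunA E2 comp_lfun1r.
have C (f g : 'End(L)) : passmx.mxof (vbasis {:L}) (vbasis {:L}) (f \o g)%VF =
    passmx.mxof (vbasis {:L}) (vbasis {:L}) g *m passmx.mxof (vbasis {:L}) (vbasis {:L}) f.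
  exact: passmx.mxof_comp.
rewrite /field_trace D !C mxtrace_mulC -mulmxA -C E1.
by rewrite (passmx.mxof1 (basis_free bP)) mulmx1.
Qed.

Lemma card_gal : #|G| = \dim {:L}.
Proof. by rewrite -(galois_dim galL) dimv1 divn1. Qed.

(* Averaging over the Galois group: every conjugate has the same trace. *)
Lemma field_trace_gal y : (field_trace y)%:A = \sum_(s in G) s y.
Proof.
have [|t Et] := @gal_fixed_rat (\sum_(s in G) s y).
  move=> s sG; rewrite rmorph_sum /= [RHS](reindex_acts 'R _ sG) ?astabsR //=.
  by apply: eq_bigr => r _; rewrite galM ?memvf.
rewrite Et; congr (_%:A).
have H : field_trace (\sum_(s in G) s y) = (\dim {:L})%:R * field_trace y.
  rewrite field_trace_sum (eq_bigr (fun=> field_trace y)) => [|s sG].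
    by rewrite sumr_const card_gal mulr_natl.
  by rewrite field_trace_galV.
move: H; rewrite Et field_traceZ field_trace1 => /esym.
rewrite mulrC; apply: mulIf.
by rewrite pnatr_eq0 -lt0n adim_gt0.
Qed.

End Galois.

Section IntRing.
Variable L : splittingFieldType rat.
Implicit Types (y z : L).
Local Notation O := (@int_ring L).

Lemma intr_int_ring (m : int) : O m%:~R.
Proof. exact: (integral_id (intr : {rmorphism int -> L})). Qed.

Lemma natr_int_ring (m : nat) : O m%:R.
Proof. exact: (integral_nat (intr : {rmorphism int -> L})). Qed.

Lemma int_ringD y z : O y -> O z -> O (y + z).
Proof. exact: (@integral_add _ _ (intr : {rmorphism int -> L})). Qed.

Lemma int_ringB y z : O y -> O z -> O (y - z).
Proof. exact: (@integral_sub _ _ (intr : {rmorphism int -> L})). Qed.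

Lemma int_ringM y z : O y -> O z -> O (y * z).
Proof. exact: (@integral_mul _ _ (intr : {rmorphism int -> L})). Qed.

Lemma int_ringX y k : O y -> O (y ^+ k).
Proof.
move=> Oy; elim: k => [|k IH]; first by rewrite expr0; exact: (natr_int_ring 1).
by rewrite exprS; apply: int_ringM.
Qed.

Lemma int_ring_sum (I : Type) (r : seq I) (P : pred I) (f : I -> L) :
  (forall i, P i -> O (f i)) -> O (\sum_(i <- r | P i) f i).
Proof.
by move=> Of; elim/big_ind: _ => //; [exact: (natr_int_ring 0) | exact: int_ringD].
Qed.

Lemma int_ring_prod (I : Type) (r : seq I) (P : pred I) (f : I -> L) :
  (forall i, P i -> O (f i)) -> O (\prod_(i <- r | P i) f i).
Proof.
by move=> Of; elim/big_ind: _ => //; [exact: (natr_int_ring 1) | exact: int_ringM].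
Qed.

Lemma int_ringMz y (m : int) : O y -> O (y *~ m).
Proof. by move=> Oy; rewrite -mulrzr; apply: int_ringM => //; exact: intr_int_ring. Qed.

Lemma int_ring_root y (p : {poly int}) : p \is monic ->
  (map_poly intr p).[y] = 0 -> O y.
Proof. by move=> pm py; exists p => //; apply/rootP. Qed.

Lemma int_ring_sqr y : O (y ^+ 2) -> O y.
Proof.
move=> Oy.
apply: (@integral_root_monic _ _ (intr : {rmorphism int -> L}) y ('X^2 - (y ^+ 2)%:P)).
- by rewrite monicXnsubC.
- by apply/rootP; rewrite !hornerE subrr.
- apply/(integral_poly (intr : {rmorphism int -> L})) => i.
  rewrite coefB coefXn coefC; apply: int_ringB; first exact: natr_int_ring.
  by case: ifP => // _; exact: (natr_int_ring 0).
Qed.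

Lemma int_ring_gal (s : gal_of {:L}) y : O y -> O (s y).
Proof.
case=> p pm /rootP py; apply: (int_ring_root pm).
rewrite -[RHS](rmorph0 s) -py -horner_map /=; congr (_.[_]).
rewrite -map_poly_comp; apply: eq_map_poly => i /=.
by rewrite rmorph_int.
Qed.

Lemma int_ring_rat (c : rat) : O (c%:A) -> c \in Num.int.
Proof.
case=> p pm /rootP py.
have pc : root (map_poly (intr : int -> rat) p) c.
  apply/rootP; apply: (fmorph_inj (in_alg L)); rewrite rmorph0 -[RHS]py.
  rewrite -horner_map /= -map_poly_comp; congr (_.[_]).
  by apply: eq_map_poly => i /=; rewrite scaler_int.
(* In [algC] a rational algebraic integer is an integer; the monic equation of [c] is carried
   there. *)
have Ac : (ratr c : algC) \in Aint.
  apply: (@root_monic_Aint (map_poly (intr : int -> algC) p)).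
  - move/rootP : pc => pc; apply/rootP; rewrite -[RHS](rmorph0 (ratr : {rmorphism rat -> algC})) -pc.
    rewrite -horner_map /= -map_poly_comp; congr (_.[_]).
    by apply: eq_map_poly => i /=; rewrite rmorph_int.
  - exact: monic_map.
  - by apply/polyOverP => i; rewrite coef_map /= intr_int.
have := Cint_rat_Aint (Crat_rat c) Ac.
case/intrP => m Em; apply/intrP; exists m.
by apply: (fmorph_inj (ratr : {rmorphism rat -> algC})); rewrite /= Em rmorph_int.
Qed.

Lemma field_trace_int (galL : galois 1 {:L}) y : O y -> field_trace y \in Num.int.
Proof.
move=> Oy; apply: int_ring_rat; rewrite (field_trace_gal galL).
by apply: int_ring_sum => s _; exact: int_ring_gal.
Qed.

End IntRing.

Section Discriminant.
Variable L : splittingFieldType rat.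
Local Notation O := (@int_ring L).
Local Notation N := (\dim {:L}).
Implicit Types (b : N.-tuple L) (y z : L).

Definition trace_mx b : 'M[rat]_N := \matrix_(i, j) field_trace (b`_i * b`_j).

Lemma disc_basisE b : disc_basis b = \det (trace_mx b). Proof. by []. Qed.

Lemma trace_mx_change b b' (T : 'M[rat]_N) :
  (forall i : 'I_N, b'`_i = \sum_j T i j *: b`_j) ->
  trace_mx b' = T *m trace_mx b *m T^T.
Proof.
move=> E; apply/matrixP => i j; rewrite !mxE !E mulr_suml field_trace_sum.
rewrite (eq_bigr (fun k => \sum_l T i k * T j l * field_trace (b`_k * b`_l))); last first.
  move=> k _; rewrite mulr_sumr field_trace_sum; apply: eq_bigr => l _.
  by rewrite -scalerAl -scalerAr !field_traceZ mulrA.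
rewrite exchange_big /=; apply: eq_bigr => l _; rewrite !mxE mulr_suml.
by apply: eq_bigr => k _; rewrite !mxE mulrAC.
Qed.

Lemma disc_change b b' (T : 'M[rat]_N) :
  (forall i : 'I_N, b'`_i = \sum_j T i j *: b`_j) ->
  disc_basis b' = (\det T) ^+ 2 * disc_basis b.
Proof.
move=> /trace_mx_change E; rewrite !disc_basisE E !det_mulmx det_tr.
by rewrite expr2 mulrAC.
Qed.

(** The coefficients of a linear relation form a row vector killed by the trace matrix. *)
Lemma basis_of_disc b : disc_basis b != 0 -> basis_of {:L} b.
Proof.
rewrite disc_basisE -unitfE -unitmxE => U.
rewrite basisEfree subvf size_tuple leqnn !andbT.
apply/freeP => k k0 i.
pose u : 'rV[rat]_N := \row_j k j.
have u0 : u *m trace_mx b = 0.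
  apply/rowP => j; rewrite !mxE -[RHS](_ : field_trace (0 * b`_j) = 0); last first.
    by rewrite mul0r -(scale0r 0) field_traceZ mul0r.
  rewrite -{1}k0 mulr_suml field_trace_sum; apply: eq_bigr => l _.
  by rewrite !mxE -scalerAl field_traceZ.
have /rowP/(_ i) : u = 0 by rewrite -(mulmxK U u) u0 mul0mx.
by rewrite !mxE.
Qed.

Hypothesis galL : galois 1 {:L}.

Lemma disc_int b : (forall i : 'I_N, O b`_i) -> disc_basis b \in Num.int.
Proof.
move=> Ob; rewrite disc_basisE /determinant; apply: rpred_sum => s _.
rewrite rpredM ?rpredX ?rpredN1 //; apply: rpred_prod => i _; rewrite mxE.
by apply: field_trace_int => //; apply: int_ringM.
Qed.

End Discriminant.

Section IntegralBasis.
Variable L : splittingFieldType rat.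
Local Notation O := (@int_ring L).
Local Notation N := (\dim {:L}).
Implicit Types (b : N.-tuple L) (y z : L).
Hypothesis galL : galois 1 {:L}.

Lemma det_replace_row (m : nat) (i : 'I_m) (c : 'I_m -> rat) :
  \det (\matrix_(j, k) (if j == i then c k else (j == k)%:R)) = c i.
Proof.
set T := \matrix_(_, _) _.
rewrite (expand_det_col T i) (bigD1 i) //= big1 => [|j ji]; last first.
  by rewrite !mxE (negPf ji) mul0r.
rewrite addr0 !mxE eqxx /cofactor exprD -expr2 sqrr_sign mul1r.
rewrite [X in \det X](_ : _ = 1%:M) ?det1 ?mulr1 //.
apply/matrixP => j k; rewrite !mxE (eq_sym _ i) (negPf (neq_lift i j)).
by rewrite (inj_eq lift_inj).
Qed.

(* An integral rational basis of least |discriminant| generates the ring of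
   integers: a fractional coordinate would allow a smaller one. *)
Lemma integral_basis_exists b0 : (forall i : 'I_N, O b0`_i) ->
  disc_basis b0 != 0 -> exists b, is_integral_basis b /\ disc_basis b != 0.
Proof.
move=> Ob0 d0.
have absz b : (forall i : 'I_N, O b`_i) -> exists m : nat, `|disc_basis b| = m%:R.
  move=> Ob; have /intrP[m ->] := disc_int galL Ob.
  by exists `|m|%N; rewrite -intr_norm -abszE -pmulrn.
pose P := [pred m : nat | `[< (0 < m)%N /\ exists b, (forall i : 'I_N, O b`_i) /\ `|disc_basis b| = m%:R >]].
have exP : exists m, P m.
  have [m Em] := absz _ Ob0; exists m; apply/asboolP; split; last by exists b0.
  by rewrite -(ltr_nat rat) -Em normr_gt0.
case: (ex_minnP exP) => m /asboolP[m0 [b [Ob Em]]] minm.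
have db : disc_basis b != 0 by rewrite -normr_gt0 Em ltr0n.
have bas := basis_of_disc db.
exists b; split => //; split => // x; split; last first.
  move=> [c ->]; apply: int_ring_sum => i _; exact: int_ringMz.
move=> Ox.
pose c (i : 'I_N) : rat := coord b i x.
have Ex : x = \sum_(i < N) c i *: b`_i by exact: (coord_basis bas (memvf x)).
suff /(_ _)/intrP-/choice[d Ed] i : c i \in Num.int.
  exists d; rewrite Ex; apply: eq_bigr => i _.
  by rewrite Ed scaler_int.
apply: contrapT => /negP ci.
pose f := c i - (Num.floor (c i))%:~R.
have f0 : f != 0.
  by rewrite subr_eq0; apply: contra ci => /eqP ->; exact: intr_int.
have f1 : 0 <= f < 1.
  rewrite /f subr_ge0 floor_le /= ltrBlDl -[X in _ + X]/(1%:~R) -intrD.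
  exact: floorD1_gt.
pose c' j := if j == i then f else c j.
pose b' := [tuple if j == i then x - b`_i *~ Num.floor (c i) else b`_j | j < N].
have Eb' (j : 'I_N) : b'`_j = if j == i then x - b`_i *~ Num.floor (c i) else b`_j.
  by rewrite -tnth_nth tnth_mktuple.
have Ob' (j : 'I_N) : O b'`_j.
  by rewrite Eb'; case: ifP => // _; apply: int_ringB => //; apply: int_ringMz.
have := @disc_change _ b b' (\matrix_(j, k) (if j == i then c' k else (j == k)%:R)) _.
rewrite det_replace_row /c' eqxx => E.
have {}E : disc_basis b' = f ^+ 2 * disc_basis b.
  apply: E => j; rewrite Eb'; case: (eqVneq j i) => [->|ji].
    rewrite {1}Ex (bigD1 i) //= [RHS](bigD1 i) //= !mxE !eqxx.
    rewrite /f scalerBl scaler_int addrAC; congr (_ + _).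
    by apply: eq_bigr => k ki; rewrite !mxE eqxx (negPf ki).
  rewrite (bigD1 j) //= !mxE (negPf ji) eqxx scale1r big1 ?addr0 // => k kj.
  by rewrite !mxE (negPf ji) eq_sym (negPf kj) scale0r.
have [m' Em'] := absz _ Ob'.
have m'0 : (0 < m')%N by rewrite -(ltr_nat rat) -Em' normr_gt0 E mulf_neq0 ?expf_neq0.
have := minm m'; rewrite leqNgt => /(_ _)/negP; apply.
  by apply/asboolP; split => //; exists b'.
rewrite -(ltr_nat rat) -Em' E normrM Em gtr_pMl ?ltr0n //.
have /andP[f2 f3] := f1.
by rewrite ger0_norm ?exprn_ge0 // expr_lt1.
Qed.

End IntegralBasis.

(** * Fields generated by square roots *)

Section SqrtGens.
Variables (L : splittingFieldType rat) (n : nat).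
Local Notation O := (@int_ring L).
Local Notation N := (\dim {:L}).
Local Notation G := 'Gal({:L} / 1)%g.
Implicit Types (a : 'I_n -> nat) (x : 'I_n -> L) (y z : L) (S T : {set 'I_n}).
Hypothesis galL : galois 1 {:L}.

(** That the [x i] generate [L] is expressed on the Galois side: only the identity fixes all of
    them. With the order of the group, this makes every choice of signs of the [x i] come from
    exactly one automorphism. *)
Definition sqrt_gens a x := [/\ forall i, (0 < a i)%N,
  forall i, x i ^+ 2 = (a i)%:R,
  forall s, s \in G -> (forall i, s (x i) = x i) -> s = 1%g &
  #|G| = (2 ^ n)%N].

Definition setprod x S := \prod_(i in S) x i.

(** Summed over [S], the products collapse to the product over [i] of [s (b0 i) + s (b1 i) * al i],
    which is 1 for [s = 1] and 0 for every other [s]. This computes the dual basis of the products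
    of the [al i] once, for both [setprod_coord] and [half_coord]. *)
Lemma reproducing (al b0 b1 : 'I_n -> L) y :
  (forall i, b0 i + b1 i * al i = 1) ->
  (forall s, s \in G -> s != 1%g -> exists i, s (b0 i) + s (b1 i) * al i = 0) ->
  y = \sum_(S in {set 'I_n})
    field_trace (y * \prod_i (if i \in S then b1 i else b0 i)) *: setprod al S.
Proof.
move=> h1 h0.
rewrite (eq_bigr (fun S : {set 'I_n} => \sum_(s in G) s y *
    \prod_i (if i \in S then s (b1 i) * al i else s (b0 i)))); last first.
  move=> S _; rewrite -mulr_algl (field_trace_gal galL) mulr_suml.
  apply: eq_bigr => s _; rewrite rmorphM rmorph_prod -mulrA; congr (_ * _).
  rewrite /setprod [X in _ * X]big_mkcond -big_split /=.
  by apply: eq_bigr => i _; case: ifP; rewrite ?mulr1.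
rewrite exchange_big /= (bigD1 1%g) ?group1 //= [X in _ + X]big1 ?addr0 => [|s /andP[sG s1]].
  rewrite -mulr_sumr -bigA_distr big1 ?mulr1 ?gal_id // => i _.
  by rewrite /= !gal_id addrC h1.
rewrite -mulr_sumr -bigA_distr.
by have [i Ei] := h0 s sG s1; rewrite (bigD1 i) //= addrC Ei mul0r mulr0.
Qed.

Section Fixed.
Variables (a : 'I_n -> nat) (x : 'I_n -> L).
Hypothesis gx : sqrt_gens a x.

Lemma gens_gt0 i : (0 < a i)%N. Proof. by case: gx. Qed.
Lemma gens_sqr i : x i ^+ 2 = (a i)%:R. Proof. by case: gx. Qed.

Lemma gens_neq0 i : x i != 0.
Proof.
rewrite -sqrf_eq0 gens_sqr -(rmorph_nat (in_alg L)) fmorph_eq0 pnatr_eq0.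
by rewrite -lt0n gens_gt0.
Qed.

Lemma gens_gal (s : gal_of {:L}) i : s (x i) = x i \/ s (x i) = - x i.
Proof.
have : s (x i) ^+ 2 = x i ^+ 2 by rewrite -rmorphXn /= gens_sqr rmorph_nat.
by move=> /eqP; rewrite eqf_sqr => /orP[] /eqP ->; [left | right].
Qed.

Lemma gens_flip s : s \in G -> s != 1%g -> exists i, s (x i) = - x i.
Proof.
move=> sG /eqP s1; apply: contrapT => noflip; apply: s1.
case: gx => _ _ + _; apply => // i.
by have [//|sx] := gens_gal s i; case: noflip; exists i.
Qed.

Lemma int_ring_gens i : O (x i).
Proof. by apply: int_ring_sqr; rewrite gens_sqr; exact: natr_int_ring. Qed.

Lemma int_ring_setprod S : O (setprod x S).
Proof. by apply: int_ring_prod => i _; exact: int_ring_gens. Qed.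

Lemma setprod_sqr S : setprod x S ^+ 2 = (\prod_(i in S) a i)%:R.
Proof.
rewrite /setprod -prodrXl natr_prod.
by apply: eq_bigr => i _; rewrite gens_sqr.
Qed.

Lemma setprod_neq0 S : setprod x S != 0.
Proof. by apply/prodf_neq0 => i _; exact: gens_neq0. Qed.

Lemma card_dim : N = #|{set 'I_n}|.
Proof. by rewrite -(card_gal galL) -cardsT -powersetT card_powerset cardsT card_ord; case: gx. Qed.

(* [y] in the basis of the products of the [x i]; the coordinate is
   [Tr (y / (2^n x_S))]. *)
Lemma setprod_coord y :
  y = \sum_(S in {set 'I_n})
    (field_trace (y * setprod x S) / (2 ^ n * \prod_(i in S) a i)%:R) *: setprod x S.
Proof.
rewrite {1}(@reproducing x (fun=> 2%:R^-1) (fun i => (2%:R * x i)^-1) y); first last.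
- move=> s sG s1; have [i Ei] := gens_flip sG s1; exists i.
  rewrite !fmorphV rmorphM rmorph_nat /= Ei mulrN invrN mulNr invfM.
  by rewrite mulfVK ?gens_neq0 // subrr.
- move=> i; rewrite invfM mulfVK ?gens_neq0 // -mulr2n -[_ *+ 2]mulr_natl.
  by rewrite divff // -(rmorph_nat (in_alg L)) fmorph_eq0 pnatr_eq0.
apply: eq_bigr => S _; congr (_ *: _).
rewrite -[LHS]mulr1 -[X in _ * X](@divff _ (2 ^ n * \prod_(i in S) a i)%:R); last first.
  by rewrite pnatr_eq0 muln_eq0 expn_eq0 /= -lt0n prodn_gt0 // => i; exact: gens_gt0.
rewrite mulrA; congr (_ / _); rewrite mulrC -field_traceZ; congr (field_trace _).
rewrite scalerAr; congr (_ * _).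
rewrite scaler_nat -[LHS]mulr_natl natrM natr_prod natrX.
have -> : 2%:R ^+ n = \prod_(i < n) 2%:R :> L by rewrite prodr_const card_ord.
have L2 : 2%:R != 0 :> L by rewrite -(rmorph_nat (in_alg L)) fmorph_eq0.
rewrite [X in _ * X * _]big_mkcond /setprod [RHS]big_mkcond -!big_split /=.
apply: eq_bigr => i _; case: ifP => _.
  by rewrite -gens_sqr expr2; field; rewrite gens_neq0 L2.
by rewrite mulr1 divff.
Qed.

End Fixed.

(** Bases are tuples indexed by ['I_N], whereas the natural indices of the products are subsets of
    ['I_n]; these maps translate. *)
Definition set_of_ord (E : N = #|{set 'I_n}|) (i : 'I_N) : {set 'I_n} :=
  enum_val (cast_ord E i).

Definition ord_of_set (E : N = #|{set 'I_n}|) (S : {set 'I_n}) : 'I_N :=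
  cast_ord (esym E) (enum_rank S).

Lemma set_of_ordK E : cancel (set_of_ord E) (ord_of_set E).
Proof. by move=> i; rewrite /set_of_ord /ord_of_set enum_valK cast_ordK. Qed.

Lemma ord_of_setK E : cancel (ord_of_set E) (set_of_ord E).
Proof. by move=> S; rewrite /set_of_ord /ord_of_set cast_ordKV enum_rankK. Qed.

Lemma sum_set_of_ord E (V : nmodType) (f : {set 'I_n} -> V) :
  \sum_(S in {set 'I_n}) f S = \sum_(i < N) f (set_of_ord E i).
Proof.
rewrite (reindex (set_of_ord E)) //=; exists (ord_of_set E) => ? _.
  exact: set_of_ordK.
exact: ord_of_setK.
Qed.

Lemma prod_set_of_ord E (V : comPzSemiRingType) (f : {set 'I_n} -> V) :
  \prod_(S in {set 'I_n}) f S = \prod_(i < N) f (set_of_ord E i).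
Proof.
rewrite (reindex (set_of_ord E)) //=; exists (ord_of_set E) => ? _.
  exact: set_of_ordK.
exact: ord_of_setK.
Qed.

Definition fam_tuple E (f : {set 'I_n} -> L) : N.-tuple L :=
  [tuple f (set_of_ord E i) | i < N].

Lemma fam_tupleE E f (i : 'I_N) : (fam_tuple E f)`_i = f (set_of_ord E i).
Proof. by rewrite -tnth_nth tnth_mktuple. Qed.

Lemma fam_tuple_basis E f :
  (forall y, exists c : {set 'I_n} -> rat, y = \sum_(S in {set 'I_n}) c S *: f S) ->
  basis_of {:L} (fam_tuple E f).
Proof.
move=> gen; rewrite basisEdim size_tuple leqnn andbT.
apply/subvP => y _; have [c ->] := gen y.
rewrite (sum_set_of_ord E); apply: memv_suml => i _; apply: memvZ.
by rewrite -fam_tupleE; apply: memv_span; rewrite mem_nth ?size_tuple.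
Qed.

Lemma fam_tuple_free E f (c d : {set 'I_n} -> rat) : basis_of {:L} (fam_tuple E f) ->
  \sum_(S in {set 'I_n}) c S *: f S = \sum_(S in {set 'I_n}) d S *: f S -> c =1 d.
Proof.
move=> /basis_free /freeP fr; rewrite !(sum_set_of_ord E) => /eqP.
rewrite -subr_eq0 -sumrB => /eqP cd S.
apply/eqP; rewrite -subr_eq0 -(ord_of_setK E S); apply/eqP.
apply: (fr (fun i => c (set_of_ord E i) - d (set_of_ord E i))).
by rewrite -[RHS]cd; apply: eq_bigr => i _; rewrite scalerBl fam_tupleE.
Qed.

End SqrtGens.

(** * Congruences modulo p in the ring of integers *)

Section CongO.
Variable L : splittingFieldType rat.
Local Notation O := (@int_ring L).
Implicit Types (y z : L).

Definition congO (p : nat) y z := exists2 w, O w & y - z = p%:R * w.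

Lemma congO_refl p y : congO p y y.
Proof. by exists 0; [exact: (natr_int_ring L 0) | rewrite subrr mulr0]. Qed.

Lemma congO_sym p y z : congO p y z -> congO p z y.
Proof.
move=> [w Ow E]; exists (- w); last by rewrite mulrN -E opprB.
by rewrite -[- w]add0r; apply: int_ringB => //; exact: (natr_int_ring L 0).
Qed.

Lemma congO_trans p y z t : congO p y z -> congO p z t -> congO p y t.
Proof.
move=> [w Ow E] [w' Ow' E']; exists (w + w'); first exact: int_ringD.
by rewrite mulrDr -E -E' addrA subrK.
Qed.

Lemma congOD p y y' z z' : congO p y y' -> congO p z z' -> congO p (y + z) (y' + z').
Proof.
move=> [w Ow E] [w' Ow' E']; exists (w + w'); first exact: int_ringD.
by rewrite mulrDr -E -E' opprD addrACA.
Qed.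

Lemma congOM p y y' z z' : O y -> O z' ->
  congO p y y' -> congO p z z' -> congO p (y * z) (y' * z').
Proof.
move=> Oy Oz' [w Ow E] [w' Ow' E']; exists (y * w' + w * z').
  by apply: int_ringD; apply: int_ringM.
rewrite mulrDr mulrCA -E' mulrA -E; ring.
Qed.

Lemma congO_sum p (I : Type) (r : seq I) (P : pred I) (f g : I -> L) :
  (forall i, P i -> congO p (f i) (g i)) ->
  congO p (\sum_(i <- r | P i) f i) (\sum_(i <- r | P i) g i).
Proof.
by move=> E; elim/big_rec2: _ => [|i *]; [exact: congO_refl | apply: congOD; auto].
Qed.

Lemma congO_prod p (I : Type) (r : seq I) (P : pred I) (f g : I -> L) :
  (forall i, P i -> O (f i)) -> (forall i, P i -> O (g i)) ->
  (forall i, P i -> congO p (f i) (g i)) ->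
  congO p (\prod_(i <- r | P i) f i) (\prod_(i <- r | P i) g i).
Proof.
move=> Of Og E.
suff [] : O (\prod_(i <- r | P i) g i) /\
  congO p (\prod_(i <- r | P i) f i) (\prod_(i <- r | P i) g i) by [].
elim/big_rec2: _ => [|i y z Pi [Oz IH]].
  by split; [exact: (natr_int_ring L 1) | exact: congO_refl].
by split; [apply: int_ringM; auto | apply: congOM; auto].
Qed.

Lemma congOX p y z k : O y -> O z -> congO p y z -> congO p (y ^+ k) (z ^+ k).
Proof.
move=> Oy Oz E; elim: k => [|k IH]; first by rewrite !expr0; exact: congO_refl.
by rewrite !exprS; apply: congOM => //; exact: int_ringX.
Qed.

Lemma frobeniusO_D p y z : prime p -> O y -> O z ->
  congO p ((y + z) ^+ p) (y ^+ p + z ^+ p).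
Proof.
move=> pp Oy Oz; have p0 := prime_gt0 pp.
case: p pp p0 => // p pp _.
(* The prime is now [p.+1]; it divides every inner binomial coefficient, and the witness collects
   the quotients. *)
exists (\sum_(i < p) (y ^+ (p.+1 - i.+1) * z ^+ i.+1) *+ ('C(p.+1, i.+1) %/ p.+1)).
  apply: int_ring_sum => i _; rewrite -mulr_natl; apply: int_ringM.
    exact: natr_int_ring.
  by apply: int_ringM; apply: int_ringX.
rewrite exprDn big_ord_recl big_ord_recr /= subn0 expr0 mulr1 bin0 mulr1n.
rewrite /bump /= add1n subnn expr0 mul1r binn mulr1n.
have -> (u v t : L) : u + (v + t) - (u + t) = v by ring.
rewrite mulr_sumr.
apply: eq_bigr => i _; rewrite /bump /= add1n mulr_natl -mulrnA divnK //.
by apply: prime_dvd_bin => //; have := ltn_ord i; lia.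
Qed.

Lemma frobeniusO_sum p (I : Type) (r : seq I) (P : pred I) (f : I -> L) :
  prime p -> (forall i, P i -> O (f i)) ->
  congO p ((\sum_(i <- r | P i) f i) ^+ p) (\sum_(i <- r | P i) f i ^+ p).
Proof.
move=> pp Of.
suff [] : O (\sum_(i <- r | P i) f i) /\
  congO p ((\sum_(i <- r | P i) f i) ^+ p) (\sum_(i <- r | P i) f i ^+ p) by [].
elim/big_rec2: _ => [|i y z Pi [Oz IH]].
  split; [exact: (natr_int_ring L 0) | rewrite expr0n].
  by rewrite -[p]prednK ?prime_gt0 //=; exact: congO_refl.
split; first by apply: int_ringD; auto.
apply: congO_trans (frobeniusO_D pp (Of i Pi) Oz) _.
by apply: congOD => //; exact: congO_refl.
Qed.

End CongO.

(** * Index of a lattice and valuation of the discriminant *)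

Section Index.
Variables (L : splittingFieldType rat) (n : nat).
Local Notation O := (@int_ring L).
Local Notation N := (\dim {:L}).
Hypothesis galL : galois 1 {:L}.

(** [t] is the index of the lattice spanned by [f], the absolute determinant of the matrix [Tm]
    writing [f] in [b]. The matrix [Um] writing [b] times [m] in [f] satisfies [Um *m Tm = m],
    whence [t] divides [m ^ N]. *)
Lemma int_basis_disc_index (E : N = #|{set 'I_n}|) (f : {set 'I_n} -> L)
    (b : N.-tuple L) (m : nat) :
  is_integral_basis b -> (forall S, O (f S)) -> basis_of {:L} (fam_tuple E f) ->
  (forall y, O y -> exists e : {set 'I_n} -> int,
     y *+ m = \sum_(S in {set 'I_n}) f S *~ e S) ->
  exists t : nat, disc_basis (fam_tuple E f) = (t ^ 2)%:R * disc_basis b /\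
    (t %| m ^ N)%N.
Proof.
move=> [bb intb] Of bf gen.
have /choice[T ET] (i : 'I_N) : exists c : 'I_N -> int,
    (fam_tuple E f)`_i = \sum_(j < N) b`_j *~ c j.
  by apply/(intb _); rewrite fam_tupleE.
have Ob (i : 'I_N) : O b`_i.
  apply/(intb _); exists (fun j => (j == i)%:R); rewrite (bigD1 i) //= eqxx.
  by rewrite big1 ?addr0 // => j /negPf ->.
have /choice[U EU] (i : 'I_N) : exists e : {set 'I_n} -> int,
    b`_i *+ m = \sum_(S in {set 'I_n}) f S *~ e S by apply: gen.
pose Tm : 'M[int]_N := \matrix_(i, j) T i j.
pose Um : 'M[int]_N := \matrix_(i, j) U i (set_of_ord E j).
have UT : Um *m Tm = (m%:Z)%:M.
  apply/matrixP => i j; apply/eqP; rewrite -subr_eq0 -(intr_eq0 rat); apply/eqP.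
  have /freeP fr := basis_free bb.
  apply: (fr (fun j => ((Um *m Tm) i j - (m%:Z)%:M i j)%:~R) _ j).
  rewrite (eq_bigr (fun k : 'I_N => b`_k *~ (Um *m Tm) i k - b`_k *~ (m%:Z)%:M i k)); last first.
    by move=> k _; rewrite scaler_int mulrzBr.
  rewrite sumrB; apply/eqP; rewrite subr_eq0; apply/eqP.
  transitivity (b`_i *+ m).
    rewrite EU (sum_set_of_ord E) [RHS](eq_bigr (fun k => \sum_(j < N) b`_j *~ (T k j * U i (set_of_ord E k)))); last first.
      move=> k _; rewrite -fam_tupleE ET mulrz_suml.
      by apply: eq_bigr => l _; rewrite mulrzA.
    rewrite [RHS]exchange_big /=; apply: eq_bigr => k _.
    rewrite mxE mulrz_sumr; apply: eq_bigr => l _.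
    by rewrite !mxE mulrC.
  rewrite (bigD1 i) //= mxE eqxx mulr1n big1 ?addr0 // => k /negPf ki.
  by rewrite mxE eq_sym ki.
have dUT : \det Um * \det Tm = (m ^ N)%:Z.
  by rewrite -det_mulmx UT det_scalar -natz -natrX natz.
exists `|\det Tm|%N; split; last first.
  have := congr1 absz dUT; rewrite abszM absz_nat => <-.
  exact: dvdn_mull.
rewrite (@disc_change _ b _ (map_mx intr Tm)) => [|i].
  rewrite det_map_mx; congr (_ * _).
  by rewrite natrX natr_absz intr_norm real_normK ?num_real.
by rewrite ET; apply: eq_bigr => j _; rewrite !mxE scaler_int.
Qed.

End Index.

Section DiscValue.
Variables (L : splittingFieldType rat) (n : nat).
Local Notation O := (@int_ring L).
Local Notation N := (\dim {:L}).
Hypothesis galL : galois 1 {:L}.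

Lemma int_basis_mem (b : N.-tuple L) (i : 'I_N) : is_integral_basis b -> O b`_i.
Proof.
move=> [_ intb]; apply/(intb _); exists (fun j => (j == i)%:R).
by rewrite (bigD1 i) //= eqxx big1 ?addr0 // => j /negPf ->.
Qed.

Section Fixed.
Variables (a : 'I_n -> nat) (x : 'I_n -> L).
Hypothesis gx : sqrt_gens a x.
Local Notation aS := (fun S : {set 'I_n} => \prod_(i in S) a i)%N.

Lemma setprod_basis E : basis_of {:L} (fam_tuple E (setprod x)).
Proof.
apply: fam_tuple_basis => y.
by exists (fun S => field_trace (y * setprod x S) / (2 ^ n * aS S)%:R); exact: setprod_coord.
Qed.

Lemma aS_gt0 S : (0 < 2 ^ n * aS S)%N.
Proof. by rewrite muln_gt0 expn_gt0 prodn_gt0 // => i; exact: gens_gt0 gx _. Qed.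

(** Uniqueness of coordinates: [setprod x T] is its own expansion, and [setprod_coord] expresses the
    coordinates by these traces. *)
Lemma setprod_trace S T : field_trace (setprod x T * setprod x S) =
  if S == T then (2 ^ n * aS S)%:R else 0.
Proof.
have E := card_dim galL gx.
have H := @fam_tuple_free _ _ _ (setprod x)
  (fun S => field_trace (setprod x T * setprod x S) / (2 ^ n * aS S)%:R)
  (fun S => (S == T)%:R) (setprod_basis E).
have {}H := H _ S.
rewrite -[LHS](@divfK _ (2 ^ n * aS S)%:R); last by rewrite pnatr_eq0 -lt0n aS_gt0.
rewrite H; first by case: ifP; rewrite ?mul1r ?mul0r.
rewrite -setprod_coord // (bigD1 T) //= eqxx scale1r big1 ?addr0 // => U /negPf ->.
by rewrite scale0r.
Qed.

Lemma disc_setprod E : disc_basis (fam_tuple E (setprod x)) =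
  (\prod_(S in {set 'I_n}) (2 ^ n * aS S))%N%:R.
Proof.
rewrite disc_basisE [trace_mx _](_ : _ = diag_mx (\row_i (2 ^ n * aS (set_of_ord E i))%:R)).
  rewrite det_diag natr_prod (prod_set_of_ord E).
  by apply: eq_bigr => i _; rewrite mxE.
apply/matrixP => i j; rewrite !mxE !fam_tupleE setprod_trace.
rewrite (can_eq (set_of_ordK E)) eq_sym.
by case: eqP => [->|_]; rewrite ?mulr1n ?mulr0n.
Qed.

Lemma aS_prod_gt0 : (0 < \prod_(S in {set 'I_n}) (2 ^ n * aS S))%N.
Proof. by rewrite prodn_gt0 // => S; exact: aS_gt0. Qed.

Lemma integral_basisP : exists b : N.-tuple L, is_integral_basis b.
Proof.
have E := card_dim galL gx.
have [|| b [ib _]] := @integral_basis_exists L galL (fam_tuple E (setprod x)).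
- by move=> i; rewrite fam_tupleE; exact: int_ring_setprod gx _.
- by rewrite disc_setprod pnatr_eq0 -lt0n aS_prod_gt0.
by exists b.
Qed.

Lemma int_basis_disc_gens (b : N.-tuple L) (m : nat) : is_integral_basis b ->
  (forall y, O y -> exists e : {set 'I_n} -> int,
     y *+ m = \sum_(S in {set 'I_n}) setprod x S *~ e S) ->
  exists t : nat, (\prod_(S in {set 'I_n}) (2 ^ n * aS S))%N%:R = (t ^ 2)%:R * disc_basis b
    /\ (t %| m ^ N)%N.
Proof.
move=> ib gen; have E := card_dim galL gx.
have [t [Et dt]] := int_basis_disc_index ib (int_ring_setprod gx) (setprod_basis E) gen.
by exists t; split => //; rewrite -Et disc_setprod.
Qed.

Lemma trace_setprod_int y S : O y -> field_trace (y * setprod x S) \in Num.int.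
Proof.
move=> Oy; apply: field_trace_int => //; apply: int_ringM => //.
exact: int_ring_setprod gx _.
Qed.

Lemma gens_span y : O y -> exists e : {set 'I_n} -> int,
  y *+ (2 ^ n * \prod_i a i) = \sum_(S in {set 'I_n}) setprod x S *~ e S.
Proof.
move=> Oy.
have /choice[e Ee] S : exists m : int, field_trace (y * setprod x S) = m%:~R.
  by apply/intrP; exact: trace_setprod_int.
exists (fun S => e S * (\prod_(i in ~: S) a i)%N).
rewrite {1}(setprod_coord galL gx y) -sumrMnl; apply: eq_bigr => S _.
rewrite -scaler_int -scaler_nat scalerA Ee; congr (_ *: _).
have -> : (\prod_i a i = aS S * \prod_(i in ~: S) a i)%N.
  rewrite (bigID (mem S)) /=; congr (_ * _)%N.
  by apply: eq_bigl => i; rewrite inE.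
rewrite mulnA natrM mulrC mulrA divfK ?pnatr_eq0 -?lt0n ?aS_gt0 //.
by rewrite intrM.
Qed.

Lemma int_basis_disc_pos (b : N.-tuple L) : is_integral_basis b ->
  exists2 d : nat, (0 < d)%N & disc_basis b = d%:R.
Proof.
move=> ib.
have [t [Et _]] := int_basis_disc_gens ib gens_span.
have /intrP[m Em] : disc_basis b \in Num.int.
  by apply: disc_int => // i; exact: int_basis_mem.
have m0 : (0 < m).
  rewrite -(ltr0z rat) -Em.
  have : 0 < (t ^ 2)%:R * disc_basis b by rewrite -Et ltr0n aS_prod_gt0.
  case: (posnP t) => [->|t0]; first by rewrite mul0r ltxx.
  by rewrite pmulr_rgt0 // ltr0n expn_gt0 t0.
case: m m0 Em => // m m0 Em; exists m => //.
Qed.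

Lemma disc_gens_nat (b : N.-tuple L) (m d : nat) : is_integral_basis b ->
  disc_basis b = d%:R ->
  (forall y, O y -> exists e : {set 'I_n} -> int,
     y *+ m = \sum_(S in {set 'I_n}) setprod x S *~ e S) ->
  exists t : nat, (\prod_(S in {set 'I_n}) (2 ^ n * aS S) = t ^ 2 * d)%N
    /\ (t %| m ^ N)%N.
Proof.
move=> ib Ed gen; have [t [Et dt]] := int_basis_disc_gens ib gen; exists t; split=> //.
by apply/eqP; rewrite -(eqr_nat rat) Et Ed -natrM.
Qed.

Lemma logn_prime_prod (I : Type) (r : seq I) (P : pred I) (f : I -> nat) p :
  (forall i, P i -> (0 < f i)%N) ->
  logn p (\prod_(i <- r | P i) f i)%N = (\sum_(i <- r | P i) logn p (f i))%N.
Proof.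
move=> f0.
suff [] : (0 < \prod_(i <- r | P i) f i)%N /\
  logn p (\prod_(i <- r | P i) f i)%N = (\sum_(i <- r | P i) logn p (f i))%N by [].
elim/big_rec2: _ => [|i k m Pi [m0 <-]]; first by rewrite logn1.
by rewrite muln_gt0 f0 // lognM // f0.
Qed.

(** The index divides a power of [m], hence is prime to [p], and [d] has the valuation of the
    discriminant of the products [setprod x S]. The factors [2 ^ n] do not count because [p] is
    odd. *)
Lemma logn_disc (b : N.-tuple L) (m d p : nat) : is_integral_basis b ->
  disc_basis b = d%:R -> (0 < d)%N -> (0 < m)%N -> prime p -> ~~ (p %| m)%N -> (2 < p)%N ->
  (forall y, O y -> exists e : {set 'I_n} -> int,
     y *+ m = \sum_(S in {set 'I_n}) setprod x S *~ e S) ->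
  logn p d = (\sum_(S in {set 'I_n}) \sum_(i in S) logn p (a i))%N.
Proof.
move=> ib Ed d0 m0 pp pm p2 gen.
have [t [Et dt]] := disc_gens_nat ib Ed gen.
have := congr1 (logn p) Et.
have t0 : (0 < t)%N by case: t {Et} dt => //; rewrite dvd0n expn_eq0 -[m == _]negbK -lt0n m0.
rewrite lognM ?expn_gt0 ?t0 // lognX (_ : logn p t = 0)%N ?muln0 ?add0n; last first.
  apply: logn_coprime; rewrite prime_coprime //.
  by apply: contra pm => pt; have := dvdn_trans pt dt; rewrite Euclid_dvdX // => /andP[].
move=> <-; rewrite logn_prime_prod => [|S _]; last exact: aS_gt0.
apply: eq_bigr => S _; rewrite lognM ?expn_gt0 ?prodn_gt0 //; last by move=> i; exact: gens_gt0 gx _.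
rewrite lognX (logn_prime p (isT : prime 2)) [p == 2%N]gtn_eqF // muln0 add0n.
by rewrite logn_prime_prod // => i _; exact: gens_gt0 gx _.
Qed.

End Fixed.
End DiscValue.

Local Close Scope classical_set_scope.

(** * Valuation of the discriminant at the odd primes *)

Section Ramification.
Variables (L : splittingFieldType rat) (n : nat).
Local Notation O := (@int_ring L).
Local Notation N := (\dim {:L}).
Local Notation G := 'Gal({:L} / 1)%g.
Hypothesis galL : galois 1 {:L}.
Variables (a : 'I_n -> nat) (x : 'I_n -> L).
Hypothesis gx : sqrt_gens a x.
Local Notation aS := (fun S : {set 'I_n} => \prod_(i in S) a i)%N.

Lemma natL_neq0 m : (m%:R == 0 :> L) = (m == 0)%N.
Proof. by rewrite -(rmorph_nat (in_alg L)) fmorph_eq0 pnatr_eq0. Qed.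

(** An automorphism is determined by the set of generators it negates, and there are as many
    automorphisms as sets. *)
Lemma gens_signs (J : {set 'I_n}) :
  exists2 s, s \in G & forall i, s (x i) = if i \in J then - x i else x i.
Proof.
pose f (s : gal_of {:L}) := [set i | s (x i) == - x i].
have xN i : (x i == - x i) = false.
  apply/negbTE; rewrite -subr_eq0 opprK -mulr2n -mulr_natr mulf_neq0 ?natL_neq0 //.
  exact: gens_neq0 gx i.
have fE (s : gal_of {:L}) i : s (x i) = if i \in f s then - x i else x i.
  rewrite inE; case: eqP => // ne; by case: (gens_gal gx s i).
have inj : {in G &, injective f}.
  move=> s t sG tG fst; apply/eqP; rewrite eq_mulgV1; apply/eqP.
  case: gx => _ _ h _; apply: h => [|i]; first by rewrite groupM ?groupV.
  by rewrite galM ?memvf // fE fst -fE -galM ?memvf // mulgV gal_id.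
have : f @: G = [set: {set 'I_n}].
  apply/eqP; rewrite eqEcard finset.subsetT /= card_in_imset // cardsT.
  by rewrite -(card_dim galL gx) (card_gal galL).
move=> /setP/(_ J); rewrite inE => /imsetP[s sG ->].
by exists s.
Qed.

Lemma setprod_flip (s : gal_of {:L}) i0 (S : {set 'I_n}) :
  (forall i, s (x i) = if i \in [set i0] then - x i else x i) ->
  s (setprod x S) = if i0 \in S then - setprod x S else setprod x S.
Proof.
move=> sx; rewrite /setprod rmorph_prod; case: ifP => iS.
  rewrite (big_setD1 i0 iS) [in RHS](big_setD1 i0 iS) /= sx set11 mulNr.
  congr (- (_ * _)); apply: eq_bigr => i /setD1P[ni _].
  by rewrite sx inE (negPf ni).
apply: eq_bigr => i jS; rewrite /= sx inE; case: eqP => // ii.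
by rewrite -ii jS in iS.
Qed.

Lemma congO_trace p y z : congO p y z -> O z -> exists2 m : int,
  field_trace y - field_trace z = (p%:Z * m)%:~R & True.
Proof.
move=> [w Ow E] Oz; have /intrP[m Em] := field_trace_int galL Ow.
exists m => //; rewrite -[y](subrK z) E field_traceD addrK.
by rewrite mulr_natl -scaler_nat field_traceZ Em intrM.
Qed.

Lemma setprod_setD1 i0 (S : {set 'I_n}) : i0 \in S ->
  setprod x S = x i0 * setprod x (S :\ i0).
Proof. by move=> iS; rewrite /setprod (big_setD1 i0 iS). Qed.

(* The coordinates along the products involving the only ramified generator
   are divisible by p: collecting them gives W with W^2 in p O, and the Frobenius
   of O / p is injective on the span of the other generators. *)
Lemma ramified_coord p i0 y : prime p -> (2 < p)%N -> (p %| a i0)%N ->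
  (forall i, i != i0 -> ~~ (p %| a i)%N) -> O y ->
  forall (e : {set 'I_n} -> int),
  (forall S : {set 'I_n}, (e S)%:~R = (2 * \prod_(i in ~: S) a i)%N%:R * field_trace (y * setprod x S)) ->
  forall S : {set 'I_n}, i0 \in S -> (p%:Z %| e S)%Z.
Proof.
move=> pp p2 pa0 pa Oy e Ee S0 iS0.
pose W := \sum_(S in {set 'I_n} | i0 \in S) setprod x (S :\ i0) *~ e S.
(* [tau] negates only [x i0], so [y - tau y] keeps the coordinates along the products containing
   [x i0] and doubles them: this is the factor 2 in [e]. *)
have [tau tG taux] := gens_signs [set i0].
pose M := (2 * (2 ^ n * \prod_i a i))%N.
have eM (S : {set 'I_n}) : (e S)%:~R = M%:R * (field_trace (y * setprod x S) / (2 ^ n * aS S)%:R) :> rat.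
  rewrite Ee; have -> : M = (2 * \prod_(i in ~: S) a i * (2 ^ n * aS S))%N.
    rewrite /M (bigID (mem S)) /= [X in (_ * (_ * (_ * X)))%N](eq_bigl (fun i => i \in ~: S)).
      by set u := (\prod_(i in S) _)%N; set v := (\prod_(i in _) _)%N; ring.
    by move=> i; rewrite inE.
  rewrite [in RHS]natrM -[RHS]mulrA; congr (_ * _).
  by rewrite [RHS]mulrC divfK // pnatr_eq0 -lt0n (aS_gt0 gx).
have WE : W * x i0 = (y - tau y) *+ (2 ^ n * \prod_i a i).
  have -> : W * x i0 = \sum_(S in {set 'I_n} | i0 \in S) setprod x S *~ e S.
    rewrite /W mulr_suml; apply: eq_bigr => S /andP[_ iS].
    by rewrite (setprod_setD1 iS) mulrC -mulrzAr.
  rewrite {1}(setprod_coord galL gx y) [in tau _](setprod_coord galL gx y).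
  rewrite rmorph_sum -sumrB -sumrMnl big_mkcondr; apply: eq_bigr => S _ /=.
  rewrite linearZ /= (setprod_flip S taux); case: ifP => iS; last by rewrite subrr mul0rn.
  rewrite scalerN opprK -mulr2n -mulrnA -scaler_nat scalerA -/M -scaler_int eM.
  by [].
(* Since [x i0 ^+ 2 = a i0], dividing by [x i0] trades the factor [a i0] for one [x i0]. So [W] is
   an integral multiple of [x i0], and [W ^+ 2] one of [a i0]. *)
have WE2 : W = x i0 * ((y - tau y) *+ (2 ^ n * \prod_(i | i != i0) a i)).
  apply: (mulIf (gens_neq0 gx i0)).
  rewrite WE mulrAC -expr2 (gens_sqr gx) (bigD1 i0) //= mulnCA mulnC mulrnA.
  by rewrite mulr_natl.
have OW : O W.
  by apply: int_ring_sum => S _; apply: int_ringMz; exact: int_ring_setprod gx _.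
have Ody : O (y - tau y) by apply: int_ringB => //; exact: int_ring_gal.
have W2 : congO p (W ^+ 2) 0.
  rewrite WE2 exprMn (gens_sqr gx); set z := _ ^+ 2.
  exists ((a i0 %/ p)%N%:R * z); last by rewrite subr0 [RHS]mulrA -natrM mulnC divnK.
  apply: int_ringM; [exact: natr_int_ring | apply: int_ringX].
  by rewrite -mulr_natl; apply: int_ringM => //; exact: natr_int_ring.
have Wp : congO p (W ^+ p) 0.
  have -> : W ^+ p = W ^+ (p - 2) * W ^+ 2 by rewrite -exprD subnK // ltnW.
  rewrite -[X in congO _ _ X](mulr0 (W ^+ (p - 2))).
  by apply: congOM => //; [exact: int_ringX | exact: (natr_int_ring L 0) | exact: congO_refl].
pose h := p./2.
have op : odd p by case: (even_prime pp) p2 => // ->.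
have ph : p = (h.*2).+1.
  by rewrite -[LHS]odd_double_half op.
(* As [p = 2 h + 1], the [p]-th power of a product without [x i0] is that product times an integer
   prime to [p]. [Z] is thus [W ^+ p] modulo [p], expanded on the same products as [W]. *)
pose Z := \sum_(S in {set 'I_n} | i0 \in S)
  (setprod x (S :\ i0) *~ (e S ^+ p * (aS (S :\ i0) ^ h)%N)).
have Z0 : congO p Z 0.
  apply: congO_trans Wp; apply: congO_sym.
  apply: congO_trans (frobeniusO_sum _ pp _) _ => [S _|].
    by apply: int_ringMz; exact: int_ring_setprod gx _.
  rewrite /Z; apply: congO_sum => S _.
  rewrite -mulrzr exprMn -rmorphXn /= -[X in congO _ X _]mulrC.
  suff -> : setprod x (S :\ i0) ^+ p = setprod x (S :\ i0) *~ (aS (S :\ i0) ^ h)%N.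
    by rewrite mulrzl -mulrzA mulrC; exact: congO_refl.
  rewrite {1}ph exprS -muln2 mulnC exprM (setprod_sqr gx) -natrX -pmulrn.
  by rewrite mulr_natr.
have Oz : O (setprod x (S0 :\ i0)) := int_ring_setprod gx _.
(* Taking the trace against the product of [S0] isolates one term, in which every factor besides
   [e S0 ^+ p] is prime to [p]. *)
have Z1 : congO p (Z * setprod x (S0 :\ i0)) 0.
  rewrite -[X in congO _ _ X](mul0r (setprod x (S0 :\ i0))).
  apply: congOM => //; last exact: congO_refl.
  by apply: int_ring_sum => S _; apply: int_ringMz; exact: int_ring_setprod gx _.
have [m Em _] := congO_trace Z1 (natr_int_ring L 0).
have t0 : field_trace (0 : L) = 0 by rewrite -(scale0r 0) field_traceZ mul0r.
move: Em; rewrite t0 subr0 /Z mulr_suml field_trace_sum.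
rewrite (bigD1 S0) //= [X in _ + X]big1 => [|S /andP[iS nS]]; last first.
  rewrite mulrzAl -scaler_int field_traceZ (setprod_trace galL gx) ifF ?mulr0 //.
  apply: contraNF nS => /eqP E; apply/eqP.
  by rewrite -(finset.setD1K iS) -(finset.setD1K iS0) E.
rewrite addr0 mulrzAl -scaler_int field_traceZ (setprod_trace galL gx) eqxx.
rewrite [X in _ * X]pmulrn -intrM => /eqP; rewrite eqr_int => /eqP Em.
have : (p%:Z %| e S0 ^+ p * (aS (S0 :\ i0) ^ h)%N * (2 ^ n * aS (S0 :\ i0))%N)%Z.
  by rewrite Em dvdz_mulr.
rewrite !dvdzE !abszM !absz_nat abszX !Euclid_dvdM //.
have na : ~~ (p %| aS (S0 :\ i0))%N.
  rewrite Euclid_dvd_prod // big_has_cond -all_predC.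
  by apply/allP => i _ /=; rewrite negb_and orbC; case: (eqVneq i i0) => [->|/pa ->]; rewrite ?setD11 ?orbT.
rewrite !Euclid_dvdX // (negPf na) /= !orbF.
by rewrite [(p %| 2)%N]gtnNdvd //= orbF => /andP[].
Qed.

(** All the coefficients [e S] are divisible by [p]: by [ramified_coord] if [i0] is in [S], and
    otherwise because [a i0] is a factor of the product over the complement. Dividing by [p] leaves
    a multiplier prime to [p] as soon as [p] divides [a i0] only once. *)
Lemma ramified_span p i0 y : prime p -> (2 < p)%N -> (p %| a i0)%N ->
  (forall i, i != i0 -> ~~ (p %| a i)%N) -> O y ->
  exists e : {set 'I_n} -> int,
  y *+ (2 * (2 ^ n * (\prod_(i | i != i0) a i * (a i0 %/ p)))) =
  \sum_(S in {set 'I_n}) setprod x S *~ e S.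
Proof.
move=> pp p2 pa0 pa Oy.
have /choice[T ET] S : exists m : int, field_trace (y * setprod x S) = m%:~R.
  by apply/intrP; exact: trace_setprod_int gx y S Oy.
pose e S := (2 * \prod_(i in ~: S) a i)%N%:Z * T S.
have Ee (S : {set 'I_n}) : (e S)%:~R = (2 * \prod_(i in ~: S) a i)%N%:R * field_trace (y * setprod x S).
  by rewrite /e intrM ET.
have pe := ramified_coord pp p2 pa0 pa Oy Ee.
pose M := (2 * (2 ^ n * (\prod_(i | i != i0) a i * (a i0 %/ p))))%N.
have Mp : (M * p = 2 * (2 ^ n * \prod_i a i))%N.
  rewrite [in RHS](bigD1 i0) //= -[X in (_ * (_ * (X * _)))%N](divnK pa0) /M.
  by set u := (\prod_(i < _ | _) _)%N; set v := (_ %/ _)%N; ring.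
have p0 : (p%:R : rat) != 0 by rewrite pnatr_eq0 -lt0n prime_gt0.
have /choice[f Ef] (S : {set 'I_n}) : exists f : int,
    f%:~R * p%:R = (e S)%:~R :> rat.
  suff /dvdzP[f ->] : (p%:Z %| e S)%Z by exists f; rewrite intrM.
  case: (boolP (i0 \in S)) => iS; first exact: pe.
  rewrite /e dvdz_mulr // dvdzE !absz_nat dvdn_mull //.
  by rewrite (bigD1 i0) ?dvdn_mulr // inE.
exists f; rewrite -/M; apply: (@mulIf _ (p%:R : L)).
  by rewrite natL_neq0 -lt0n prime_gt0.
rewrite mulr_natr -mulrnA Mp {1}(setprod_coord galL gx y) -sumrMnl mulr_suml.
apply: eq_bigr => S _.
rewrite mulr_natr -scaler_nat scalerA -[setprod x S *~ _]scaler_int -scaler_nat scalerA.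
rewrite [_%:R * (f S)%:~R]mulrC Ef Ee; congr (_ *: _).
have -> : (\prod_i a i = aS S * \prod_(i in ~: S) a i)%N.
  rewrite (bigID (mem S)) /=; congr (_ * _)%N.
  by apply: eq_bigl => i; rewrite inE.
rewrite (_ : 2 * _ = (2 * \prod_(i in ~: S) a i) * (2 ^ n * aS S))%N; last by ring.
by rewrite natrM -mulrA [X in _ * X]mulrC divfK // pnatr_eq0 -lt0n (aS_gt0 gx).
Qed.

Variable b : N.-tuple L.
Hypothesis ib : is_integral_basis b.
Variable d : nat.
Hypothesis bd : disc_basis b = d%:R.

Lemma disc_nat_gt0 : (0 < d)%N.
Proof.
have [d' d'0] := int_basis_disc_pos galL gx ib.
by rewrite bd => /eqP; rewrite eqr_nat => /eqP ->.
Qed.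

Lemma prod_gt0_dvd p : prime p -> (forall i, ~~ (p %| a i)%N) -> ~~ (p %| \prod_i a i)%N.
Proof.
move=> pp pa; rewrite Euclid_dvd_prod // big_has -all_predC.
by apply/allP => i _ /=.
Qed.

Lemma logn_disc_unramified p : prime p -> (2 < p)%N -> (forall i, ~~ (p %| a i)%N) ->
  logn p d = 0%N.
Proof.
move=> pp p2 pa.
rewrite (logn_disc galL gx ib bd disc_nat_gt0 _ pp _ p2 (gens_span galL gx)).
- by apply: big1 => S _; apply: big1 => i _; rewrite logn_coprime // prime_coprime.
- by rewrite muln_gt0 expn_gt0 prodn_gt0 // => i; exact: gens_gt0 gx _.
- by rewrite Euclid_dvdM // negb_or prod_gt0_dvd // Euclid_dvdX // gtnNdvd.
Qed.

Lemma card_sets_mem (i0 : 'I_n) : #|[set S : {set 'I_n} | i0 \in S]| = (2 ^ n.-1)%N.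
Proof.
have E : #|[set S : {set 'I_n} | i0 \in S]| = #|[set S : {set 'I_n} | i0 \notin S]|.
  rewrite -(card_imset _ (can_inj (@finset.setCK _))); apply: eq_card => S.
  rewrite inE; apply/imsetP/idP => [[T]|iS]; first by rewrite !inE => iT ->; rewrite inE iT.
  by exists (~: S); rewrite ?inE ?iS ?finset.setCK.
have := cardsC [set S : {set 'I_n} | i0 \in S].
have -> : ~: [set S : {set 'I_n} | i0 \in S] = [set S : {set 'I_n} | i0 \notin S].
  by apply/setP => S; rewrite !inE.
rewrite -E addnn -cardsT -powersetT card_powerset cardsT card_ord.
case: n i0 {E} => [[]//|m] i0 /=; rewrite expnS mul2n.
by move/double_inj.
Qed.

(** Each of the [2 ^ n.-1] sets containing [i0] contributes one factor [p], and the index is prime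
    to [p] by [ramified_span]. *)
Lemma logn_disc_ramified p i0 : prime p -> (2 < p)%N -> logn p (a i0) = 1%N ->
  (forall i, i != i0 -> ~~ (p %| a i)%N) -> logn p d = (2 ^ n.-1)%N.
Proof.
move=> pp p2 pa0 pa.
have a0 i : (0 < a i)%N := gens_gt0 gx i.
have da : (p %| a i0)%N by rewrite -(expn1 p) pfactor_dvdn // pa0.
rewrite (logn_disc galL gx ib bd disc_nat_gt0 _ pp _ p2
  (fun y Oy => ramified_span pp p2 da pa Oy)).
- rewrite -(card_sets_mem i0) -sum1_card big_mkcond [RHS]big_mkcond /=.
  apply: eq_bigr => S _; rewrite inE; case: ifP => iS.
    rewrite (big_setD1 i0) //= pa0 big1 // => i /setD1P[ii _].
    by rewrite logn_coprime // prime_coprime // pa.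
  apply: big1 => i iS'; rewrite logn_coprime // prime_coprime // pa //.
  by apply: contraFneq iS => <-.
- rewrite !muln_gt0 /= expn_gt0 prodn_gt0 //= divn_gt0 ?prime_gt0 //.
  exact: dvdn_leq.
- rewrite !Euclid_dvdM // !negb_or Euclid_dvdX // gtnNdvd //=.
  rewrite Euclid_dvd_prod // big_has_cond -all_predC.
  apply/andP; split.
    by apply/allP => i _ /=; rewrite negb_and; case: (eqVneq i i0) => //= /pa.
  apply/negP => /(dvdn_mul (dvdnn p)); rewrite [X in (_ %| X)%N]mulnC divnK //.
  by rewrite mulnn pfactor_dvdn // pa0.
Qed.

End Ramification.

(** * The prime 2 when the generators are 1 modulo 4 *)

Section AtTwo.
Variables (L : splittingFieldType rat) (n : nat).
Local Notation O := (@int_ring L).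
Local Notation N := (\dim {:L}).
Hypothesis galL : galois 1 {:L}.
Variables (a : 'I_n -> nat) (x : 'I_n -> L).
Hypothesis gx : sqrt_gens a x.
Hypothesis a4 : forall i, (a i %% 4 = 1)%N.

Definition half_gen i : L := (1 + x i) / 2%:R.
Local Notation al := half_gen.
Local Notation c i := ((a i %/ 4)%N%:R : L).

Lemma two_neq0 : (2%:R : L) != 0. Proof. by rewrite natL_neq0. Qed.

Lemma gens_half i : x i = 2%:R * al i - 1.
Proof. by rewrite mulrC divfK ?two_neq0 // addrAC subrr add0r. Qed.

Lemma half_gen_sqr i : al i ^+ 2 = al i + c i.
Proof.
have Ea : (a i)%:R = 4%:R * c i + 1 :> L.
  by rewrite {1}(divn_eq (a i) 4) a4 natrD natrM mulrC.
have := gens_sqr gx i; rewrite gens_half Ea => E.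
have L4 : (4%:R : L) != 0 by rewrite natL_neq0.
apply: (mulfI L4); apply/eqP; rewrite -subr_eq0; apply/eqP.
rewrite -[RHS](subrr (4%:R * c i + 1)) -{1}E; ring.
Qed.

Lemma int_ring_half i : O (al i).
Proof.
apply: (@integral_root_monic _ _ (intr : {rmorphism int -> L}) _
  (('X - 1%:P) * 'X - (c i)%:P)).
- rewrite monicE lead_coefDl ?lead_coef_Mmonic ?monicX //.
    by rewrite lead_coefXsubC.
  rewrite size_polyN size_Mmonic ?monicX ?polyXsubC_eq0 // size_XsubC size_polyX.
  by rewrite (leq_ltn_trans (size_polyC_leq1 _)).
- apply/rootP; rewrite hornerD hornerN hornerM hornerXsubC hornerX hornerC; transitivity (al i ^+ 2 - al i - c i); [ring | rewrite half_gen_sqr; ring].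
- apply/(integral_poly (intr : {rmorphism int -> L})) => k.
  rewrite coefB coefMX coefB coefX !coefC.
  apply: int_ringB; last by case: ifP => _; [exact: natr_int_ring | exact: (natr_int_ring L 0)].
  case: ifP => _; first exact: (natr_int_ring L 0).
  apply: int_ringB; first exact: natr_int_ring.
  by case: ifP => _; [exact: (natr_int_ring L 1) | exact: (natr_int_ring L 0)].
Qed.

Lemma int_ring_half_prod S : O (setprod al S).
Proof. by apply: int_ring_prod => i _; exact: int_ring_half. Qed.

(** The dual basis, for the trace form, of the products of the [half_gen i], as provided by
    [reproducing]. The odd number [\prod_i a i] clears its denominators. *)
Definition half_dual (S : {set 'I_n}) : L :=
  \prod_i (if i \in S then (x i)^-1 else (al i - 1) / x i).

Lemma half_coord y :
  y = \sum_(S in {set 'I_n}) field_trace (y * half_dual S) *: setprod al S.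
Proof.
apply: (reproducing galL (b0 := fun i => (al i - 1) / x i) (b1 := fun i => (x i)^-1)).
  move=> i; rewrite mulrC -mulrDr addrAC -mulr2n -[_ *+ 2]mulr_natl -gens_half.
  by rewrite mulVf // (gens_neq0 gx).
move=> s sG s1; have [i Ei] := gens_flip gx sG s1; exists i.
have sal : s (al i) = 1 - al i.
  rewrite fmorph_div rmorphD rmorph1 rmorph_nat /= Ei /al.
  by field; rewrite ?two_neq0.
rewrite fmorphV fmorph_div rmorphB rmorph1 /= Ei sal.
by field; rewrite ?oppr_eq0 ?(gens_neq0 gx) ?two_neq0.
Qed.

Lemma half_basis E : basis_of {:L} (fam_tuple E (setprod al)).
Proof.
apply: fam_tuple_basis => y.
by exists (fun S => field_trace (y * half_dual S)); exact: half_coord.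
Qed.

Lemma half_dual_trace S T : field_trace (setprod al T * half_dual S) = (S == T)%:R.
Proof.
have E := card_dim galL gx.
have H := @fam_tuple_free _ _ _ (setprod al)
  (fun S => field_trace (setprod al T * half_dual S))
  (fun S => (S == T)%:R) (half_basis E).
rewrite H // -half_coord // (bigD1 T) //= eqxx scale1r big1 ?addr0 // => U /negPf ->.
by rewrite scale0r.
Qed.

Lemma int_ring_half_dual S : O ((\prod_i a i)%:R * half_dual S).
Proof.
rewrite natr_prod /half_dual -big_split; apply: int_ring_prod => i _ /=.
have -> : (a i)%:R = x i * x i by rewrite -expr2 (gens_sqr gx).
case: ifP => _; first by rewrite mulfK ?(gens_neq0 gx) //; exact: int_ring_gens gx i.
rewrite mulrC mulrA divfK ?(gens_neq0 gx) //.
apply: int_ringM; last exact: int_ring_gens gx i.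
by apply: int_ringB; [exact: int_ring_half | exact: (natr_int_ring L 1)].
Qed.

Lemma half_span y : O y -> exists e : {set 'I_n} -> int,
  y *+ (\prod_i a i) = \sum_(S in {set 'I_n}) setprod al S *~ e S.
Proof.
move=> Oy.
have /choice[e Ee] (S : {set 'I_n}) : exists m : int,
    field_trace (y * ((\prod_i a i)%:R * half_dual S)) = m%:~R.
  apply/intrP; apply: field_trace_int => //; apply: int_ringM => //.
  exact: int_ring_half_dual.
exists e; rewrite {1}(half_coord y) -sumrMnl; apply: eq_bigr => S _.
rewrite -scaler_int -Ee mulrCA [in RHS]mulr_natl -[in RHS]scaler_nat field_traceZ.
by rewrite -scalerA scaler_nat.
Qed.

Lemma odd_prod_gens : odd (\prod_i a i).
Proof.
suff : ~~ (2 %| \prod_i a i)%N by rewrite dvdn2 negbK.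
by apply: prod_gt0_dvd => // i; rewrite dvdn2 negbK (divn_eq (a i) 4) a4 addn1 /= oddM andbF.
Qed.

(** The dual basis times [A] is integral, and times [A] again it has integral coordinates on the
    products. So an integral matrix times the trace matrix is [A ^ 2] times the identity: the
    discriminant of the products divides a power of the odd [A], and [d] divides that
    discriminant. *)
Lemma disc_odd (b : N.-tuple L) (d : nat) : is_integral_basis b ->
  disc_basis b = d%:R -> odd d.
Proof.
move=> ib bd; have E := card_dim galL gx.
have [t [Et dt]] := int_basis_disc_index ib int_ring_half_prod (half_basis E) half_span.
set f := fam_tuple E (setprod al) in Et.
have /intrP[D ED] : disc_basis f \in Num.int.
  by apply: disc_int => // i; rewrite fam_tupleE; exact: int_ring_half_prod.
have Dd : D = (t ^ 2 * d)%N%:Z.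
  by apply/eqP; rewrite -(eqr_int rat) -ED Et bd -natrM pmulrn.
pose A := (\prod_i a i)%N.
have /choice[e Ee] (S : {set 'I_n}) : exists e : {set 'I_n} -> int,
    (A%:R * half_dual S) *+ A = \sum_(T in {set 'I_n}) setprod al T *~ e T.
  by apply: half_span; exact: int_ring_half_dual.
pose Em : 'M[rat]_N := \matrix_(i, j) (e (set_of_ord E i) (set_of_ord E j))%:~R.
have EmT : Em *m trace_mx f = ((A ^ 2)%N%:R)%:M.
  apply/matrixP => i j; rewrite mxE.
  transitivity (field_trace (((A%:R * half_dual (set_of_ord E i)) *+ A) * setprod al (set_of_ord E j))).
    rewrite Ee mulr_suml field_trace_sum (sum_set_of_ord E); apply: eq_bigr => k _.
    by rewrite !mxE !fam_tupleE [in RHS]mulrzAl -[X in _ = field_trace X]scaler_int field_traceZ.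
  rewrite -mulr_natr; have -> (u v : L) : A%:R * u * A%:R * v = (A ^ 2)%:R * (v * u).
    by rewrite natrX; ring.
  rewrite mulr_natl -scaler_nat field_traceZ.
  rewrite half_dual_trace (can_eq (set_of_ordK E)) mxE.
  by case: eqP; rewrite ?mulr1 ?mulr0.
have /intrP[m Em'] : \det Em \in Num.int.
  rewrite /determinant; apply: rpred_sum => s _.
  rewrite rpredM ?rpredX ?rpredN1 //; apply: rpred_prod => i _.
  by rewrite mxE intr_int.
have : m * D = ((A ^ 2) ^ N)%N%:Z.
  apply/eqP; rewrite -(eqr_int rat) intrM -Em' -ED disc_basisE -det_mulmx EmT.
  by rewrite det_scalar -natrX pmulrn.
move=> /(congr1 absz); rewrite abszM absz_nat Dd absz_nat => /(congr1 odd).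
rewrite !oddM !oddX odd_prod_gens !orbT => /andP[_ /andP[_]] //.
Qed.

(** Squaring [al ^ 2 = al + c] gives [al ^ 4 = al + 2 al c + (c + c ^ 2)], and [c + c ^ 2] is
    even. *)
Lemma half_gen_frobenius i : congO 2 (al i ^+ 4) (al i).
Proof.
have -> : al i ^+ 4 = al i + 2%:R * (al i * c i) + (c i + c i ^+ 2).
  by rewrite -[4%N]/(2 * 2)%N exprM half_gen_sqr sqrrD half_gen_sqr -[_ *+ 2]mulr_natl; ring.
have /dvdnP[q Eq] : (2 %| a i %/ 4 + (a i %/ 4) ^ 2)%N.
  by rewrite dvdn2 oddD oddX /= addbb.
exists (al i * c i + q%:R).
  apply: int_ringD; last exact: natr_int_ring.
  by apply: int_ringM; [exact: int_ring_half | exact: natr_int_ring].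
by rewrite -natrX -natrD Eq natrM; ring.
Qed.

(* O / 2O is a product of copies of F_2 and F_4. *)
Lemma int_ring_frobenius y : O y -> congO 2 (y ^+ 4) y.
Proof.
move=> Oy; have [e Ee] := half_span Oy.
set m := (\prod_i a i)%N in Ee.
have Oz : O (y *+ m) by rewrite -mulr_natr; apply: int_ringM => //; exact: natr_int_ring.
(* [m] is odd, so modulo 2 one may work with [y *+ m], an integral combination of products of the
   [half_gen i]. *)
have zy : congO 2 (y *+ m) y.
  exists (y *+ m./2); first by rewrite -mulr_natr; apply: int_ringM => //; exact: natr_int_ring.
  rewrite -{1}(odd_double_half m) odd_prod_gens mulrnDr mulr1n addrAC subrr add0r.
  by rewrite -muln2 mulrnA mulr_natl.
apply: congO_trans (zy); apply: congO_trans (congO_sym (congOX 4 Oz Oy zy)) _.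
have Oe S : O (setprod al S *~ e S) by apply: int_ringMz; exact: int_ring_half_prod.
rewrite -[4%N]/(2 * 2)%N exprM Ee.
apply: congO_trans (congOX 2 _ _ (frobeniusO_sum _ (isT : prime 2) _)) _ => //.
- by apply: int_ringX; apply: int_ring_sum.
- by apply: int_ring_sum => S _; exact: int_ringX.
apply: congO_trans (frobeniusO_sum _ (isT : prime 2) _) _ => [S _|].
  exact: int_ringX.
apply: congO_sum => S _; rewrite -exprM -[(2 * 2)%N]/4%N -mulrzr exprMn.
apply: congOM.
- by apply: int_ringX; exact: int_ring_half_prod.
- exact: intr_int_ring.
- rewrite /setprod -prodrXl; apply: congO_prod => i _.
  + by apply: int_ringX; exact: int_ring_half.
  + exact: int_ring_half.
  + exact: half_gen_frobenius.
have /dvdzP[q Eq] : (2%:Z %| e S ^+ 4 - e S)%Z.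
  have := divz_eq (e S) 2; have := modz_ge0 (e S) (isT : 2%:Z != 0).
  have := ltz_pmod (e S) (isT : 0 < 2%:Z); move: (e S %/ 2)%Z (e S %% 2)%Z => q r.
  move=> r2 r0 ->; have : (r == 0) || (r == 1) by lia.
  case/orP => /eqP ->; apply/dvdzP.
    by exists (q ^+ 4 * 8 - q); ring.
  by exists (q ^+ 4 * 8 + q ^+ 3 * 16 + q ^+ 2 * 12 + q * 3); ring.
exists q%:~R; first exact: intr_int_ring.
by rewrite -rmorphXn -rmorphB /= Eq intrM mulrC.
Qed.

End AtTwo.

(** * The discriminant formula *)

Section DiscFormula.
Variables (L : splittingFieldType rat) (n : nat).
Local Notation N := (\dim {:L}).
Hypothesis galL : galois 1 {:L}.

Lemma squarefree_gt0 m : squarefree m -> (0 < m)%N.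
Proof. by case: m => // /(_ 2%N (dvdn0 _)). Qed.

Lemma logn_squarefree m p : squarefree m -> prime p -> (p %| m)%N -> logn p m = 1%N.
Proof.
move=> sm pp pm; have m0 := squarefree_gt0 sm.
apply/eqP; rewrite eqn_leq -[X in _ && X]pfactor_dvdn // expn1 pm andbT leqNgt.
apply/negP => l2; have /sm E : (p ^ 2 %| m)%N by rewrite pfactor_dvdn.
by rewrite E in pp.
Qed.

(** For the other [i] with [p] dividing [a i], replace [x i] by [x i * x i0 / p]. The same field is
    generated, and squarefreeness makes the new radicand [(a i / p) (a i0 / p)] prime to [p]. *)
Lemma adapted_gens (a : 'I_n -> nat) (x : 'I_n -> L) p i0 : sqrt_gens a x ->
  (forall i, squarefree (a i)) -> prime p -> (p %| a i0)%N ->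
  exists (a' : 'I_n -> nat) (x' : 'I_n -> L), [/\ sqrt_gens a' x',
    logn p (a' i0) = 1%N & forall i, i != i0 -> ~~ (p %| a' i)%N].
Proof.
move=> gx sf pp pi0; have p0 := prime_gt0 pp.
pose t i := (i != i0) && (p %| a i)%N.
exists (fun i => if t i then (a i %/ p * (a i0 %/ p))%N else a i).
exists (fun i => if t i then x i * x i0 / p%:R else x i).
have a0 i : (0 < a i)%N := gens_gt0 gx i.
have Lp : (p%:R : L) != 0 by rewrite natL_neq0 -lt0n.
split; last first.
- move=> i ii; rewrite /t ii /=; case: ifP => [pai|->] //.
  rewrite Euclid_dvdM // negb_or; apply/andP; split.
    apply/negP => /(dvdn_mul (dvdnn p)); rewrite [X in (_ %| X)%N]mulnC divnK // mulnn.
    by rewrite pfactor_dvdn // logn_squarefree.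
  apply/negP => /(dvdn_mul (dvdnn p)); rewrite [X in (_ %| X)%N]mulnC divnK // mulnn.
  by rewrite pfactor_dvdn // logn_squarefree.
- by rewrite /t eqxx logn_squarefree.
case: (gx) => _ sq fix1 cG; split => //.
- move=> i; case: ifP => // /andP[_ pai].
  by rewrite muln_gt0 !divn_gt0 //; apply/andP; split; apply: dvdn_leq.
- move=> i; case: ifP => // /andP[_ pai]; rewrite expr_div_n exprMn !sq.
  apply: (mulIf (expf_neq0 2 Lp)); rewrite divfK ?expf_neq0 //.
  rewrite -natrX -!natrM; congr (_%:R).
  by rewrite -{1}(divnK pai) -{1}(divnK pi0); ring.
- move=> s sG fx; apply: fix1 => // i.
  have f0 : s (x i0) = x i0 by have := fx i0; rewrite /t eqxx.
  have := fx i; case: ifP => // _; rewrite fmorph_div rmorphM rmorph_nat /= f0.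
  by move=> /(mulIf (invr_neq0 Lp)) /(mulIf (gens_neq0 gx i0)).
Qed.

Lemma field_disc_formula (a : 'I_n -> nat) (x : 'I_n -> L) : sqrt_gens a x ->
  (forall i, squarefree (a i)) -> (forall i, a i %% 4 = 1)%N ->
  field_disc L = ((\prod_(p <- primes (\prod_i a i)) p) ^ (2 ^ n.-1))%N%:R.
Proof.
move=> gx sf a4.
have H (b : N.-tuple L) : is_integral_basis b -> disc_basis b =
    ((\prod_(p <- primes (\prod_i a i)) p) ^ (2 ^ n.-1))%N%:R.
  move=> ib; have [d d0 bd] := int_basis_disc_pos galL gx ib.
  have P0 : (0 < \prod_(p <- primes (\prod_i a i)) p)%N.
    rewrite big_seq prodn_cond_gt0 // => p; rewrite mem_primes => /andP[pp _].
    exact: prime_gt0.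
  have A0 : (0 < \prod_i a i)%N by rewrite prodn_gt0 // => i; exact: gens_gt0 gx i.
  rewrite bd; congr (_%:R); apply: eqn_from_log => //; first by rewrite expn_gt0 P0.
  move=> p; rewrite lognX.
  case: (boolP (prime p)) => pp; last first.
    have nl m : logn p m = 0%N by rewrite lognE (negPf pp).
    by rewrite !nl muln0.
  have -> : logn p (\prod_(q <- primes (\prod_i a i)) q) = (p %| \prod_i a i)%N.
    rewrite big_seq logn_prime_prod; last first.
      by move=> q; rewrite mem_primes => /andP[qq _]; exact: prime_gt0.
    rewrite (eq_bigr (fun q => (p == q) : nat)); last first.
      by move=> q; rewrite mem_primes => /andP[qq _]; rewrite logn_prime.
    rewrite -big_seq; have [pA|pA] := boolP (p %| _)%N.
      have pin : p \in primes (\prod_i a i) by rewrite mem_primes pp A0.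
      rewrite (bigD1_seq p) ?primes_uniq //= eqxx big1 // => q.
      by rewrite eq_sym => /negPf ->.
    rewrite big_seq big1 // => q; rewrite mem_primes => /and3P[_ _ qA].
    by case: eqP => // E; rewrite E qA in pA.
  case: (boolP [exists i, (p %| a i)%N]) => [/existsP[i0 pi0]|].
    have [a' [x' [gx' l1 ln]]] := adapted_gens gx sf pp pi0.
    have p2 : (2 < p)%N.
      rewrite ltn_neqAle prime_gt1 // andbT; apply: contraTneq pi0 => <-.
      by rewrite dvdn2 negbK (divn_eq (a i0) 4) a4 addn1 /= oddM andbF.
    rewrite (logn_disc_ramified galL gx' ib bd pp p2 l1 ln).
    by rewrite (bigD1 i0) //= dvdn_mulr // muln1.
  move=> /existsPn np.
  rewrite (negPf (prod_gt0_dvd pp np)) muln0.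
  have [->|p2] := eqVneq p 2%N.
    by apply: logn_coprime; rewrite coprime2n; apply: (disc_odd galL gx a4 ib bd).
  apply: (logn_disc_unramified galL gx ib bd pp _ np).
  by rewrite ltn_neqAle eq_sym p2 prime_gt1.
rewrite /field_disc; have [b0 ib0] := integral_basisP galL gx.
by case: xgetP => [D -> [b ib <-]|/(_ (disc_basis b0))]; [exact: H | case; exists b0].
Qed.

End DiscFormula.

(** * Ramification at 2 *)

Section PrimesOverTwo.
Local Open Scope classical_set_scope.
Variable L : splittingFieldType rat.
Local Notation O := (@int_ring L).
Implicit Types (y z : L) (I J P Q : set L).

(** [r] plays the reduction modulo 2: integral elements with the same value are congruent. It
    carries the finiteness of the residue ring. *)
Variables (T : finType) (r : L -> T).
Hypothesis rP : forall y z, O y -> O z -> r y = r z -> congO 2 y z.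

Let O0 : O 0 := natr_int_ring L 0.
Let O1 : O 1 := natr_int_ring L 1.
Let O2 : O 2%:R := natr_int_ring L 2.

Lemma ideal_congO I y z : is_ideal I -> I 2%:R -> congO 2 y z -> I z -> I y.
Proof.
move=> iI I2 [w Ow E] Iz; rewrite -(subrK z y) E.
case: (iI) => _ _ iD iM; apply: iD => //.
by rewrite mulrC; apply: iM.
Qed.

Lemma prime_expr P y k : is_nonzero_prime P -> O y -> P (y ^+ k) -> P y.
Proof.
move=> [iP _ P1 pP] Oy; elim: k => [|k IH]; first by rewrite expr0.
rewrite exprS => /pP [] //; exact: int_ringX.
Qed.

(* O / 2O is finite, so the powers of an element repeat modulo P. *)
Lemma prime_over2_unit P y : is_nonzero_prime P -> P 2%:R -> O y -> ~ P y ->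
  exists m, P (1 - y ^+ m.+1).
Proof.
move=> PP P2 Oy Py; have [iP _ P1 pP] := PP.
have /injectivePn[i [j nij rij]] : ~~ injectiveb (fun i : 'I_#|T|.+1 => r (y ^+ i)).
  apply/negP => /injectiveP /leq_card; rewrite card_ord.
  by rewrite ltnn.
wlog ij : i j nij rij / (i < j)%N.
  move=> H; have := nij; rewrite -(inj_eq val_inj) neq_ltn => /orP[] lt.
    exact: (H i j).
  by apply: (H j i) => //; rewrite eq_sym.
have /(ideal_congO iP P2) Pij : congO 2 (y ^+ i) (y ^+ j).
  by apply: rP => //; exact: int_ringX.
have {}Pij : P (y ^+ i - y ^+ j).
  case: (rP (int_ringX i Oy) (int_ringX j Oy) rij) => w Ow ->; rewrite mulrC; case: iP => _ _ _; exact.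
move: Pij; rewrite -(subnKC (ltnW ij)) exprD -[X in X - _]mulr1 -mulrBr.
move=> /pP [||/(prime_expr PP Oy)//|]; first exact: int_ringX.
  by apply: int_ringB => //; exact: int_ringX.
by exists (j - i).-1; rewrite prednK // subn_gt0.
Qed.

(** An element of [Q] outside [P] has a power congruent to 1 modulo [P], which would put 1 in
    [Q]. *)
Lemma prime_over2_maximal P Q : is_nonzero_prime P -> is_nonzero_prime Q ->
  P 2%:R -> P `<=` Q -> P = Q.
Proof.
move=> PP [[QO Q0 QD QM] _ Q1 _] P2 PQ; apply/seteqP; split => // y Qy.
apply: contrapT => Py; have [m /PQ Qm] := prime_over2_unit PP P2 (QO _ Qy) Py.
apply: Q1; rewrite -(subrK (y ^+ m.+1) 1); apply: QD => //.
by rewrite exprSr; apply: QM => //; apply: int_ringX; exact: QO.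
Qed.

Lemma ideal_mul_ideal I J : is_ideal I -> is_ideal J -> is_ideal (ideal_mul I J).
Proof.
move=> [IO I0 ID IM] [JO J0 JD JM]; split.
- move=> x [s [sIJ ->]]; rewrite big_seq; apply: int_ring_sum => u us.
  by have [Iu Ju] := sIJ u us; apply: int_ringM; [exact: IO | exact: JO].
- by exists [::]; split => //; rewrite big_nil.
- move=> x y [s [sIJ ->]] [t [tIJ ->]]; exists (s ++ t); split; last by rewrite big_cat.
  by move=> u; rewrite mem_cat => /orP[/sIJ|/tIJ].
- move=> a x Oa [s [sIJ ->]]; exists [seq (a * u.1, u.2) | u <- s]; split.
    move=> u /mapP[v vs ->] /=; have [Iv Jv] := sIJ v vs; split => //.
    exact: IM.
  by rewrite big_map mulr_sumr; apply: eq_bigr => u _ /=; rewrite mulrA.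
Qed.

Lemma int_ring_ideal : is_ideal O.
Proof. by split => //; [exact: int_ringD | exact: int_ringM]. Qed.

Lemma ideal_mul_subl I J : is_ideal I -> is_ideal J -> ideal_mul I J `<=` I.
Proof.
move=> [IO I0 ID IM] [JO _ _ _] x [s [sIJ ->]]; rewrite big_seq.
elim/big_ind: _ => // u /sIJ [Iu Ju]; rewrite mulrC; apply: (IM _ _) => //; exact: JO.
Qed.

Lemma ideal_mul_subr I J : is_ideal I -> is_ideal J -> ideal_mul I J `<=` J.
Proof.
move=> [IO I0 ID IM] [JO J0 JD JM] x [s [sIJ ->]]; rewrite big_seq.
elim/big_ind: _ => // u /sIJ [Iu Ju]; apply: JM => //; exact: IO.
Qed.

Lemma ideal_mulM I J x y : I x -> J y -> ideal_mul I J (x * y).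
Proof.
move=> Ix Jy; exists [:: (x, y)]; split; last by rewrite big_seq1.
by move=> u; rewrite inE => /eqP ->.
Qed.

Section Product.
Variables (k : nat) (P : 'I_k -> set L).
Hypothesis Pinj : injective P.
Hypothesis Pprime : forall i, is_nonzero_prime (P i).
Hypothesis P2 : forall i, P i 2%:R.

Lemma ideal_prod_ideal (s : seq 'I_k) : is_ideal (\big[@ideal_mul L/O]_(i <- s) P i).
Proof.
elim/big_rec: _ => [|i J _ iJ]; first exact: int_ring_ideal.
by apply: ideal_mul_ideal => //; case: (Pprime i).
Qed.

Lemma ideal_prod_sub (s : seq 'I_k) i : i \in s -> \big[@ideal_mul L/O]_(i <- s) P i `<=` P i.
Proof.
have iP j : is_ideal (P j) by case: (Pprime j).
elim: s => // j s IH; rewrite inE big_cons => /orP[/eqP ->|/IH {}IH].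
  exact: ideal_mul_subl (iP _) (ideal_prod_ideal s).
by move=> x /(ideal_mul_subr (iP _) (ideal_prod_ideal s)) /IH.
Qed.

(* Distinct primes over 2 are comaximal, so their product is their intersection. *)
Lemma ideal_prod_inter (s : seq 'I_k) x : uniq s -> O x -> (forall i, i \in s -> P i x) ->
  (\big[@ideal_mul L/O]_(i <- s) P i) x.
Proof.
elim: s => [|j s IH] /=; first by rewrite big_nil.
move=> /andP[js us] Ox Px; rewrite big_cons; set J := \big[_/_]_(_ <- _) _.
have Jx : J x by apply: IH => // i si; apply: Px; rewrite inE si orbT.
have iJ : is_ideal J := ideal_prod_ideal s.
have [iPj _ Pj1 pPj] := Pprime j; have [PjO Pj0 PjD PjM] := iPj.
have [JO _ _ JM] := iJ.
(* [w] is a product of elements taken from each of the other primes outside [P j]; as [P j] is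
   prime, [w] is outside it too. *)
have [w [Jw Pw]] : exists w, J w /\ ~ P j w.
  rewrite /J {IH Jx Px us J iJ JO JM}; elim: s js => [|i s IHs].
    by move=> _; rewrite big_nil; exists 1.
  rewrite inE negb_or => /andP[ji /IHs[w [Jw Pw]]].
  have [v [Pv Pjv]] : exists v, P i v /\ ~ P j v.
    apply: contrapT => H; move/eqP: ji; apply; apply: Pinj.
    apply/esym; apply: prime_over2_maximal => // v Pv.
    by apply: contrapT => Pjv; apply: H; exists v.
  have Ov : O v by case: (Pprime i) => -[+ _ _ _] _ _ _; apply.
  have Ow : O w by case: (ideal_prod_ideal s) => + _ _ _; apply.
  exists (v * w); split; first by rewrite big_cons; exact: ideal_mulM.
  by move=> /(pPj _ _ Ov Ow) [].
have [m Pm] := prime_over2_unit (Pprime j) (P2 j) (JO _ Jw) Pw.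
have Jwm : J (w ^+ m.+1) by rewrite exprSr; apply: JM => //; apply: int_ringX; exact: JO.
(* [x] lies in both ideals, [1 - w ^+ m.+1] in [P j] and [w ^+ m.+1] in [J], so both terms are in
   the product. *)
have -> : x = (1 - w ^+ m.+1) * x + x * w ^+ m.+1 by ring.
have [_ _ mD _] := ideal_mul_ideal iPj iJ.
apply: mD; apply: ideal_mulM => //.
by apply: Px; rewrite inE eqxx.
Qed.

End Product.

(** The ideal generated by 2 is a product of distinct primes, hence their intersection, and a prime
    containing [y ^+ 2] contains [y]. *)
Lemma unramified2_reduced y : unramified L 2 -> O y ->
  congO 2 (y ^+ 2) 0 -> congO 2 y 0.
Proof.
move=> [k [P [Pinj Pprime E]]] Oy [w Ow]; rewrite subr0 => Ey.
have sub i : principal_ideal 2%:R `<=` P i.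
  by rewrite E; apply: ideal_prod_sub => //; rewrite mem_index_enum.
have P2 i : P i 2%:R by apply: sub; exists 1 => //; rewrite mulr1.
have : principal_ideal 2%:R y.
  rewrite E; apply: ideal_prod_inter => //; first exact: index_enum_uniq.
  move=> i _; apply: (prime_expr (k := 2)) => //; apply: sub.
  by exists w => //; rewrite Ey.
by case=> v Ov <-; exists v => //; rewrite subr0.
Qed.

(** An ideal containing 2 is determined by this finite set, which makes both the choice of a maximal
    ideal and the enumeration of the primes over 2 finite. *)
Definition residues I : {set T} := [set t : T | `[< exists2 y, I y & r y = t >]]%SET.

Lemma residuesP I y : is_ideal I -> I 2%:R -> O y -> r y \in residues I -> I y.
Proof.
move=> iI I2 Oy; rewrite inE => /asboolP[z Iz rz].
apply: (ideal_congO iI I2 _ Iz); apply: rP => //.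
by case: iI => + _ _ _; apply.
Qed.

Lemma residues_sub I J : is_ideal J -> is_ideal I -> J 2%:R ->
  residues I \subset residues J -> I `<=` J.
Proof.
move=> iJ [IO _ _ _] J2 /fintype.subsetP sub y Iy.
apply: residuesP => //; first exact: IO.
by apply: sub; rewrite inE; apply/asboolP; exists y.
Qed.

Lemma principal_ideal_ideal : is_ideal (principal_ideal (2%:R : L)).
Proof.
split.
- by move=> _ [x Ox <-]; apply: int_ringM.
- by exists 0 => //; rewrite mulr0.
- by move=> _ _ [x Ox <-] [y Oy <-]; exists (x + y); [exact: int_ringD | rewrite mulrDr].
- by move=> a _ Oa [x Ox <-]; exists (a * x); [exact: int_ringM | rewrite mulrCA].
Qed.

Hypothesis frob : forall y, O y -> congO 2 (y ^+ 4) y.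
Hypothesis natL2 : (2%:R : L) != 0.

(* An ideal maximal among those containing 2 and avoiding x is prime, because
   x^4 = x modulo 2. *)
Lemma prime_over2_avoiding x : O x -> ~ principal_ideal 2%:R x ->
  exists P, [/\ is_nonzero_prime P, P 2%:R & ~ P x].
Proof.
move=> Ox nx.
pose F I := [/\ is_ideal I, I 2%:R & ~ I x].
pose A := [pred m : nat | `[< exists2 I, F I & #|residues I| = m >]].
have A0 : exists m, A m.
  exists #|residues (principal_ideal 2%:R)|; apply/asboolP.
  exists (principal_ideal 2%:R) => //; split => //; first exact: principal_ideal_ideal.
  by exists 1 => //; rewrite mulr1.
have Amax m : A m -> (m <= #|T|)%N by move=> /asboolP[I _ <-]; exact: max_card.
case: (ex_maxnP A0 Amax) => m /asboolP[I [iI I2 Ix] Em] mmax.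
have [IO I0 ID IM] := iI.
exists I; split => //; split => //.
- by move=> E; move: I2; rewrite E => /eqP; rewrite (negPf natL2).
- by move=> I1; apply: Ix; rewrite -[x]mulr1; apply: (IM _ _).
have extend y : O y -> ~ I y -> exists i a, [/\ I i, O a & x = i + a * y].
  move=> Oy Iy.
  pose J := [set u | exists i a, [/\ I i, O a & u = i + a * y]].
  apply: contrapT => nJx.
  have IJ : I `<=` J.
    by move=> u Iu; exists u, 0; split => //; rewrite mul0r addr0.
  have iJ : is_ideal J.
    split.
    + by move=> _ [i [a [Ii Oa ->]]]; apply: int_ringD; [exact: IO | exact: int_ringM].
    + exact: IJ.
    + move=> _ _ [i [a [Ii Oa ->]]] [i' [a' [Ii' Oa' ->]]].
      exists (i + i'), (a + a'); split; [exact: ID | exact: int_ringD |].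
      by rewrite mulrDl addrACA.
    + move=> c _ Oc [i [a [Ii Oa ->]]]; exists (c * i), (c * a); split.
      * exact: IM.
      * exact: int_ringM.
      * by rewrite mulrDr mulrA.
  have /mmax : A #|residues J|.
    by apply/asboolP; exists J => //; split => //; exact: IJ.
  rewrite -Em leqNgt => /negP; apply; apply: proper_card.
  rewrite properE; apply/andP; split.
    apply/fintype.subsetP => t; rewrite inE => /asboolP[u Iu <-]; rewrite inE; apply/asboolP.
    by exists u => //; exact: IJ.
  apply/negP => /(residues_sub iI iJ I2) JI; apply: Iy; apply: JI.
  by exists 0, 1; split => //; rewrite mul1r add0r.
move=> y z Oy Oz Iyz; apply: contrapT => /not_orP[Iy Iz].
have [i [a [Ii Oa Ex]]] := extend y Oy Iy.
have [i' [a' [Ii' Oa' Ex']]] := extend z Oz Iz.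
have Ix2 : I (x ^+ 2).
  rewrite expr2 {1}Ex Ex' mulrDl; apply: (ID _ _).
    by rewrite -Ex' mulrC; apply: (IM _ _).
  rewrite mulrDr; apply: (ID _ _).
    by apply: (IM _ _) => //; exact: int_ringM.
  by rewrite mulrACA; apply: (IM _ _) => //; exact: int_ringM.
apply: Ix; apply: (ideal_congO iI I2 (congO_sym (frob Ox))).
rewrite -[4%N]/(2 + 2)%N exprD; apply: (IM _ _) => //; exact: int_ringX.
Qed.

(** The primes over 2 are enumerated by their residue sets. Their intersection is the ideal
    generated by 2, by [prime_over2_avoiding], and equals their product by [ideal_prod_inter]. *)
Lemma frobenius_unramified2 : unramified L 2.
Proof.
pose F P := is_nonzero_prime P /\ P 2%:R.
pose A : {set {set T}} := [set t | `[< exists2 P, F P & residues P = t >]]%SET.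
have /choice[P FP] (i : 'I_#|A|) : exists P, F P /\ residues P = enum_val i.
  by have := enum_valP i; rewrite inE => /asboolP[P FP E]; exists P.
have Pprime i : is_nonzero_prime (P i) by case: (FP i) => -[].
have P2 i : P i 2%:R by case: (FP i) => -[].
have Pinj : injective P.
  move=> i j E; apply: enum_val_inj; have [_ <-] := FP i; have [_ <-] := FP j.
  by rewrite E.
exists #|A|, P; split => //.
apply/seteqP; split => x.
  move=> [w Ow <-]; apply: ideal_prod_inter => //.
  - exact: index_enum_uniq.
  - exact: int_ringM.
  - by move=> i _; have [[_ _ _ PM] _ _ _] := Pprime i; rewrite mulrC; apply: PM.
move=> Ex.
have Px i : P i x.
  by apply: (@ideal_prod_sub _ P Pprime (index_enum _) i) => //; rewrite mem_index_enum.
have Ox : O x by case: (ideal_prod_ideal Pprime (index_enum _)) => + _ _ _; apply.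
apply: contrapT => nx; have [Q [Qprime Q2 Qx]] := prime_over2_avoiding Ox nx.
have QA : residues Q \in A by rewrite inE; apply/asboolP; exists Q.
pose i := enum_rank_in QA (residues Q).
apply: Qx; have [_ E] := FP i; move: E; rewrite enum_rankK_in // => E.
have [iQ _ _ _] := Qprime; have [iP _ _ _] := Pprime i.
by apply: (residues_sub iQ iP Q2) => //; rewrite E.
Qed.

End PrimesOverTwo.

(** * Quadratic subfields *)

Section SquarefreePart.

Definition sqfree_part (m : nat) : nat :=
  \prod_(p <- primes m | odd (logn p m)) p.

Lemma sqfree_part_gt0 m : (0 < sqfree_part m)%N.
Proof.
rewrite /sqfree_part big_seq_cond prodn_cond_gt0 // => p /andP[].
by rewrite mem_primes => /andP[pp _] _; exact: prime_gt0.
Qed.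

Lemma logn_sqfree_part p m : prime p -> (0 < m)%N ->
  logn p (sqfree_part m) = odd (logn p m).
Proof.
move=> pp m0; rewrite /sqfree_part big_seq_cond logn_prime_prod; last first.
  by move=> q /andP[]; rewrite mem_primes => /andP[qq _] _; exact: prime_gt0.
rewrite (eq_bigr (fun q => (p == q) : nat)); last first.
  by move=> q /andP[]; rewrite mem_primes => /andP[qq _] _; rewrite logn_prime.
rewrite -big_seq_cond.
have [pm|pm] := boolP (odd (logn p m)).
  have pin : p \in primes m by rewrite -logn_gt0; case: logn pm.
  rewrite big_mkcond (bigD1_seq p) ?primes_uniq //= pm eqxx big1 // => q qp.
  by rewrite eq_sym (negPf qp) if_same.
rewrite big1 // => q qm; case: eqP => // E; by rewrite E qm in pm.
Qed.

Lemma squarefreeP m : (0 < m)%N -> (forall p, prime p -> (logn p m <= 1)%N) -> squarefree m.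
Proof.
move=> m0 lm d; case: d => [|[|d]] //; first by rewrite exp0n // dvd0n => /eqP E; rewrite E in m0.
move=> dm; have pp := pdiv_prime (isT : (1 < d.+2)%N).
have := lm _ pp; rewrite leqNgt => /negP; case.
rewrite -[(1 < _)%N]pfactor_dvdn //; apply: dvdn_trans dm.
by apply: dvdn_exp2r; exact: pdiv_dvd.
Qed.

Lemma sqfree_part_squarefree m : (0 < m)%N -> squarefree (sqfree_part m).
Proof.
move=> m0; apply: squarefreeP; first exact: sqfree_part_gt0.
by move=> p pp; rewrite logn_sqfree_part // leq_b1.
Qed.

Lemma sqfree_partE m : (0 < m)%N -> exists2 k, (0 < k)%N & m = (sqfree_part m * k ^ 2)%N.
Proof.
move=> m0; exists (\prod_(p <- primes m) p ^ (logn p m)./2)%N.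
  rewrite big_seq prodn_cond_gt0 // => p; rewrite mem_primes => /andP[pp _].
  by rewrite expn_gt0 prime_gt0.
rewrite {1}(prod_prime_decomp m0) prime_decompE big_map /= /sqfree_part.
rewrite [X in (X * _)%N]big_mkcond -mulnn -!big_split /=.
apply: eq_bigr => p _; rewrite -expnD addnn -{1}(odd_double_half (logn p m)) expnD.
by case: odd; rewrite ?expn1 ?expn0.
Qed.

(** At each prime the two valuations are at most 1 and have the same parity. *)
Lemma squarefree_rat_eq (D D' : nat) (c : rat) : squarefree D -> squarefree D' ->
  D%:R = c ^+ 2 * D'%:R -> D = D'.
Proof.
move=> sD sD' E.
have D0 := squarefree_gt0 sD; have D'0 := squarefree_gt0 sD'.
have En : (D * `|denq c| ^ 2 = D' * `|numq c| ^ 2)%N.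
  apply/eqP; rewrite -(eqr_nat rat) natrM natrX [eqbRHS]natrM natrX !natr_absz !intr_norm !real_normK ?num_real //.
  rewrite E -{1}(divq_num_den c) expr_div_n [X in X * _]mulrAC divfK ?expf_neq0 ?intr_eq0 ?denq_neq0 //.
  by rewrite mulrC.
have d0 : (0 < `|denq c|)%N by rewrite absz_gt0 denq_neq0.
have n0 : (0 < `|numq c|)%N.
  by case: (posnP `|numq c|%N) En => // -> /eqP; rewrite muln0 muln_eq0 expn_eq0 !gtn_eqF.
apply: eqn_from_log => // p.
case: (boolP (prime p)) => pp; last first.
  have nl m : logn p m = 0%N by rewrite lognE (negPf pp).
  by rewrite !nl.
have := congr1 (logn p) En; rewrite [LHS]lognM ?expn_gt0 ?d0 // [RHS]lognM ?expn_gt0 ?n0 // !lognX.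
have l1 m : squarefree m -> (logn p m <= 1)%N.
  move=> sm; case: (boolP (p %| m)%N) => pm; first by rewrite logn_squarefree.
  by rewrite logn_coprime // prime_coprime.
have := l1 _ sD; have := l1 _ sD'; lia.
Qed.

End SquarefreePart.

Section Radicands.
Variables (L : splittingFieldType rat) (n : nat).
Local Notation N := (\dim {:L}).

(** A squarefree [D > 1] is not the square of a rational, so a square root of [D] generates a
    subfield of degree exactly 2. *)
Lemma radicandsP (D : nat) : radicands L D <->
  [/\ (1 < D)%N, squarefree D & exists y : L, y ^+ 2 = D%:R].
Proof.
split=> [[D1 sD [E [_ [y Ey _]]]]|[D1 sD [y Ey]]]; split => //; first by exists y.
exists <<1; y>>%AS; split; last by exists y.
rewrite dim_Fadjoin dimv1 muln1.
have y1 : y \notin 1%VS.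
  apply/negP => /vlineP[c Ec].
  have := @squarefree_rat_eq D 1 c sD _ _.
  rewrite mulr1 => H; suff DE : D = 1%N by rewrite DE in D1.
  apply: H; first by move=> d; rewrite dvdn1 => /eqP; case: d => [|[|]].
  apply: (@ratA_inj L) => /=; rewrite -[c ^+ 2]/(c ^+ 2).
  by rewrite scaler_nat -Ey Ec exprZn expr1n.
apply/eqP; rewrite eqn_leq; apply/andP; split; last first.
  by rewrite ltn_neqAle eq_sym (adjoin_deg_eq1 1%AS y) y1.
have mon : 'X^2 - (D%:R : L)%:P \is monic by rewrite monicXnsubC.
have pov : 'X^2 - (D%:R : L)%:P \is a polyOver 1%VS.
  by rewrite rpredB ?rpredX ?polyOverX // polyOverC rpred_nat.
have rt : root ('X^2 - (D%:R : L)%:P) y by apply/rootP; rewrite !hornerE Ey subrr.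
have := dvdp_leq (monic_neq0 mon) (minPoly_dvdp pov rt).
by rewrite size_minPoly size_XnsubC.
Qed.

Hypothesis galL : galois 1 {:L}.
Variables (a : 'I_n -> nat) (x : 'I_n -> L).
Hypothesis gx : sqrt_gens a x.
Local Notation aS := (fun S : {set 'I_n} => \prod_(i in S) a i)%N.
Local Notation DS S := (sqfree_part (\prod_(i in S) a i)).

Implicit Types S T : {set 'I_n}.

Lemma aS0_gt0 S : (0 < aS S)%N.
Proof. by rewrite prodn_gt0 // => i; exact: gens_gt0 gx i. Qed.

Lemma setprod_inj (c : rat) S T : setprod x S = c *: setprod x T -> S = T.
Proof.
move=> E; apply/eqP; apply/negPn/negP => nST.
have := setprod_trace galL gx S S; rewrite eqxx {1}E -scalerAl field_traceZ.
rewrite (setprod_trace galL gx S T) (negPf nST) mulr0 => /esym/eqP.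
by rewrite pnatr_eq0 -[_ == _]negbK -lt0n (aS_gt0 gx).
Qed.

(** The automorphism negating only [x i] multiplies [y] by a sign. By invariance of the trace, [y]
    has a nonzero coordinate along [setprod x U] only if that sign is negative exactly when [i] is
    in [U], so a single [U] is possible. *)
Lemma sqrt_setprod (D : nat) (y : L) : (0 < D)%N -> y ^+ 2 = D%:R ->
  exists S (c : rat), y = c *: setprod x S.
Proof.
move=> D0 Ey.
have y0 : y != 0 by rewrite -sqrf_eq0 Ey natL_neq0 -lt0n.
have uniq S T : field_trace (y * setprod x S) != 0 -> field_trace (y * setprod x T) != 0 -> S = T.
  move=> tS tT; apply/setP => i.
  have [s sG sx] := gens_signs galL gx [set i].
  have [e Ee] : exists e : bool, s y = (-1) ^+ e * y.
    have : s y ^+ 2 = y ^+ 2 by rewrite -rmorphXn /= Ey rmorph_nat.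
    move=> /eqP; rewrite eqf_sqr => /orP[] /eqP ->; first by exists false; rewrite mul1r.
    by exists true; rewrite expr1 mulN1r.
  have H U : field_trace (y * setprod x U) != 0 -> (i \in U) = e.
    move=> tU; have := field_trace_galV (y * setprod x U) sG.
    rewrite rmorphM /= Ee (setprod_flip U sx); case: (e); case: (i \in U) => //.
      rewrite expr1 mulN1r mulNr -scaleN1r field_traceZ mulN1r => /eqP.
      by rewrite -subr_eq0 -opprD oppr_eq0 -mulr2n mulrn_eq0 /= (negPf tU).
    rewrite expr0 mul1r mulrN -scaleN1r field_traceZ mulN1r => /eqP.
    by rewrite -subr_eq0 -opprD oppr_eq0 -mulr2n mulrn_eq0 /= (negPf tU).
  by rewrite (H S tS) (H T tT).
have [S tS] : exists S, field_trace (y * setprod x S) != 0.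
  apply: contrapT => H; move/eqP: y0; apply.
  rewrite (setprod_coord galL gx y) big1 // => S _.
  case: (eqVneq (field_trace (y * setprod x S)) 0) => [->|tS]; first by rewrite mul0r scale0r.
  by case: H; exists S.
exists S, (field_trace (y * setprod x S) / (2 ^ n * aS S)%:R).
rewrite {1}(setprod_coord galL gx y) (bigD1 S) //= [X in _ + X]big1 ?addr0 // => T nT.
case: (eqVneq (field_trace (y * setprod x T)) 0) => [->|tT]; first by rewrite mul0r scale0r.
by rewrite (uniq T S tT tS) eqxx in nT.
Qed.

Lemma sqfree_part_sqrt S : exists (y : L) (c : rat), y ^+ 2 = (DS S)%:R /\ setprod x S = c *: y.
Proof.
have [k k0 Ek] := sqfree_partE (aS0_gt0 S).
have Lk : (k%:R : L) != 0 by rewrite natL_neq0 -lt0n.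
exists (setprod x S / k%:R), k%:R; split.
  apply: (mulIf (expf_neq0 2 Lk)).
  by rewrite expr_div_n divfK ?expf_neq0 // (setprod_sqr gx) {1}Ek natrM natrX.
by rewrite scaler_nat -[RHS]mulr_natr divfK.
Qed.

Lemma sqfree_part_inj S T : DS S = DS T -> S = T.
Proof.
move=> E; have [y [c [Ey ES]]] := sqfree_part_sqrt S.
have [z [d [Ez ET]]] := sqfree_part_sqrt T.
have d0 : d != 0.
  by apply: contra_neq (setprod_neq0 gx T) => d0; rewrite ET d0 scale0r.
have : y ^+ 2 = z ^+ 2 by rewrite Ey E Ez.
move=> /eqP; rewrite eqf_sqr => /orP[] /eqP yz.
  apply: (@setprod_inj (c / d)).
  by rewrite ET scalerA divfK // -yz.
apply: (@setprod_inj (- c / d)).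
by rewrite ET scalerA divfK // scaleNr -scalerN -yz.
Qed.

Lemma radicands_gens (D : nat) : radicands L D <-> exists2 S : {set 'I_n}, S != finset.set0 & D = DS S.
Proof.
rewrite radicandsP; split=> [[D1 sD [y Ey]]|[S S0 ->]].
  have D0 := ltnW D1.
  have [S [c Ec]] := sqrt_setprod D0 Ey.
  have [z [d [Ez ES]]] := sqfree_part_sqrt S.
  have ED : D = DS S.
    apply: (@squarefree_rat_eq _ _ (c * d)) => //; first exact/sqfree_part_squarefree/aS0_gt0.
    apply: (@ratA_inj L) => /=.
    rewrite scaler_nat -Ey Ec ES scalerA exprZn Ez -[in RHS]scalerA.
    by rewrite [in RHS]scaler_nat.
  exists S => //; apply: contraTneq D1 => E; rewrite ED E big_set0.
  by rewrite /sqfree_part big_nil.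
have E1 : DS (finset.set0 : {set 'I_n}) = 1%N by rewrite big_set0 /sqfree_part big_nil.
split; last by have [y [c [Ey _]]] := sqfree_part_sqrt S; exists y.
- rewrite ltn_neqAle sqfree_part_gt0 andbT eq_sym; apply: contra S0 => /eqP E.
  by apply/eqP; apply: sqfree_part_inj; rewrite E1.
- exact/sqfree_part_squarefree/aS0_gt0.
Qed.

End Radicands.

(** * Generators of a totally real multiquadratic field and ramification at 2 *)

Section Interface.
Variables (L : splittingFieldType rat) (n : nat).
Local Notation O := (@int_ring L).
Local Notation N := (\dim {:L}).
Local Notation G := 'Gal({:L} / 1)%g.

Lemma fix_generators (s : gal_of {:L}) (xs : seq L) : {:L}%VS = <<1 & xs>>%VS ->
  s \in G -> (forall y, y \in xs -> s y = y) -> s = 1%g.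
Proof.
move=> Lx sG sx; apply/eqP/gal_eqP => y _; rewrite gal_id.
have yx : y \in <<1 & xs>>%VS by rewrite -Lx memvf.
have : (<<1 & xs>> <= fixedField [set s])%VS.
  apply/Fadjoin_seqP; split; first exact: sub1v.
  move=> z zx; apply/fixedFieldP; first exact: memvf.
  by move=> t; rewrite inE => /eqP ->; exact: sx.
move=> /subvP/(_ y yx) /fixedFieldP H.
by apply: (H (memvf y)); rewrite inE.
Qed.

Lemma tot_gens : totally_real_multiquadratic n L ->
  galois 1 {:L} /\ exists (a : 'I_n -> nat) (x : 'I_n -> L),
    [/\ sqrt_gens a x, forall i, (1 < a i)%N, forall i, squarefree (a i) &
        {:L}%VS = <<1 & [tuple x i | i < n]>>%VS].
Proof.
move=> [galL iso [a [x [a1 sa xa Lx]]]]; split => //.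
exists a, (fun i => x`_i); split => //; last first.
  rewrite Lx; congr (<<1 & _>>%VS); apply: (@eq_from_nth _ 0); first by rewrite !size_tuple.
  move=> i; rewrite size_tuple => li.
  by rewrite -[i]/(nat_of_ord (Ordinal li)) -[RHS]tnth_nth tnth_mktuple.
split => //.
- by move=> i; exact: ltnW.
- move=> s sG sx; apply: (fix_generators Lx sG) => y /tnthP[i ->].
  by rewrite (tnth_nth 0).
- by rewrite (card_isog iso) cardsT card_mx mul1n card_Fp.
Qed.

(** [r] records the parities of the coordinates in an integral basis. *)
Lemma residues_exist (a : 'I_n -> nat) (x : 'I_n -> L) :
  galois 1 {:L} -> sqrt_gens a x -> exists (T : finType) (r : L -> T),
  forall y z, O y -> O z -> r y = r z -> congO 2 y z.
Proof.
move=> galL gx; have [b [bb intb]] := integral_basisP galL gx.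
have /choice[c Ec] (y : L) : exists c : 'I_N -> int,
    O y -> y = \sum_(i < N) b`_i *~ c i.
  have [/intb[c Ec]|nOy] := pselect (O y); first by exists c.
  by exists (fun=> 0).
exists {ffun 'I_N -> bool}, (fun y => [ffun i => odd `|c y i|%N]).
move=> y z Oy Oz /ffunP E.
have /choice[q Eq] (i : 'I_N) : exists q : int, c y i - c z i = 2%:Z * q.
  have := E i; rewrite !ffunE => Ei.
  by exists ((c y i - c z i) %/ 2)%Z; lia.
exists (\sum_(i < N) b`_i *~ q i).
  apply: int_ring_sum => i _; apply: int_ringMz; apply: int_basis_mem => //.
rewrite (Ec y Oy) (Ec z Oz) -sumrB mulr_sumr; apply: eq_bigr => i _.
by rewrite -mulrzBr Eq mulrC mulrzA -[LHS]mulrzl.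
Qed.

Lemma half_integer_not_int (w : L) (q : nat) : O w -> 2%:R * w = (q.*2.+1)%:R -> False.
Proof.
move=> Ow Ew.
have E : w = ((q.*2.+1)%:R / 2%:R)%:A.
  apply: (mulfI (two_neq0 L)); rewrite Ew [RHS]mulr_natl -[RHS]scaler_nat scalerA.
  by rewrite mulrC divfK // scaler_nat.
move: Ow; rewrite E => /int_ring_rat/intrP[m Em].
have : ((q.*2.+1)%:R : rat) = (m * 2%:Z)%:~R by rewrite intrM -Em divfK.
rewrite pmulrn => /eqP; rewrite eqr_int => /eqP; lia.
Qed.

(** If [a i] is 2 modulo 4, the square of [x i] is divisible by 2; if it is 3, that of [1 + x i] is.
    When 2 is unramified that element is then twice an integral [w], and [w ^+ 2], respectively
    [w ^+ 2 - w], would be half an odd integer. *)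
Lemma unramified2_gens (a : 'I_n -> nat) (x : 'I_n -> L) :
  galois 1 {:L} -> sqrt_gens a x -> (forall i, squarefree (a i)) ->
  unramified L 2 <-> forall i, (a i %% 4 = 1)%N.
Proof.
move=> galL gx sa; have [T [r rP]] := residues_exist galL gx.
split=> [unr i|a4]; last first.
  apply: (frobenius_unramified2 rP) (two_neq0 L) => y Oy.
  exact: (int_ring_frobenius galL gx a4).
have na4 : (a i %% 4 != 0)%N.
  by apply/negP => /(sa i 2%N).
have Ox := int_ring_gens gx i.
have sqx := gens_sqr gx i.
have Ea := divn_eq (a i) 4; have := ltn_pmod (a i) (isT : (0 < 4)%N).
set q := (a i %/ 4)%N in Ea.
move: na4 Ea; case: (a i %% 4)%N => [|[|[|[|]]]] // _ Ea _.
  have [|w Ow] := @unramified2_reduced L T r rP (x i) unr Ox.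
    exists (q.*2.+1)%:R; first exact: natr_int_ring.
    by rewrite subr0 sqx Ea -natrM; congr (_%:R); lia.
  rewrite subr0 => Ew; exfalso.
  apply: (@half_integer_not_int (w ^+ 2) q); first exact: int_ringX.
  apply: (mulfI (two_neq0 L)); transitivity (x i ^+ 2); first by rewrite Ew; ring.
  by rewrite sqx Ea -natrM; congr (_%:R); lia.
have Oy : O (1 + x i) by apply: int_ringD => //; exact: (natr_int_ring L 1).
have sq1 : (1 + x i) ^+ 2 = 2%:R * ((q.*2.+2)%:R + x i).
  rewrite mulrDr -natrM (_ : (2 * q.*2.+2 = a i + 1)%N) ?natrD -?sqx; last by lia.
  ring.
have [|w Ow] := @unramified2_reduced L T r rP (1 + x i) unr Oy.
  exists ((q.*2.+2)%:R + x i); first by apply: int_ringD => //; exact: natr_int_ring.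
  by rewrite subr0.
rewrite subr0 => Ew; exfalso.
apply: (@half_integer_not_int (w ^+ 2 - w) q); first by apply: int_ringB => //; exact: int_ringX.
apply: (mulfI (two_neq0 L)); transitivity ((1 + x i) ^+ 2 - 2%:R * (1 + x i)).
  by rewrite Ew; ring.
rewrite sq1 -mulrBr; congr (_ * _).
rewrite (_ : q.*2.+2 = q.*2.+1 + 1)%N ?natrD; last by lia.
ring.
Qed.

End Interface.

(** * Real multiquadratic fields with prescribed radicands *)

Section Existence.
Variable (R : realType).

Definition rat_alg (z : R) := exists2 p : {poly rat}, p != 0 & root (map_poly ratr p) z.

Lemma pchar_rat : [pchar rat] =i pred0.
Proof. exact: pchar_num. Qed.

Lemma rat_algP (z : R) : rat_alg z <-> integralOver (ratr : rat -> R) z.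
Proof.
split=> [[p p0 rp]|[p pm rp]]; last by exists p => //; exact: monic_neq0.
by apply/(integral_algebraic (ratr : {rmorphism rat -> R})); exists p.
Qed.

Lemma rat_algB (y z : R) : rat_alg y -> rat_alg z -> rat_alg (y - z).
Proof.
move=> /rat_algP ay /rat_algP az; apply/rat_algP.
exact: (@integral_sub _ _ (ratr : {rmorphism rat -> R})).
Qed.

Lemma rat_algMn (y : R) k : rat_alg y -> rat_alg (y *+ k).
Proof.
move=> /rat_algP ay; apply/rat_algP; rewrite -mulr_natr.
apply: (@integral_mul _ _ (ratr : {rmorphism rat -> R})) => //.
exact: (integral_nat (ratr : {rmorphism rat -> R})).
Qed.

(** The primitive element is built one [y] at a time as [y *+ k - z]. The clause on [P] records that
    it lies in the additive group generated by [ys]; it serves to pull the primitive element back to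
    the subspace generated by the roots. *)
Lemma real_PET (ys : seq R) : (forall y, y \in ys -> rat_alg y) ->
  exists z, [/\ rat_alg z,
    forall P : R -> Prop, P 0 -> (forall u v, P u -> P v -> P (u - v)) ->
      (forall y, y \in ys -> P y) -> P z &
    forall y, y \in ys -> exists p, (map_poly ratr p).[z] = y].
Proof.
elim: ys => [|y ys IH] alg.
  exists 0; split => //; exists 'X; first by rewrite polyX_eq0.
  by rewrite map_polyX rootX.
have [|z [az Pz pz]] := IH; first by move=> u uys; apply: alg; rewrite inE uys orbT.
have ay : rat_alg y by apply: alg; rewrite inE eqxx.
have [q q0 qy] := ay; have [p p0 pz0] := az.
have [k [[g1 E1] [g2 E2]]] := @pchar0_PET _ _ (ratr : {rmorphism rat -> R}) z y p p0 pz0 q q0 qy pchar_rat.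
exists (y *+ k - z); split.
- by apply: rat_algB => //; exact: rat_algMn.
- move=> P P0 PB Pys; apply: (PB); last first.
    by apply: Pz => // u uys; apply: Pys; rewrite inE uys orbT.
  have Py : P y by apply: Pys; rewrite inE eqxx.
  have PN u : P u -> P (- u) by rewrite -sub0r; exact: PB.
  elim: k {E1 E2} => [|k IHk]; first by rewrite mulr0n.
  by rewrite mulrSr -[y in X in P (_ + X)]opprK; apply: PB => //; exact: PN.
- move=> u; rewrite inE => /orP[/eqP ->|/pz[h <-]]; first by exists g2.
  by exists (h \Po g1); rewrite map_comp_poly horner_comp E1.
Qed.

Lemma prod_sqrt_split (F : fieldType) (n : nat) (a : 'I_n -> nat) (x : 'I_n -> F) :
  (forall i, x i ^+ 2 = (a i)%:R) ->
  \prod_(i < n) ('X^2 - (a i)%:R%:P) =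
  \prod_(z <- [tuple x i | i < n] ++ [seq - u | u <- [tuple x i | i < n]]) ('X - z%:P).
Proof.
move=> sqx; rewrite big_cat big_map !big_tuple; apply: etrans (big_split _ _ _ _ _).
by apply: eq_bigr => i _ /=; rewrite tnth_ord_tuple tnth_map tnth_mktuple -sqx polyCN opprK polyC_exp subr_sqr.
Qed.

Section Construct.
Variables (n : nat) (a : 'I_n -> nat).

Lemma multiquadratic_splitting : exists (L : splittingFieldType rat)
  (iota : {rmorphism L -> R}) (x : 'I_n -> L),
  (forall i, x i ^+ 2 = (a i)%:R) /\ {:L}%VS = <<1 & [tuple x i | i < n]>>%VS.
Proof.
pose ys := [seq Num.sqrt ((a i)%:R : R) | i <- enum 'I_n].
have [|z [[p' p'0 rp'] Pz pz]] := @real_PET ys.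
  move=> _ /mapP[i _ ->]; exists ('X^2 - (a i)%:R%:P).
    by rewrite monic_neq0 // monicXnsubC.
  by apply/rootP; rewrite rmorphB /= map_polyXn map_polyC /= !hornerE rmorph_nat sqr_sqrtr ?ler0n ?subrr.
(* An annihilating polynomial of least size is irreducible, and presents the field generated by
   [z]. *)
pose Q := [pred m : nat | `[< exists q : {poly rat}, [/\ q != 0, root (map_poly ratr q) z & size q = m] >]].
have exQ : exists m, Q m by exists (size p'); apply/asboolP; exists p'.
case: (ex_minnP exQ) => m /asboolP[p [p0 rp sp]] minm.
have irr : irreducible_poly p.
  apply/(subfx_irreducibleP (iota := (ratr : {rmorphism rat -> R})) rp p0) => q rq q0.
  by rewrite sp; apply: minm; apply/asboolP; exists q.
pose L0 : fieldExtType rat := SubFieldExtType rp irr.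
pose io : {rmorphism L0 -> R} := @subfx_inj _ _ (ratr : {rmorphism rat -> R}) z p.
have evalP q : exists u : L0, io u = (map_poly ratr q).[z].
  by exists (subfx_eval _ z p q); rewrite /io /= subfx_inj_eval.
have /choice[x Ex] (i : 'I_n) : exists u : L0, io u = Num.sqrt ((a i)%:R : R).
  have [|q Eq] := pz (Num.sqrt ((a i)%:R : R)); first by apply: map_f; rewrite mem_enum.
  by have [u Eu] := evalP q; exists u; rewrite Eu.
have sqx i : x i ^+ 2 = (a i)%:R.
  by apply: (fmorph_inj io); rewrite rmorphXn /= Ex sqr_sqrtr ?ler0n // rmorph_nat.
pose xt := [tuple x i | i < n].
have xin i : x i \in <<1 & xt>>%VS.
  by apply: seqv_sub_adjoin; rewrite -[x i](tnth_mktuple x i) mem_tnth.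
have full : {:L0}%VS = <<1 & xt>>%VS.
  apply/eqP; rewrite eqEsubv subvf andbT; apply/subvP => u _.
  have [v vin Ev] : exists2 v, v \in <<1 & xt>>%VS & io v = z.
    apply: (Pz (fun t => exists2 v, v \in <<1 & xt>>%VS & io v = t)).
    - by exists 0; rewrite ?mem0v ?rmorph0.
    - by move=> _ _ [v vin <-] [w win <-]; exists (v - w); rewrite ?memvB ?rmorphB.
    - by move=> _ /mapP[i _ ->]; exists (x i).
  have [q ->] := subfxEroot rp p0 u.
  have -> : subfx_root (ratr : {rmorphism rat -> R}) z p = v.
    by apply: (fmorph_inj io); rewrite Ev; exact: subfx_inj_root.
  apply: (@rpred_horner _ <<1 & xt>>%AS) => //.
  by apply/polyOverP => k; rewrite coef_map; exact: (memvZ _ (mem1v _)).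
have spl : splitting_field_axiom L0.
  exists (\prod_(i < n) ('X^2 - (a i)%:R%:P)).
    apply: rpred_prod => i _; rewrite rpredB ?rpredX ?polyOverX //.
    by rewrite polyOverC rpred_nat.
  exists (xt ++ [seq - u | u <- xt]).
    by rewrite (prod_sqrt_split sqx) eqpxx.
  apply/eqP; rewrite eqEsubv subvf /= full; apply/Fadjoin_seqP; split; first exact: sub1v.
  move=> u uxt; apply: seqv_sub_adjoin; by rewrite mem_cat uxt.
pose mix := FieldExt_isSplittingField.Build _ L0 spl.
pose L : splittingFieldType rat := HB.pack (L0 : Type) (SubFieldExtType rp irr) mix.
by exists L, io, x.
Qed.

Hypothesis a0 : forall i, (0 < a i)%N.
Hypothesis indep : forall S : {set 'I_n}, S != finset.set0 ->
  sqfree_part (\prod_(i in S) a i) != 1%N.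

(** The order of the Galois group comes from summing [s (setprod x S) / setprod x S] over all [s]
    and [S] in two ways. For fixed [s <> 1] the sum over [S] vanishes, since [s] negates a
    generator, and the total is [2 ^ n]. For fixed nonempty [S] the sum over [s] vanishes, by
    independence of the radicands, and the total is the order of the group. *)
Theorem multiquadratic_exists : exists (L : splittingFieldType rat)
  (iota : {rmorphism L -> R}) (x : 'I_n -> L),
  [/\ galois 1 {:L}, sqrt_gens a x & {:L}%VS = <<1 & [tuple x i | i < n]>>%VS].
Proof.
have [L [io [x [sqx full]]]] := multiquadratic_splitting.
have galL : galois 1 {:L}.
  apply/and3P; split; [exact: sub1v | | exact: normalFieldf].
  apply/separableP => u _; apply: pcharf0_separable => q.
  by rewrite (pchar_lalg L) pchar_rat.
exists L, io, x; split => //.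
have x0 i : x i != 0.
  by rewrite -sqrf_eq0 sqx natL_neq0 -lt0n.
have fix1 s : s \in 'Gal({:L} / 1)%g -> (forall i, s (x i) = x i) -> s = 1%g.
  move=> sG sx; apply: (fix_generators full sG) => y /tnthP[i ->].
  by rewrite tnth_mktuple.
have flip (s : gal_of {:L}) i : s (x i) = x i \/ s (x i) = - x i.
  have : s (x i) ^+ 2 = x i ^+ 2 by rewrite -rmorphXn /= sqx rmorph_nat.
  by move=> /eqP; rewrite eqf_sqr => /orP[] /eqP ->; [left | right].
split => //.
have nz S : setprod x S != 0 by apply/prodf_neq0.
have chsum S : S != finset.set0 -> \sum_(s in 'Gal({:L} / 1)%g) s (setprod x S) = 0.
  move=> S0.
  have sq : setprod x S ^+ 2 = (\prod_(i in S) a i)%:R.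
    by rewrite /setprod -prodrXl natr_prod; apply: eq_bigr => i _; rewrite sqx.
  have [s sG sS] : exists2 s, s \in 'Gal({:L} / 1)%g & s (setprod x S) = - setprod x S.
    apply: contrapT => H.
    have [|c Ec] := gal_fixed_rat galL (y := setprod x S).
      move=> s sG; have : s (setprod x S) ^+ 2 = setprod x S ^+ 2.
        by rewrite -rmorphXn /= sq rmorph_nat.
      move=> /eqP; rewrite eqf_sqr => /orP[] /eqP // E.
      by case: H; exists s.
    have A0 : (0 < \prod_(i in S) a i)%N by rewrite prodn_gt0.
    have [k k0 Ek] := sqfree_partE A0.
    have k0' : (k%:R : rat) != 0 by rewrite pnatr_eq0 -lt0n.
    move/eqP: (indep S0); apply.
    apply: (@squarefree_rat_eq _ 1 (c / k%:R)).
    - exact: sqfree_part_squarefree.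
    - by move=> d; rewrite dvdn1 => /eqP; case: d => [|[|]].
    - rewrite mulr1; apply: (mulIf (expf_neq0 2 k0')).
      rewrite expr_div_n divfK ?expf_neq0 // -natrX -natrM -Ek.
      apply: (@ratA_inj L) => /=.
      by rewrite scaler_nat -sq Ec exprZn expr1n.
  rewrite -(field_trace_gal galL); have := field_trace_galV (setprod x S) sG.
  rewrite sS -scaleN1r field_traceZ mulN1r => /eqP.
  by rewrite eq_sym -addr_eq0 -mulr2n mulrn_eq0 /= => /eqP ->; rewrite scale0r.
apply/eqP; rewrite -(eqr_nat rat) -(inj_eq (@ratA_inj L)) /= !scaler_nat.
rewrite -sumr_const natrX.
have : \sum_(S in {set 'I_n}) \sum_(s in 'Gal({:L} / 1)%g) s (setprod x S) / setprod x S =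
    (2%:R ^+ n : L).
  rewrite exchange_big /= (bigD1 1%g) ?group1 //= [X in _ + X]big1 ?addr0.
    rewrite (eq_bigr (fun=> 1)); last by move=> S _; rewrite gal_id divff.
    by rewrite sumr_const -cardsT -powersetT card_powerset cardsT card_ord natrX.
  move=> s /andP[sG s1].
  have [i si] : exists i, s (x i) = - x i.
    apply: contrapT => H; move/eqP: s1; apply; apply: fix1 => // i.
    by case: (flip s i) => // E; case: H; exists i.
  rewrite (eq_bigr (fun S : {set 'I_n} => \prod_i (if i \in S then s (x i) / x i else 1))); last first.
    move=> S _; rewrite /setprod rmorph_prod -prodf_div big_mkcond.
    by apply: eq_bigr => j _; case: ifP.
  by rewrite -bigA_distr (bigD1 i) //= si mulNr divff // addNr mul0r.
move=> <-; rewrite (bigD1 finset.set0) //= [X in _ + X]big1 ?addr0.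
  by apply/eqP; apply: eq_bigr => s _; rewrite /setprod big_set0 rmorph1 divr1.
by move=> S S0; rewrite -mulr_suml chsum // mul0r.
Qed.

End Construct.
End Existence.

(** * Fields and coprime tuples *)

Section Bits.
Variable n : nat.
Local Notation V := 'rV['F_2]_n.
Local Notation l := (ell n).

Lemma F2_cases (u : 'F_2) : u = 0 \/ u = 1.
Proof. by case: u => [[|[|m]] //= lt]; [left | right]; apply/val_inj. Qed.

Lemma F2_neq0 (u : 'F_2) : (u != 0) = (u == 1).
Proof. by case: (F2_cases u) => ->. Qed.

Lemma F2_addrr (u : 'F_2) : u + u = 0.
Proof. by case: (F2_cases u) => ->; apply/val_inj. Qed.

Lemma rV2_addrr (u : V) : u + u = 0.
Proof. by apply/rowP => i; rewrite !mxE F2_addrr. Qed.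

Lemma bits_modn j m : (j %% 2 ^ m = \sum_(t < m) odd (j %/ 2 ^ t) * 2 ^ t)%N.
Proof.
elim: m => [|m IH]; first by rewrite expn0 modn1 big_ord0.
rewrite big_ord_recr /= -IH.
have p0 : (0 < 2 ^ m)%N by rewrite expn_gt0.
rewrite {1}(divn_eq j (2 ^ m)) {1}(divn_eq (j %/ 2 ^ m) 2) expnS modn2 mulnDl.
have -> : (j %/ 2 ^ m %/ 2 * 2 * 2 ^ m + odd (j %/ 2 ^ m) * 2 ^ m + j %% 2 ^ m =
  j %/ 2 ^ m %/ 2 * (2 * 2 ^ m) + (j %% 2 ^ m + odd (j %/ 2 ^ m) * 2 ^ m))%N by ring.
rewrite modnMDl modn_small //.
have := ltn_pmod j p0; case: odd; lia.
Qed.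

Lemma vbits_inj i j : (i < 2 ^ n)%N -> (j < 2 ^ n)%N -> vbits n i = vbits n j -> i = j.
Proof.
move=> li lj E; rewrite -(modn_small li) -(modn_small lj) !bits_modn.
apply: eq_bigr => t _; congr (_ * _)%N.
have /rowP/(_ t) := E; rewrite !mxE.
by case: odd; case: odd.
Qed.

Lemma vbits0 : vbits n 0 = 0.
Proof. by apply/rowP => t; rewrite !mxE div0n. Qed.

Lemma ell_lt : (l.+1 = 2 ^ n)%N.
Proof. by rewrite /ell subn1 prednK // expn_gt0. Qed.

(** The shift by one skips the zero vector: the [vbit i] run once over the nonzero vectors. *)
Definition vbit (i : 'I_l) : V := vbits n i.+1.

Lemma vbit_inj : injective vbit.
Proof.
move=> i j E; apply/val_inj; have := @vbits_inj i.+1 j.+1.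
by rewrite -!ell_lt !ltnS !ltn_ord => /(_ isT isT E) [].
Qed.

Lemma vbit_neq0 i : vbit i != 0.
Proof.
apply/eqP; rewrite -vbits0 => E; have := @vbits_inj i.+1 0.
by rewrite -!ell_lt !ltnS !ltn_ord /= => /(_ isT isT E).
Qed.

Lemma vbit_onto (w : V) : w != 0 -> exists i, vbit i = w.
Proof.
move=> w0.
have sub : [set vbit i | i in 'I_l] \subset [set~ 0].
  by apply/fintype.subsetP => _ /imsetP[i _ ->]; rewrite !inE vbit_neq0.
have : [set vbit i | i in 'I_l] == [set~ 0].
  rewrite eqEcard sub /= card_imset ?card_ord; last exact: vbit_inj.
  by rewrite cardsC1 card_mx card_Fp // mul1n -subn1.
move=> /eqP/setP/(_ w); rewrite !inE w0 => /imsetP[i _ ->].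
by exists i.
Qed.

Definition dot (u w : V) : 'F_2 := (u *m w^T) 0 0.

Lemma dotvE i j : dotv n i j = dot (vbits n i) (vbits n j).
Proof. by []. Qed.

Lemma dotC u w : dot u w = dot w u.
Proof. by rewrite /dot !mxE; apply: eq_bigr => i _; rewrite !mxE mulrC. Qed.

Lemma dotDr u w w' : dot u (w + w') = dot u w + dot u w'.
Proof. by rewrite /dot linearD mulmxDr mxE. Qed.

Lemma dot0r u : dot u 0 = 0.
Proof. by rewrite /dot linear0 mulmx0 mxE. Qed.

Lemma dotDl u u' w : dot (u + u') w = dot u w + dot u' w.
Proof. by rewrite dotC dotDr dotC [dot w u']dotC. Qed.

Lemma dot0l u : dot 0 u = 0.
Proof. by rewrite dotC dot0r. Qed.

Lemma dot_delta u t : dot u (delta_mx 0 t) = u 0 t.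
Proof.
rewrite /dot mxE (bigD1 t) //= !mxE !eqxx mulr1 big1 ?addr0 // => i it.
by rewrite !mxE (negPf it) andbF mulr0.
Qed.

Lemma dot_neq0 u : u != 0 -> exists w, dot u w = 1.
Proof.
move=> u0; apply: contrapT => H; move/eqP: u0; apply; apply/rowP => t; rewrite mxE.
case: (F2_cases (u 0 t)) => // E; case: H; exists (delta_mx 0 t).
by rewrite dot_delta.
Qed.

Lemma vbits_pow (t : 'I_n) : vbits n (2 ^ t) = delta_mx 0 t.
Proof.
apply/rowP => i; rewrite !mxE eqxx /=.
have [ti|it|/val_inj ->] := ltngtP t i.
- rewrite divn_small ?ltn_exp2l //; case: eqP => // E; by rewrite E ltnn in ti.
- rewrite -(subnK (ltnW it)) expnD mulnK ?expn_gt0 //.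
  have -> : odd (2 ^ (t - i)) = false by rewrite oddX /= orbF subn_eq0 leqNgt it.
  by case: eqP => // E; rewrite E ltnn in it.
- by rewrite divnn expn_gt0 /= eqxx.
Qed.

(* Translation by a vector [w0] with [u . w0 = 1] exchanges the two classes. *)
Lemma card_dot_half (u v : V) : u != 0 -> v != u ->
  (v != 0) -> #|[set w | (dot u w == 1) && (dot v w == 1)]| =
              #|[set w | (dot u w != 1) && (dot v w == 1)]|.
Proof.
move=> u0 vu v0.
have [w0 [E1 E2]] : exists w0, dot u w0 = 1 /\ dot v w0 = 0.
  have uv : u + v != 0.
    apply: contra_neq vu => E; apply/eqP; rewrite -subr_eq0; apply/eqP.
    have -> : - u = u by apply/eqP; rewrite -subr_eq0 -opprD rV2_addrr oppr0.
    by rewrite addrC.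
  have [w Ew] := dot_neq0 uv; have [w' Ew'] := dot_neq0 u0.
  move: Ew; rewrite dotDl.
  case: (F2_cases (dot u w)) => Eu; case: (F2_cases (dot v w)) => Ev; rewrite Eu Ev.
  - by rewrite addr0 => /eqP.
  - move=> _; case: (F2_cases (dot v w')) => Ev'; first by exists w'.
    by exists (w + w'); rewrite !dotDr Eu Ev Ew' Ev' add0r F2_addrr.
  - by move=> _; exists w.
  - by rewrite F2_addrr => /eqP.
have inj : injective (fun w : V => w + w0) by move=> x y /addIr.
rewrite -(card_imset _ inj); apply: eq_card => w; rewrite inE.
apply/imsetP/idP => [[w']|/andP[H1 H2]].
  by rewrite inE => /andP[/eqP H1 /eqP H2] ->; rewrite !dotDr H1 H2 E1 E2 F2_addrr addr0 eqxx.
exists (w + w0); last by rewrite -addrA rV2_addrr addr0.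
rewrite inE !dotDr E1 E2 addr0 H2 andbT.
by move: H1; rewrite -F2_neq0 negbK => /eqP ->; rewrite add0r.
Qed.

Lemma card_dot1 (u : V) : u != 0 -> #|[set w | dot u w == 1]| = (2 ^ n.-1)%N.
Proof.
move=> u0; have [w0 E0] := dot_neq0 u0.
have E : #|[set w | dot u w == 1]| = #|~: [set w | dot u w == 1]|.
  have inj : injective (fun w : V => w + w0) by move=> x y /addIr.
  rewrite -(card_imset _ inj); apply: eq_card => w; rewrite !inE.
  apply/imsetP/idP => [[w']|H].
    by rewrite inE => /eqP H ->; rewrite dotDr H E0 F2_addrr.
  exists (w + w0); last by rewrite -addrA rV2_addrr addr0.
  by rewrite inE dotDr E0; move: H; rewrite -F2_neq0 negbK => /eqP ->; rewrite add0r.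
have := cardsC [set w | dot u w == 1]; rewrite -E card_mx card_Fp // mul1n addnn.
have n0 : (0 < n)%N.
  rewrite lt0n; apply: contraNneq u0 => n0; apply/eqP/rowP => t.
  by have := ltn_ord t; rewrite [X in (_ < X)%N]n0.
have -> : (2 ^ n = (2 ^ n.-1).*2)%N by rewrite -mul2n -expnS prednK.
exact: double_inj.
Qed.

End Bits.

Section Tuples.
Variable n : nat.
Local Notation V := 'rV['F_2]_n.
Local Notation l := (ell n).
Implicit Types (g : 'I_l -> nat) (w : V).

Definition radprod g w : nat := \prod_(i < l | dot (vbit i) w == 1) g i.

Lemma radprod0 g : radprod g 0 = 1%N.
Proof. by rewrite /radprod big_pred0 // => i; rewrite dot0r. Qed.

Definition tuple_adm g := (forall i, squarefree (g i)) /\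
  (forall i j, i != j -> coprime (g i) (g j)).

Lemma radprod_gt0 g w : (forall i, (0 < g i)%N) -> (0 < radprod g w)%N.
Proof. by move=> g0; rewrite prodn_cond_gt0. Qed.

Lemma radprod_prod (P : pred V) g :
  (\prod_(w | P w) radprod g w = \prod_i g i ^ #|[set w | P w && (dot (vbit i) w == 1%R)]|)%N.
Proof.
rewrite /radprod; under eq_bigr do rewrite big_mkcond.
rewrite exchange_big /=; apply: eq_bigr => i _.
rewrite -big_mkcondr /= prod_nat_const; congr (_ ^ _)%N.
by apply: eq_card => w; rewrite inE.
Qed.

(** For [j] other than [i], the vectors [w] with [dot (vbit j) w = 1] are split evenly between the
    two classes, so the powers of [g j] cancel and those of [g i] remain. This recovers a tuple from
    its radicands. *)
Lemma radprod_inversion g i :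
  (\prod_(w | dot (vbit i) w == 1%R) radprod g w =
   g i ^ (2 ^ n.-1) * \prod_(w | dot (vbit i) w != 1%R) radprod g w)%N.
Proof.
rewrite !radprod_prod (bigD1 i) //= [in RHS](bigD1 i) //= mulnA; congr (_ * _)%N.
  rewrite -[LHS]muln1; congr (_ ^ _ * _)%N.
    by rewrite -(card_dot1 (vbit_neq0 i)); apply: eq_card => w; rewrite !inE andbb.
  rewrite (_ : [set w | _] = finset.set0) ?cards0 //.
  by apply/setP => w; rewrite !inE andNb.
apply: eq_bigr => j ji; congr (_ ^ _)%N; apply: card_dot_half.
- exact: vbit_neq0.
- by apply: contra ji => /eqP/vbit_inj ->.
- exact: vbit_neq0.
Qed.

Lemma radprod_inj g g' : (forall i, (0 < g i)%N) -> radprod g =1 radprod g' -> g =1 g'.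
Proof.
move=> g0 E i; have := radprod_inversion g i.
rewrite (eq_bigr (radprod g')) => [|w _]; last exact: E.
rewrite [in RHS](eq_bigr (radprod g')) => [|w _]; last exact: E.
rewrite radprod_inversion => /eqP; rewrite eqn_pmul2r.
  by rewrite eqn_exp2r ?expn_gt0 // => /eqP.
by rewrite prodn_cond_gt0 // => w _; rewrite -E; exact: radprod_gt0.
Qed.

Lemma logn_radprod p g w : tuple_adm g -> prime p ->
  (exists i, [/\ (p %| g i)%N, logn p (radprod g w) = (dot (vbit i) w == 1) &
     forall w', logn p (radprod g w') = (dot (vbit i) w' == 1)]) \/
  (forall i, ~~ (p %| g i)%N) /\ (forall w', logn p (radprod g w') = 0%N).
Proof.
move=> [sg cg] pp; have g0 i : (0 < g i)%N := squarefree_gt0 (sg i).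
have [[i pi]|H] := pselect (exists i, (p %| g i)%N).
  have E w' : logn p (radprod g w') = (dot (vbit i) w' == 1).
    rewrite logn_prime_prod // big_mkcond (bigD1 i) //= logn_squarefree //.
    rewrite big1 ?addn0; first by case: ifP.
    move=> j ji; case: ifP => // _; rewrite logn_coprime // prime_coprime //.
    apply/negP => pj; have := cg _ _ ji; rewrite /coprime => /eqP E.
    have : (p %| 1)%N by rewrite -E dvdn_gcd pj pi.
    by rewrite dvdn1 => /eqP Ep; rewrite Ep in pp.
  by left; exists i.
have np i : ~~ (p %| g i)%N by apply/negP => pi; apply: H; exists i.
right; split => // w'; rewrite logn_prime_prod // big1 // => i _.
by rewrite logn_coprime // prime_coprime.
Qed.

Lemma radprod_squarefree g w : tuple_adm g -> squarefree (radprod g w).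
Proof.
move=> ag; have g0 i : (0 < g i)%N by case: ag => sg _; exact: squarefree_gt0.
apply: squarefreeP; first exact: radprod_gt0.
move=> p pp; have [[i [_ -> _]]|[_ ->]] := logn_radprod w ag pp => //.
exact: leq_b1.
Qed.

Definition set_vec (S : {set 'I_n}) : V := \row_t (t \in S)%:R.

Lemma set_vec_sum S : set_vec S = \sum_(t in S) delta_mx 0 t.
Proof.
apply/rowP => t; rewrite !mxE summxE; have [tS|tS] := boolP (t \in S).
  rewrite (bigD1 t) //= !mxE !eqxx big1 ?addr0 // => i /andP[_ it].
  by rewrite !mxE [t == i]eq_sym (negPf it) andbF.
rewrite big1 // => i iS; rewrite mxE; suff /negPf -> : t != i by rewrite andbF.
by apply: contraNneq tS => ->.
Qed.

Lemma dot_sum u (I : finType) (P : pred I) (f : I -> V) :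
  dot u (\sum_(i | P i) f i) = \sum_(i | P i) dot u (f i).
Proof.
by elim/big_rec2: _ => [|i x y _ <-]; rewrite ?dot0r ?dotDr.
Qed.

Lemma F2_sum_odd (I : finType) (P : pred I) (f : I -> 'F_2) :
  (\sum_(i | P i) f i == 1) = odd (\sum_(i | P i) (f i == 1%R))%N.
Proof.
elim/big_rec2: _ => [|i k u _ E] //; rewrite oddD -E.
by case: (F2_cases (f i)) => ->; case: (F2_cases k) => ->.
Qed.

(** Multiplying radicands up to squares is adding vectors: at a prime dividing [g i], the parity of
    the number of factors it divides is the dot product of [vbit i] with the sum. *)
Lemma sqfree_part_radprod_sum g (S : {set 'I_n}) (f : 'I_n -> V) : tuple_adm g ->
  sqfree_part (\prod_(t in S) radprod g (f t)) = radprod g (\sum_(t in S) f t).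
Proof.
move=> ag; have g0 i : (0 < g i)%N by case: ag => sg _; exact: squarefree_gt0.
have P0 : (0 < \prod_(t in S) radprod g (f t))%N.
  by rewrite prodn_cond_gt0 // => t _; exact: radprod_gt0.
apply: eqn_from_log; [exact: sqfree_part_gt0 | exact: radprod_gt0 |] => p.
case: (boolP (prime p)) => pp; last first.
  have nl m : logn p m = 0%N by rewrite lognE (negPf pp).
  by rewrite !nl.
rewrite logn_sqfree_part // logn_prime_prod; last by move=> t _; exact: radprod_gt0.
have [[i [_ _ H]]|[_ H]] := logn_radprod 0 ag pp.
  rewrite H dot_sum F2_sum_odd; congr (nat_of_bool (odd _)).
  by apply: eq_bigr => t _; rewrite H.
by rewrite H big1.
Qed.

Lemma sqfree_part_radprod g (S : {set 'I_n}) : tuple_adm g ->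
  sqfree_part (\prod_(t in S) radprod g (delta_mx 0%R t)) = radprod g (set_vec S).
Proof. by move=> ag; rewrite sqfree_part_radprod_sum // set_vec_sum. Qed.

Lemma set_vec_neq0 S : (set_vec S != 0) = (S != finset.set0).
Proof.
apply/idP/idP; apply: contra => /eqP E.
  by apply/eqP/rowP => t; rewrite !mxE E inE.
apply/eqP/setP => t; move/rowP/(_ t): E; rewrite !mxE inE.
by case: (t \in S).
Qed.

Lemma set_vec_onto w : set_vec [set t | w 0 t == 1] = w.
Proof. by apply/rowP => t; rewrite !mxE inE; case: (F2_cases (w 0 t)) => ->. Qed.

(** Each prime dividing some [a t] has a pattern of divisibility, a nonzero vector over [F_2];
    component [i] collects the primes of pattern [vbit i]. *)
Definition tuple_of_gens (a : 'I_n -> nat) (i : 'I_l) : nat :=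
  \prod_(p <- primes (\prod_t a t) | [forall t, (p %| a t)%N == (vbit i 0 t == 1)]) p.

Lemma tuple_of_gensP (a : 'I_n -> nat) : (forall t, squarefree (a t)) ->
  tuple_adm (tuple_of_gens a) /\ forall t, radprod (tuple_of_gens a) (delta_mx 0 t) = a t.
Proof.
move=> sa; have a0 t := squarefree_gt0 (sa t).
have A0 : (0 < \prod_t a t)%N by rewrite prodn_gt0.
have g0 i : (0 < tuple_of_gens a i)%N.
  rewrite /tuple_of_gens big_seq_cond prodn_cond_gt0 // => p /andP[].
  by rewrite mem_primes => /andP[pp _] _; exact: prime_gt0.
have lg p i : prime p -> logn p (tuple_of_gens a i) =
    (p %| \prod_t a t)%N && [forall t, (p %| a t)%N == (vbit i 0 t == 1)].
  move=> pp; rewrite /tuple_of_gens big_seq_cond logn_prime_prod; last first.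
    by move=> q /andP[]; rewrite mem_primes => /andP[qq _] _; exact: prime_gt0.
  rewrite (eq_bigr (fun q => (p == q) : nat)); last first.
    by move=> q /andP[]; rewrite mem_primes => /andP[qq _] _; rewrite logn_prime.
  rewrite -big_seq_cond; have [/andP[pA pm]|pm] := boolP (_ && _).
    have pin : p \in primes (\prod_t a t) by rewrite mem_primes pp A0.
    rewrite big_mkcond (bigD1_seq p) ?primes_uniq //= pm eqxx big1 // => q qp.
    by rewrite eq_sym (negPf qp) if_same.
  rewrite big_seq_cond big1 // => q /andP[qA qm]; case: eqP => // E.
  move: qA; rewrite mem_primes => /and3P[_ _ qA].
  by rewrite E qA qm in pm.
have adm : tuple_adm (tuple_of_gens a).
  split=> [i|i j ij].
    by apply: squarefreeP => // p pp; rewrite lg // leq_b1.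
  rewrite /coprime eqn_leq gcdn_gt0 g0 andbT leqNgt; apply/negP => c1.
  have pp := pdiv_prime c1; set p := pdiv _ in pp.
  have : (p %| gcdn (tuple_of_gens a i) (tuple_of_gens a j))%N := pdiv_dvd _.
  rewrite dvdn_gcd -{1 2}(expn1 p) !pfactor_dvdn // !lg // !lt0b.
  move=> /andP[/andP[_ /forallP Hi] /andP[_ /forallP Hj]]; move/eqP: ij; apply.
  apply: vbit_inj; apply/rowP => t; have := Hi t; have /eqP -> := Hj t.
  by case: (F2_cases (vbit i 0 t)) => ->; case: (F2_cases (vbit j 0 t)) => ->.
split => // t; apply: eqn_from_log; [exact: radprod_gt0 | by [] |] => p.
case: (boolP (prime p)) => pp; last first.
  have nl m : logn p m = 0%N by rewrite lognE (negPf pp).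
  by rewrite !nl.
have [[i [pi H _]]|[np H]] := logn_radprod (delta_mx 0 t) adm pp.
  rewrite H dot_delta.
  have : logn p (tuple_of_gens a i) = 1%N by case: adm => sg _; apply: logn_squarefree.
  rewrite lg //; case: (boolP (_ && _)) => // /andP[_ /forallP/(_ t)/eqP <-] _.
  case: (boolP (p %| a t)%N) => pa; first by rewrite logn_squarefree.
  by rewrite logn_coprime // prime_coprime.
rewrite H; apply/esym/logn_coprime; rewrite prime_coprime //; apply/negP => pa.
pose w : V := \row_t (p %| a t)%N%:R.
have [i Ei] : exists i, vbit i = w.
  apply: vbit_onto; apply/eqP => /rowP/(_ t); rewrite !mxE pa => /eqP.
  by rewrite oner_eq0.
have := np i; rewrite -(expn1 p) pfactor_dvdn // lg //.
have -> : (p %| \prod_t a t)%N by rewrite (bigD1 t) //= dvdn_mulr.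
rewrite (_ : [forall t, _]) //; apply/forallP => t'; rewrite Ei mxE.
by case: (p %| a t')%N.
Qed.

Lemma logn_radical p A : prime p -> (0 < A)%N ->
  logn p (\prod_(q <- primes A) q) = (p %| A)%N.
Proof.
move=> pp A0; rewrite big_seq logn_prime_prod; last first.
  by move=> q; rewrite mem_primes => /andP[qq _]; exact: prime_gt0.
rewrite (eq_bigr (fun q => (p == q) : nat)); last first.
  by move=> q; rewrite mem_primes => /andP[qq _]; rewrite logn_prime.
rewrite -big_seq; have [pA|pA] := boolP (p %| _)%N.
  have pin : p \in primes A by rewrite mem_primes pp A0.
  rewrite (bigD1_seq p) ?primes_uniq //= eqxx big1 // => q.
  by rewrite eq_sym => /negPf ->.
rewrite big_seq big1 // => q; rewrite mem_primes => /and3P[_ _ qA].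
by case: eqP => // E; rewrite E qA in pA.
Qed.

(** A prime dividing [g i] divides the radicand attached to any nonzero bit of [vbit i]. This turns
    the discriminant formula into a power of the product of the tuple. *)
Lemma primes_prod_tuple g : tuple_adm g ->
  (\prod_(p <- primes (\prod_t radprod g (delta_mx 0%R t))) p = \prod_i g i)%N.
Proof.
move=> ag; have g0 i : (0 < g i)%N by case: ag => sg _; exact: squarefree_gt0.
have A0 : (0 < \prod_t radprod g (delta_mx 0%R t))%N.
  by rewrite prodn_gt0 // => t; exact: radprod_gt0.
apply: eqn_from_log.
- rewrite big_seq prodn_cond_gt0 // => p; rewrite mem_primes => /andP[pp _].
  exact: prime_gt0.
- by rewrite prodn_gt0.
move=> p; case: (boolP (prime p)) => pp; last first.
  have nl m : logn p m = 0%N by rewrite lognE (negPf pp).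
  by rewrite !nl.
rewrite logn_radical // Euclid_dvd_prod // logn_prime_prod //.
have [[i [pi _ H]]|[np H]] := logn_radprod 0 ag pp; last first.
  rewrite [RHS]big1; last by move=> i _; rewrite logn_coprime // prime_coprime.
  apply/eqP; rewrite eqb0 big_has -all_predC; apply/allP => t _ /=.
  by rewrite -(expn1 p) pfactor_dvdn ?H // radprod_gt0.
have -> : \big[orb/false]_(t < n) (p %| radprod g (delta_mx 0%R t))%N = true.
  have [t Et] : exists t, vbit i 0 t = 1.
    apply: contrapT => no; have := vbit_neq0 i; case/eqP; apply/rowP => t.
    by rewrite [RHS]mxE; case: (F2_cases (vbit i 0 t)) => // E; case: no; exists t.
  rewrite big_has; apply/hasP; exists t; first by rewrite mem_index_enum.
  by rewrite /= -(expn1 p) pfactor_dvdn ?H ?dot_delta ?Et // radprod_gt0.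
rewrite (bigD1 i) //= logn_squarefree //; last by case: ag.
rewrite big1 ?addn0 // => j ji; rewrite logn_coprime // prime_coprime //.
apply/negP => pj; case: ag => _ /(_ _ _ ji) /eqP E.
have : (p %| 1)%N by rewrite -E dvdn_gcd pj pi.
by rewrite dvdn1 => /eqP Ep; rewrite Ep in pp.
Qed.

End Tuples.

Section TotallyReal.
Variables (L : splittingFieldType rat) (n : nat).
Local Notation G := 'Gal({:L} / 1)%g.

Lemma tot_of_gens (a : 'I_n -> nat) (x : 'I_n -> L) : galois 1 {:L} -> sqrt_gens a x ->
  (forall i, (1 < a i)%N) -> (forall i, squarefree (a i)) ->
  {:L}%VS = <<1 & [tuple x i | i < n]>>%VS -> totally_real_multiquadratic n L.
Proof.
move=> galL gx a1 sa full; split => //; last first.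
  exists a, [tuple x i | i < n]; split => // i.
  by rewrite -tnth_nth tnth_mktuple; exact: gens_sqr gx i.
pose f (s : gal_of {:L}) : 'rV['F_2]_n := \row_i (s (x i) != x i)%:R.
have xN i : (x i == - x i) = false.
  apply/negbTE; rewrite -subr_eq0 opprK -mulr2n -mulr_natr mulf_neq0 ?natL_neq0 //.
  exact: gens_neq0 gx i.
have fM : {in G &, {morph f : s t / (s * t)%g}}.
  move=> s t _ _; apply/rowP => i; rewrite !mxE galM ?memvf //.
  have [->|->] := gens_gal gx s i; rewrite ?rmorphN /=.
    by have [->|->] := gens_gal gx t i; rewrite ?eqxx ?[- _ == _]eq_sym ?xN ?addr0 ?add0r.
  have [->|->] := gens_gal gx t i; rewrite ?opprK ?eqxx ?[- _ == _]eq_sym ?xN ?addr0 //.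
  by apply/esym; apply/val_inj.
pose fm : {morphism G >-> 'rV['F_2]_n} := Morphism fM.
have inj : ('injm fm)%g.
  apply/injmP => s t sG tG /rowP E; apply/eqP; rewrite eq_mulgV1; apply/eqP.
  case: (gx) => _ _ h _; apply: h => [|i]; first by rewrite groupM ?groupV.
  have st : s (x i) = t (x i).
    have := E i; rewrite !mxE.
    have [->|->] := gens_gal gx s i; have [->|->] := gens_gal gx t i => //;
    by rewrite eqxx eq_sym xN /= => /eqP.
  by rewrite galM ?memvf // st -galM ?memvf // mulgV gal_id.
apply/isogP; exists fm => //; apply/eqP; rewrite eqEcard finset.subsetT /=.
rewrite card_injm // cardsT card_mx mul1n card_Fp //.
by case: gx => _ _ _ ->.
Qed.

End TotallyReal.

Section FieldsAsTuples.
Variables (R : realType) (n : nat).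
Local Notation V := 'rV['F_2]_n.
Local Notation l := (ell n).
Local Notation e_ t := (delta_mx (0%R : 'I_1) t : V).
Implicit Types (g : 'I_l -> nat) (w : V).

(** The image of the field in [R], described by the [a t] alone, so that equality of embedded fields
    becomes a statement about tuples. *)
Definition sqrt_field (a : 'I_n -> nat) : set R :=
  [set u | exists c : {set 'I_n} -> rat,
     u = \sum_(S in {set 'I_n}) ratr (c S) * \prod_(t in S) Num.sqrt (a t)%:R]%classic.

Lemma range_gens (L : splittingFieldType rat) (iota : {rmorphism L -> R})
  (a : 'I_n -> nat) (x : 'I_n -> L) : galois 1 {:L} -> sqrt_gens a x ->
  range iota = sqrt_field a.
Proof.
move=> galL gx.
have /choice[e Ee] (t : 'I_n) : exists e : bool, iota (x t) = (-1) ^+ e * Num.sqrt (a t)%:R.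
  have : iota (x t) ^+ 2 = Num.sqrt (a t)%:R ^+ 2.
    by rewrite sqr_sqrtr ?ler0n // -rmorphXn /= (gens_sqr gx) rmorph_nat.
  move=> /eqP; rewrite eqf_sqr => /orP[] /eqP ->; first by exists false; rewrite mul1r.
  by exists true; rewrite expr1 mulN1r.
pose sg (S : {set 'I_n}) : rat := \prod_(t in S) (-1) ^+ e t.
have ES S : iota (setprod x S) = ratr (sg S) * \prod_(t in S) Num.sqrt (a t)%:R.
  rewrite /setprod /sg !rmorph_prod -big_split; apply: eq_bigr => t _ /=.
  by rewrite Ee rmorphXn rmorphN rmorph1.
have sg2 S : sg S * sg S = 1.
  by rewrite /sg -big_split big1 // => t _ /=; rewrite -exprD addnn -mul2n exprM sqrrN !expr1n.
have io (c : rat) y : iota (c *: y) = ratr c * iota y.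
  rewrite -mulr_algl rmorphM; congr (_ * _).
  by rewrite -[LHS]/((iota \o in_alg L) c) fmorph_eq_rat.
apply/seteqP; split => [_ [y _ <-]|u [c ->]].
  exists (fun S => (field_trace (y * setprod x S) / (2 ^ n * \prod_(i in S) a i)%:R) * sg S).
  rewrite {1}(setprod_coord galL gx y) rmorph_sum; apply: eq_bigr => S _.
  by rewrite io ES [in RHS](rmorphM (ratr : {rmorphism rat -> R})) -[in RHS]mulrA.
exists (\sum_(S in {set 'I_n}) (c S * sg S) *: setprod x S) => //.
rewrite rmorph_sum; apply: eq_bigr => S _.
by rewrite io ES mulrA -rmorphM -mulrA sg2 mulr1.
Qed.

Definition tuple_gens g (t : 'I_n) : nat := radprod g (e_ t).

Definition tuple_shape (Rs : nat -> R) g := exists s : seq nat,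
  [/\ sorted ltn s, size s = l,
      forall D, D \in s <-> exists i : 'I_l, D = radprod g (vbit i) &
      shape_in n Rs (lambda R s)].

Definition tuple_valid (Rs : nat -> R) (X : R) g :=
  [/\ tuple_adm g, forall t, (tuple_gens g t %% 4 = 1)%N,
      ((\prod_i g i) ^ (2 ^ n.-1))%N%:R <= X & tuple_shape Rs g].

Hypothesis hn : (2 <= n)%N.

(** The shape condition lists [ell n] distinct values, one for each nonzero [w]; it remains to tell
    them from the value 1 at 0. If [radprod g w = 1], the [g i] with [dot (vbit i) w = 1] are all 1,
    and [w + w'] has the same radicand as [w']. A [w'] other than 0 and [w] exists because
    [2 <= n]. *)
Lemma radprod_distinct (Rs : nat -> R) g : (forall i, (0 < g i)%N) -> tuple_shape Rs g ->
  injective (radprod g).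
Proof.
move=> g0 [s [so ss Ds _]].
have inj : injective (fun i : 'I_l => radprod g (vbit i)).
  have us : uniq s by apply: (sorted_uniq ltn_trans ltnn).
  apply/injectiveP; rewrite /injectiveb /dinjectiveb.
  rewrite (@leq_size_uniq _ s) //; last by rewrite size_map -cardE card_ord ss.
  by move=> D /Ds[i ->]; apply: map_f; rewrite mem_enum.
have injV w w' : w != 0 -> w' != 0 -> radprod g w = radprod g w' -> w = w'.
  move=> /vbit_onto[i <-] /vbit_onto[j <-] E; by rewrite (inj i j).
have ne1 w : w != 0 -> radprod g w != 1%N.
  move=> w0; apply/negP => /eqP E.
  have [w' w'0 ww'] : exists2 w', w' != 0 & w' != w.
    have : (1 < #|[set~ (0%R : V)]|)%N.
      rewrite cardsC1 card_mx card_Fp // mul1n.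
      have : (2 ^ 2 <= 2 ^ n)%N by rewrite leq_exp2l.
      by case: (2 ^ n)%N => [|[|[|]]].
    rewrite (cardD1 w) !inE w0 /= ltnS => /card_gt0P[w'].
    by rewrite !inE => /andP[H1 H2]; exists w'.
  have gi i : dot (vbit i) w = 1 -> g i = 1%N.
    move=> di; apply/eqP; rewrite -dvdn1 -E /radprod (bigD1 i) ?di ?eqxx //=.
    exact: dvdn_mulr.
  have E' : radprod g (w + w') = radprod g w'.
    rewrite /radprod big_mkcond [RHS]big_mkcond; apply: eq_bigr => i _.
    rewrite dotDr; case: (F2_cases (dot (vbit i) w)) => di; rewrite di ?add0r //.
    by rewrite gi // !if_same.
  have ww0 : w + w' != 0.
    apply: contraNneq ww' => E0; rewrite eq_sym -subr_eq0.
    have -> : - w' = w' by apply/eqP; rewrite -subr_eq0 -opprD rV2_addrr oppr0.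
    exact/eqP.
  have := injV _ _ ww0 w'0 E'; move/eqP; rewrite -subr_eq0 addrK => /eqP w00.
  by rewrite w00 eqxx in w0.
move=> w w'; case: (eqVneq w 0) => [->|w0]; case: (eqVneq w' 0) => [->|w'0] //.
- by rewrite radprod0 => /esym/eqP; rewrite (negPf (ne1 _ w'0)).
- by rewrite radprod0 => /eqP; rewrite (negPf (ne1 _ w0)).
- exact: injV.
Qed.

Lemma tuple_adm_gt0 g : tuple_adm g -> forall i, (0 < g i)%N.
Proof. by move=> [sg _] i; exact: squarefree_gt0. Qed.

Lemma radicands_tuple (L : splittingFieldType rat) g (x : 'I_n -> L) D :
  galois 1 {:L} -> tuple_adm g -> sqrt_gens (tuple_gens g) x ->
  radicands L D <-> exists i : 'I_l, D = radprod g (vbit i).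
Proof.
move=> galL ag gx; rewrite (radicands_gens galL gx); split=> [[S S0 ->]|[i ->]].
  have [|i Ei] := @vbit_onto n (set_vec S); first by rewrite set_vec_neq0.
  by exists i; rewrite Ei -sqfree_part_radprod.
exists [set t | vbit i 0 t == 1]; first by rewrite -set_vec_neq0 set_vec_onto vbit_neq0.
by rewrite -{1}(set_vec_onto (vbit i)) -sqfree_part_radprod.
Qed.

Lemma family_to_tuple (Rs : nat -> R) X K : field_family n Rs X K ->
  exists2 g, tuple_valid Rs X g & K = sqrt_field (tuple_gens g).
Proof.
move=> [L [iota [-> [tot disc unr [s [so ss Ds sh]]]]]].
have [galL [a [x [gx a1 sa full]]]] := tot_gens tot.
have [ag Ea] := tuple_of_gensP sa.
have {}Ea : tuple_gens (tuple_of_gens a) = a by apply/funext.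
exists (tuple_of_gens a); last by rewrite Ea; exact: range_gens galL gx.
have a4 : forall i, (a i %% 4 = 1)%N by apply/(unramified2_gens galL gx sa).
split => //; first by move=> t; rewrite Ea.
- move: disc; rewrite (field_disc_formula galL gx sa a4) ratr_nat.
  rewrite -(primes_prod_tuple ag); congr ((_ ^ _)%N%:R <= _).
  by rewrite -[X in (\prod_t X t)%N]Ea.
- exists s; split => // D; rewrite Ds; apply: (@radicands_tuple L _ x) => //.
  by rewrite Ea.
Qed.

Lemma tuple_gens_squarefree g : tuple_adm g -> forall t, squarefree (tuple_gens g t).
Proof. by move=> ag t; exact: radprod_squarefree. Qed.

Lemma tuple_field_exists (Rs : nat -> R) g : tuple_adm g -> tuple_shape Rs g ->
  exists (L : splittingFieldType rat) (iota : {rmorphism L -> R}) (x : 'I_n -> L),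
  [/\ galois 1 {:L}, sqrt_gens (tuple_gens g) x,
      {:L}%VS = <<1 & [tuple x i | i < n]>>%VS & totally_real_multiquadratic n L].
Proof.
move=> ag sh; have g0 := tuple_adm_gt0 ag.
have inj := radprod_distinct g0 sh.
have sa := tuple_gens_squarefree ag.
have [||L [iota [x [galL gx full]]]] := @multiquadratic_exists R n (tuple_gens g).
- by move=> t; exact: squarefree_gt0.
- move=> S S0; rewrite sqfree_part_radprod // -(radprod0 g).
  by apply: contra S0 => /eqP/inj/eqP; rewrite -[_ == 0]negbK set_vec_neq0 negbK.
exists L, iota, x; split => //; apply: (tot_of_gens galL gx) => // t.
rewrite ltn_neqAle squarefree_gt0 // andbT eq_sym -(radprod0 g).
apply/negP => /eqP/inj/rowP/(_ t); rewrite !mxE !eqxx => /eqP.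
by rewrite oner_eq0.
Qed.

Lemma tuple_to_family (Rs : nat -> R) X g : tuple_valid Rs X g ->
  field_family n Rs X (sqrt_field (tuple_gens g)).
Proof.
move=> [ag a4 pX sh]; have sa := tuple_gens_squarefree ag.
have [L [iota [x [galL gx full tot]]]] := tuple_field_exists ag sh.
exists L, iota; split; first by rewrite (range_gens iota galL gx).
split => //.
- by rewrite (field_disc_formula galL gx sa a4) ratr_nat (primes_prod_tuple ag).
- by apply/(unramified2_gens galL gx sa).
- case: sh => s [so ss Ds sh]; exists s; split => // D; rewrite Ds.
  by apply: iff_sym; apply: (radicands_tuple _ galL ag gx).
Qed.

End FieldsAsTuples.

(** * The action of GL_n(F_2) on tuples and the number of fields *)

Lemma card_fibers (T : finType) (U : choiceType) (A : {set T}) (f : T -> U) (c : nat) :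
  (forall x, x \in A -> #|[set y in A | f y == f x]| = c) ->
  #|A| = (#|` [fset f x | x in A]%fset| * c)%N.
Proof.
move=> fib; set S := [fset f x | x in A]%fset.
have Sin x : x \in A -> f x \in S by move=> xA; apply/imfsetP; exists x.
rewrite -sum1_card (eq_bigr (fun x => \sum_(K <- S) (f x == K)%N)%N); last first.
  move=> x xA; rewrite (bigD1_seq (f x)) ?fset_uniq ?Sin //= eqxx big1 // => K Kx.
  by rewrite eq_sym (negPf Kx).
rewrite exchange_big /= big_seq (eq_bigr (fun=> c)); last first.
  move=> K /imfsetP[x /= xA ->]; rewrite -(fib x xA) -sum1_card big_mkcond [RHS]big_mkcond.
  by apply: eq_bigr => y _ /=; rewrite inE; case: (y \in A); case: eqP.
by rewrite -big_seq big_const_seq count_predT iter_addn_0 mulnC.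
Qed.

Section Action.
Variables (n : nat) (T : Type).
Local Notation l := (ell n).

(** The default [g i] is never taken for invertible [A], which permutes the nonzero vectors and
    hence the components. *)
Definition mx_act (A : 'M['F_2]_n) (g : 'I_l -> T) (i : 'I_l) : T :=
  if [pick j | vbit j == vbit i *m A] is Some j then g j else g i.

Lemma mx_act_perm (A : 'M['F_2]_n) : A \in unitmx -> exists2 p : 'I_l -> 'I_l,
  injective p & forall i, vbit (p i) = vbit i *m A /\ forall g, mx_act A g i = g (p i).
Proof.
move=> uA.
have /choice[p Ep] (i : 'I_l) : exists j, vbit j = vbit i *m A.
  apply: vbit_onto; apply: contraNneq (vbit_neq0 i) => E.
  by rewrite -(mulmxK uA (vbit i)) E mul0mx.
exists p => [i j E|i].
  apply: vbit_inj; apply: (can_inj (mulmxK uA)).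
  by rewrite -!Ep E.
split => // g; rewrite /mx_act; case: pickP => [j /eqP|/(_ (p i))]; last by rewrite Ep eqxx.
by rewrite -Ep => /vbit_inj ->.
Qed.

End Action.

Lemma radprod_act n (A : 'M['F_2]_n) (g : 'I_(ell n) -> nat) w : A \in unitmx ->
  radprod (mx_act A g) w = radprod g (w *m (invmx A)^T).
Proof.
move=> uA; have [p pinj pP] := mx_act_perm nat uA.
rewrite /radprod [RHS](reindex p) /=; last exact/onW_bij/injF_bij.
apply: eq_big => [i|i _]; last by have [_ ->] := pP i.
have [-> _] := pP i; rewrite /dot trmx_mul trmxK -!mulmxA.
by rewrite [A *m (_ *m _)]mulmxA mulmxV // mul1mx.
Qed.

Lemma prod_act n (A : 'M['F_2]_n) (g : 'I_(ell n) -> nat) : A \in unitmx ->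
  (\prod_i mx_act A g i = \prod_i g i)%N.
Proof.
move=> uA; have [p pinj pP] := mx_act_perm nat uA.
rewrite [RHS](reindex p) /=; last exact/onW_bij/injF_bij.
by apply: eq_bigr => i _; have [_ ->] := pP i.
Qed.

Lemma tuple_adm_act n (A : 'M['F_2]_n) (g : 'I_(ell n) -> nat) : A \in unitmx ->
  tuple_adm g -> tuple_adm (mx_act A g).
Proof.
move=> uA [sg cg]; have [p pinj pP] := mx_act_perm nat uA.
split=> [i|i j ij]; first by have [_ ->] := pP i.
have [_ ->] := pP i; have [_ ->] := pP j; apply: cg.
by apply: contra ij => /eqP/pinj ->.
Qed.

Lemma card_GL n : (0 < n)%N -> #|'GL_n(2)%g| = #|[set A : 'M['F_2]_n | A \in unitmx]|.
Proof.
case: n => // m _; rewrite cardsT -(card_imset _ val_inj); apply: eq_card => A.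
rewrite inE; apply/imsetP/idP => [[u _ ->]|uA]; first exact: (valP u).
by exists (FinRing.unit 'M['F_2]_m.+1 uA).
Qed.

Section FieldCount.
Variables (R : realType) (n : nat).
Local Notation V := 'rV['F_2]_n.
Local Notation l := (ell n).
Local Notation e_ t := (delta_mx (0%R : 'I_1) t : V).
Implicit Types (g : 'I_l -> nat) (w : V).
Hypothesis hn : (2 <= n)%N.
Variables (Rs : nat -> R) (X : R).

Lemma tuple_shape_act g g' : (forall D, (exists i : 'I_l, D = radprod g (vbit i)) <->
    (exists i : 'I_l, D = radprod g' (vbit i))) ->
  tuple_shape Rs g -> tuple_shape Rs g'.
Proof.
by move=> E [s [so ss Ds sh]]; exists s; split => // D; rewrite Ds.
Qed.

(** A product of generators is 1 modulo 4, and is its squarefree part times an odd square, which is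
    1 modulo 4 as well. *)
Lemma radprod_mod4 g w : tuple_adm g -> (forall t, tuple_gens g t %% 4 = 1)%N ->
  (radprod g w %% 4 = 1)%N.
Proof.
move=> ag a4; rewrite -(set_vec_onto w) -sqfree_part_radprod //.
set S := [set t | _]; set A := (\prod_(t in S) _)%N.
have A4 : (A %% 4 = 1)%N.
  rewrite /A; elim/big_rec: _ => // t k _ k4; by rewrite -modnMm a4 k4.
have A0 : (0 < A)%N by case: A A4.
have [k k0 Ek] := sqfree_partE A0.
have k2 : (k ^ 2 %% 4 = 1)%N.
  have ok : odd k.
    have : odd A by rewrite (divn_eq A 4) A4 addn1 /= oddM andbF.
    by rewrite Ek oddM oddX /= => /andP[].
  rewrite -(odd_double_half k) ok -mul2n; set j := (k./2)%N.
  rewrite (_ : (true + 2 * j) ^ 2 = (j * j + j) * 4 + 1)%N; last by rewrite /=; ring.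
  by rewrite modnMDl.
by move: A4; rewrite {1}Ek -modnMmr k2 muln1.
Qed.

Lemma tuple_valid_act A g : A \in unitmx -> tuple_valid Rs X g -> tuple_valid Rs X (mx_act A g).
Proof.
move=> uA [ag a4 pX sh]; split.
- exact: tuple_adm_act.
- by move=> t; rewrite /tuple_gens radprod_act //; exact: radprod_mod4.
- by rewrite prod_act.
have uB : (invmx A)^T \in unitmx by rewrite unitmx_tr unitmx_inv.
apply: tuple_shape_act sh => D; split=> [[i ->]|[i ->]].
  have [|j Ej] := @vbit_onto n (vbit i *m invmx (invmx A)^T).
    apply: contraNneq (vbit_neq0 i) => E.
    by rewrite -(mulmxKV uB (vbit i)) E mul0mx.
  by exists j; rewrite radprod_act // Ej mulmxKV.
rewrite radprod_act //.
have [|j Ej] := @vbit_onto n (vbit i *m (invmx A)^T).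
  apply: contraNneq (vbit_neq0 i) => E.
  by rewrite -(mulmxK uB (vbit i)) E mul0mx.
by exists j; rewrite Ej.
Qed.

Lemma sqrt_field_sub g g' : tuple_adm g -> tuple_shape Rs g ->
  (forall t, exists w, tuple_gens g' t = radprod g w) ->
  (sqrt_field (R := R) (tuple_gens g') `<=` sqrt_field (tuple_gens g))%classic.
Proof.
move=> ag sh H.
have [L [iota [x [galL gx full tot]]]] := tuple_field_exists hn ag sh.
rewrite -(range_gens iota galL gx) => _ [c ->].
have /choice[y Ey] t : exists y, iota y = Num.sqrt (tuple_gens g' t)%:R.
  have [w ->] := H t.
  have [y [_ [Ey _]]] := sqfree_part_sqrt gx [set t | w 0 t == 1].
  rewrite /tuple_gens sqfree_part_radprod // set_vec_onto in Ey.
  have : iota y ^+ 2 = Num.sqrt (radprod g w)%:R ^+ 2.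
    by rewrite sqr_sqrtr ?ler0n // -rmorphXn /= Ey rmorph_nat.
  move=> /eqP; rewrite eqf_sqr => /orP[] /eqP E; first by exists y.
  by exists (- y); rewrite rmorphN E opprK.
exists (\sum_(S in {set 'I_n}) c S *: \prod_(t in S) y t) => //.
rewrite rmorph_sum; apply: eq_bigr => S _.
rewrite -mulr_algl rmorphM rmorph_prod; congr (_ * _).
  by rewrite -[LHS]/((iota \o in_alg L) (c S)) fmorph_eq_rat.
by apply: eq_bigr => t _; rewrite -Ey.
Qed.

Lemma sqrt_field_act A g : A \in unitmx -> tuple_valid Rs X g ->
  sqrt_field (R := R) (tuple_gens (mx_act A g)) = sqrt_field (tuple_gens g).
Proof.
move=> uA vg; have [ag a4 pX sh] := vg; have [ag' _ _ sh'] := tuple_valid_act uA vg.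
have uB : (invmx A)^T \in unitmx by rewrite unitmx_tr unitmx_inv.
apply/seteqP; split; apply: sqrt_field_sub => // t.
  by exists (e_ t *m (invmx A)^T); rewrite /tuple_gens radprod_act.
exists (e_ t *m invmx (invmx A)^T).
by rewrite radprod_act // mulmxKV.
Qed.

Lemma same_field_radicands g g' : tuple_adm g -> tuple_shape Rs g ->
  tuple_adm g' -> tuple_shape Rs g' ->
  sqrt_field (R := R) (tuple_gens g') = sqrt_field (tuple_gens g) ->
  forall w, exists w', radprod g' w = radprod g w'.
Proof.
move=> ag sh ag' sh' E w.
have [L [iota [x [galL gx full tot]]]] := tuple_field_exists hn ag sh.
have [L' [iota' [x' [galL' gx' full' tot']]]] := tuple_field_exists hn ag' sh'.
have [->|w0] := eqVneq w 0; first by exists 0; rewrite !radprod0.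
have [i Ei] := vbit_onto w0.
have : radicands L' (radprod g' w).
  by apply/(radicands_tuple _ galL' ag' gx'); exists i; rewrite Ei.
rewrite radicandsP => -[D1 sD [y Ey]].
have : range iota (iota' y).
  by rewrite (range_gens iota galL gx) -E -(range_gens iota' galL' gx'); exists y.
case=> z _ Ez.
have : radicands L (radprod g' w).
  apply/radicandsP; split => //; exists z; apply: (fmorph_inj iota).
  by rewrite rmorphXn /= Ez -rmorphXn /= Ey !rmorph_nat.
by rewrite (radicands_tuple _ galL ag gx) => -[j ->]; exists (vbit j).
Qed.

(** Each generator of [g'] is the radicand of [g] at some vector [f t]. The matrix [B] with rows
    [f t] matches all the radicands, and is invertible because distinct vectors have distinct
    radicands; the components move by its inverse transpose. *)
Lemma same_field_act g g' : tuple_valid Rs X g -> tuple_valid Rs X g' ->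
  sqrt_field (R := R) (tuple_gens g') = sqrt_field (tuple_gens g) ->
  exists2 A, A \in unitmx & g' =1 mx_act A g.
Proof.
move=> [ag _ _ sh] [ag' _ _ sh'] E.
have g'0 := tuple_adm_gt0 ag'.
have inj' := radprod_distinct hn g'0 sh'.
have /choice[f Ef] (t : 'I_n) := same_field_radicands ag sh ag' sh' E (e_ t).
pose B : 'M['F_2]_n := \matrix_(t, j) f t 0 j.
have rB t : row t B = f t by apply/rowP => j; rewrite !mxE.
have WB w : radprod g' w = radprod g (w *m B).
  rewrite -(set_vec_onto w); set S := [set t | _].
  rewrite -sqfree_part_radprod // (eq_bigr (fun t => radprod g (f t))); last first.
    by move=> t _; rewrite Ef.
  rewrite sqfree_part_radprod_sum //; congr (radprod g _).
  rewrite set_vec_sum mulmx_suml; apply: eq_bigr => t _.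
  by rewrite -rowE rB.
have uB : B \in unitmx.
  rewrite -row_free_unit; apply: inj_row_free => v vB.
  by apply: inj'; rewrite WB vB !radprod0.
have uA : invmx B^T \in unitmx by rewrite unitmx_inv unitmx_tr.
exists (invmx B^T) => //; apply: radprod_inj => // w.
by rewrite radprod_act // invmxK trmxK.
Qed.

Variable B : nat.
Hypothesis XB : X < B%:R.

Lemma tuple_valid_bound g : tuple_valid Rs X g -> forall i, (g i < B)%N.
Proof.
move=> [ag _ pX _] i; have g0 := tuple_adm_gt0 ag.
rewrite -(ltr_nat R); apply: le_lt_trans XB; apply: le_trans pX; rewrite ler_nat.
have P0 : (0 < \prod_i g i)%N by rewrite prodn_gt0.
apply: (@leq_trans (\prod_i g i)); first by apply: dvdn_leq => //; rewrite (bigD1 i) //= dvdn_mulr.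
by rewrite -{1}(expn1 (\prod_i g i)) leq_pexp2l // expn_gt0.
Qed.

Definition tuples_set : {set {ffun 'I_l -> 'I_B}} :=
  [set f : {ffun 'I_l -> 'I_B} | `[< tuple_valid Rs X (fun i => f i) >]].

(** The fibres of the map from tuples to fields are the orbits of the action, and the action is free
    because a radicand determines its vector. *)
Lemma field_count_tuples : #|tuples_set| = (field_count n Rs X * #|'GL_n(2)%g|)%N.
Proof.
pose k (f : {ffun 'I_l -> 'I_B}) : set R := sqrt_field (tuple_gens (fun i => f i)).
have -> : field_count n Rs X = #|` [fset k f | f in tuples_set]%fset|.
  rewrite /field_count; congr (#|` _|).
  have -> : field_family n Rs X = [set` [fset k f | f in tuples_set]%fset]%classic.
    apply/seteqP; split => K.
      move=> /family_to_tuple[g vg ->] /=; apply/imfsetP.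
      exists [ffun i => Ordinal (tuple_valid_bound vg i)]; last first.
        by rewrite /k; congr (sqrt_field (tuple_gens _)); apply/funext => i; rewrite ffunE.
      rewrite inE; apply/asboolP; rewrite [X in tuple_valid _ _ X](_ : _ = g) //.
      by apply/funext => i; rewrite ffunE.
    move=> /imfsetP[f /=]; rewrite inE => /asboolP vf ->.
    exact: tuple_to_family.
  exact: set_fsetK.
apply: card_fibers => f; rewrite inE => /asboolP vf.
rewrite card_GL; last exact: ltnW.
pose Phi (A : 'M['F_2]_n) : {ffun 'I_l -> 'I_B} := [ffun i => mx_act A f i].
have PhiE A : A \in unitmx -> (fun i => Phi A i : nat) =1 mx_act A (fun i => f i : nat).
  move=> uA i; rewrite ffunE.
  have [p _ pP] := mx_act_perm 'I_B uA; have [p' _ pP'] := mx_act_perm nat uA.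
  have [E1 ->] := pP i; have [E2 ->] := pP' i.
  by congr (nat_of_ord (f _)); apply: vbit_inj; rewrite E1 E2.
have [af _ _ shf] := vf; have f0 := tuple_adm_gt0 af.
have inj : {in [set A : 'M['F_2]_n | A \in unitmx] &, injective Phi}.
  move=> A A'; rewrite !inE => uA uA' E.
  have W w : w *m (invmx A)^T = w *m (invmx A')^T.
    apply: (radprod_distinct hn f0 shf); rewrite -!radprod_act //.
    by congr (radprod _ w); apply/funext => i; rewrite -!PhiE // E.
  apply: (can_inj (@invmxK _ n)); apply: trmx_inj; apply/row_matrixP => i.
  by rewrite !rowE.
rewrite -(card_in_imset inj); apply: eq_card => h.
rewrite inE; apply/andP/imsetP => [[]|[A]].
  rewrite inE => /asboolP vh /eqP kh.
  have [A uA EA] := same_field_act vf vh kh.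
  exists A; first by rewrite inE.
  by apply/ffunP => i; apply/val_inj; exact: etrans (EA i) (esym (PhiE A uA i)).
rewrite inE => uA ->.
have E : (fun i => Phi A i : nat) = mx_act A (fun i => f i : nat) by apply/funext => i; exact: PhiE.
split; first by rewrite inE; apply/asboolP; rewrite E; exact: tuple_valid_act.
by apply/eqP; rewrite /k E; exact: sqrt_field_act.
Qed.

End FieldCount.

(** * Densities in boxes *)

Section Counting.
Variable l : nat.

Lemma card_ffun_forall (B : nat) (p : 'I_l -> pred nat) :
  #|[set f : {ffun 'I_l -> 'I_B} | [forall i, p i (f i)]]| =
  (\prod_i #|[set m : 'I_B | p i m]|)%N.
Proof.
have -> : (\prod_i #|[set m : 'I_B | p i m]| = \prod_i \sum_(m < B) p i m)%N.
  by apply: eq_bigr => i _; rewrite -sum1dep_card big_mkcond.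
rewrite bigA_distr_bigA -sum1dep_card big_mkcond; apply: eq_bigr => f _ /=.
case: ifP => [/forallP H|/negbT/forallPn[i Hi]]; first by rewrite big1 // => i _; rewrite H.
by rewrite (bigD1 i) //= (negPf Hi).
Qed.

Lemma count_residue (Q r N : nat) : (r < Q)%N ->
  (\sum_(m < N) (m %% Q == r) = N %/ Q + (r < N %% Q))%N.
Proof.
move=> rQ; have Q0 : (0 < Q)%N by apply: leq_ltn_trans rQ.
elim: N => [|N IH]; first by rewrite big_ord0 div0n mod0n.
rewrite big_ord_recr /= IH divnS // modnS.
have [/dvdnP[k Ek]|nd] := boolP (Q %| N.+1)%N; last first.
  have := ltn_pmod N Q0; lia.
have : (N %% Q = Q.-1)%N.
  case: k Ek => // k Ek.
  have -> : N = (k * Q + Q.-1)%N by lia.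
  by rewrite modnMDl modn_small // prednK.
lia.
Qed.

End Counting.

Section Residues.
Variable R : realType.

Lemma nat_threshold (a : R) : exists k : nat, forall m : nat, (a <= m%:R) = (k <= m)%N.
Proof.
have H : exists m : nat, a <= m%:R.
  exists (Num.bound `|a|); apply: le_trans (ler_norm a) _; apply: ltW.
  exact: archi_boundP.
case: (ex_minnP H) => k ak mink; exists k => m; apply/idP/idP => [/mink //|km].
by apply: le_trans ak _; rewrite ler_nat.
Qed.

Definition residue_count (B Q r : nat) (a b : R) : nat :=
  #|[set m : 'I_B | (a <= m%:R < b) && (m %% Q == r)%N]|.

(** Each endpoint costs at most 1 for rounding it up to an integer and at most 1 for counting the
    residue below that integer. *)
Lemma residue_count_bound B Q r a b : (r < Q)%N -> 0 <= a -> a <= b -> b <= B%:R ->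
  `|(residue_count B Q r a b)%:R - (b - a) / Q%:R| <= 4.
Proof.
move=> rQ a0 ab bB; have Q0 : (0 < Q)%N by apply: leq_ltn_trans rQ.
have [ka Ka] := nat_threshold a; have [kb Kb] := nat_threshold b.
have kab : (ka <= kb)%N by rewrite -Ka (le_trans ab) // Kb.
have kbB : (kb <= B)%N by rewrite -Kb.
have E : (residue_count B Q r a b + \sum_(m < ka) (m %% Q == r) =
    \sum_(m < kb) (m %% Q == r))%N.
  rewrite /residue_count -sum1dep_card big_mkcond /=.
  rewrite (eq_bigr (fun m : 'I_B => (ka <= m < kb) && (m %% Q == r) : nat)%N); last first.
    by move=> m _; rewrite Ka ltNge Kb -ltnNge; case: (_ && _).
  rewrite -(big_mkord xpredT (fun m => (ka <= m < kb) && (m %% Q == r) : nat)%N).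
  rewrite -!(big_mkord xpredT (fun m => (m %% Q == r) : nat)%N).
  rewrite (big_cat_nat (leq0n kb) kbB) //= (big_cat_nat (leq0n ka) kab) //=.
  have -> : (\sum_(0 <= m < ka) (ka <= m < kb) && (m %% Q == r))%N = 0%N.
    rewrite big_nat_cond big1 // => m /andP[/andP[_ mk] _].
    by rewrite leqNgt mk.
  have -> : (\sum_(kb <= m < B) (ka <= m < kb) && (m %% Q == r))%N = 0%N.
    rewrite big_nat_cond big1 // => m /andP[/andP[mk _] _].
    by rewrite ltnNge mk andbF.
  rewrite add0n addn0 [in RHS](big_cat_nat (leq0n ka) kab) //= addnC; congr (_ + _)%N.
  by rewrite !big_nat; apply: eq_bigr => m ->.
have dist (x : R) (k : nat) : 0 <= x -> (forall m : nat, (x <= m%:R) = (k <= m)%N) ->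
    x <= k%:R /\ k%:R <= x + 1.
  move=> x0 Kx; rewrite Kx leqnn; split => //.
  case: k Kx => [|k] Kx; first by rewrite ler_wpDl.
  rewrite -natr1 lerD2r leNgt; apply/negP => /ltW; by rewrite Kx ltnn.
have [a1 a2] := dist a ka a0 Ka; have [b1 b2] := dist b kb (le_trans a0 ab) Kb.
have cnt k : exists2 t : R, (\sum_(m < k) (m %% Q == r))%N%:R = k%:R / Q%:R + t & `|t| <= 1.
  rewrite count_residue //.
  exists ((r < k %% Q)%N%:R - (k %% Q)%N%:R / Q%:R).
    have Ek : k%:R = (k %/ Q)%:R * Q%:R + (k %% Q)%:R :> R by rewrite -natrM -natrD -divn_eq.
    by rewrite [in RHS]Ek natrD; field; rewrite pnatr_eq0 -lt0n.
  have q0 : 0 < Q%:R :> R by rewrite ltr0n.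
  have u0 : (0 : R) <= (k %% Q)%N%:R / Q%:R by rewrite divr_ge0.
  have u1 : (k %% Q)%N%:R / Q%:R <= (1 : R).
    by rewrite ler_pdivrMr // mul1r ler_nat ltnW // ltn_pmod.
  move: u0 u1; move: ((k %% Q)%N%:R / Q%:R) => u u0 u1; rewrite ler_norml.
  by case: (_ < _)%N; rewrite /=; lra.
have [ta Ea Ta] := cnt ka; have [tb Eb Tb] := cnt kb.
have {}E : (residue_count B Q r a b)%:R = kb%:R / Q%:R + tb - (ka%:R / Q%:R + ta).
  by rewrite -Ea -Eb -E natrD addrK.
have q0 : 0 < Q%:R :> R by rewrite ltr0n.
have q1 : 1 <= Q%:R :> R by rewrite ler1n.
have frac (x y : R) : x <= y -> y <= x + 1 -> 0 <= (y - x) / Q%:R <= 1.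
  move=> xy yx; rewrite divr_ge0 ?subr_ge0 //= ?ler0n // ler_pdivrMr // mul1r.
  by apply: le_trans q1; rewrite lerBlDl.
have /andP[fa0 fa1] := frac _ _ a1 a2; have /andP[fb0 fb1] := frac _ _ b1 b2.
have -> : (residue_count B Q r a b)%:R - (b - a) / Q%:R =
    (kb%:R - b) / Q%:R - (ka%:R - a) / Q%:R + tb - ta.
  by rewrite E; ring.
move: Ta Tb fa0 fa1 fb0 fb1; rewrite !ler_norml => /andP[t1 t2] /andP[t3 t4].
move: ((kb%:R - b) / Q%:R) ((ka%:R - a) / Q%:R) => u v u0 u1 v0 v1.
by apply/andP; split; lra.
Qed.

Definition tends (f : R -> R) (L : R) :=
  forall e, 0 < e -> exists T0, forall T, T0 <= T -> `|f T - L| <= e.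

Lemma tendsP (f : R -> R) L : tends f L <-> (f @ +oo --> L)%classic.
Proof.
split=> [H|/cvgrPdist_le H e e0].
  apply/cvgrPdist_le => e e0; have [T0 HT] := H e e0.
  exists T0; split; first exact: num_real.
  by move=> T /ltW /HT; rewrite distrC.
have [T0 [_ HT]] := H e e0; exists (T0 + 1) => T T1; rewrite distrC; apply: HT.
by apply: lt_le_trans T1; rewrite ltrDl.
Qed.

Lemma tends_ext (f g : R -> R) L T1 : (forall T, T1 <= T -> f T = g T) -> tends f L -> tends g L.
Proof.
move=> fg H e /H[T0 HT]; exists (Num.max T0 T1) => T.
by rewrite ge_max => /andP[h0 h1]; rewrite -fg // HT.
Qed.

Lemma tends_cst (c : R) : tends (fun=> c) c.
Proof. by move=> e e0; exists 0 => T _; rewrite subrr normr0 ltW. Qed.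

Lemma tendsD f g L M : tends f L -> tends g M -> tends (fun T => f T + g T) (L + M).
Proof. by move=> /tendsP H /tendsP K; apply/tendsP; exact: cvgD. Qed.

Lemma tendsM f g L M : tends f L -> tends g M -> tends (fun T => f T * g T) (L * M).
Proof. by move=> /tendsP H /tendsP K; apply/tendsP; exact: cvgM. Qed.

Lemma tends_sum (I : Type) (r : seq I) (P : pred I) (f : I -> R -> R) (L : I -> R) :
  (forall i, P i -> tends (f i) (L i)) ->
  tends (fun T => \sum_(i <- r | P i) f i T) (\sum_(i <- r | P i) L i).
Proof.
move=> H; elim: r => [|i r IH].
  by rewrite big_nil; apply: (@tends_ext _ _ _ 0 _ (tends_cst 0)) => T _; rewrite big_nil.
rewrite big_cons; case: ifP => Pi.
  apply: (@tends_ext (fun T => f i T + \sum_(j <- r | P j) f j T) _ _ 0).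
    by move=> T _; rewrite big_cons Pi.
  by apply: tendsD => //; exact: H.
by apply: (@tends_ext _ _ _ 0 _ IH) => T _; rewrite big_cons Pi.
Qed.

Lemma tends_prod (I : Type) (r : seq I) (P : pred I) (f : I -> R -> R) (L : I -> R) :
  (forall i, P i -> tends (f i) (L i)) ->
  tends (fun T => \prod_(i <- r | P i) f i T) (\prod_(i <- r | P i) L i).
Proof.
move=> H; elim: r => [|i r IH].
  by rewrite big_nil; apply: (@tends_ext _ _ _ 0 _ (tends_cst 1)) => T _; rewrite big_nil.
rewrite big_cons; case: ifP => Pi.
  apply: (@tends_ext (fun T => f i T * \prod_(j <- r | P j) f j T) _ _ 0).
    by move=> T _; rewrite big_cons Pi.
  by apply: tendsM => //; exact: H.
by apply: (@tends_ext _ _ _ 0 _ IH) => T _; rewrite big_cons Pi.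
Qed.

(** [B T] only makes the type of tuples finite; outgrowing every multiple of [T], it cuts no box
    once [T] is large. *)
Lemma tends_residue_count (B : R -> nat) (Q r : nat) (a b : R) : (r < Q)%N -> 0 <= a -> a <= b ->
  (forall K : R, exists T0, forall T, T0 <= T -> K * T <= (B T)%:R) ->
  tends (fun T => (residue_count (B T) Q r (a * T) (b * T))%:R / T) ((b - a) / Q%:R).
Proof.
move=> rQ a0 ab /(_ b)[Tb bB] e e0; exists (Num.max Tb (Num.max 1 (4 / e))) => T.
rewrite !ge_max => /and3P[/bB bT T1 Te].
have T0 : 0 < T by apply: lt_le_trans T1.
have := @residue_count_bound (B T) Q r (a * T) (b * T) rQ.
rewrite mulr_ge0 ?(ltW T0) // ler_pM2r // ab bT // => /(_ isT isT isT) H.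
have -> : (residue_count (B T) Q r (a * T) (b * T))%:R / T - (b - a) / Q%:R =
   ((residue_count (B T) Q r (a * T) (b * T))%:R - (b * T - a * T) / Q%:R) / T.
  have Q0 : (0 < Q)%N by apply: leq_ltn_trans rQ.
  by field; rewrite (gt_eqF T0) pnatr_eq0 -lt0n.
rewrite normrM normfV (gtr0_norm T0) ler_pdivrMr //; apply: le_trans H _.
by move: Te; rewrite ler_pdivrMr // mulrC.
Qed.

Variable l : nat.

Definition in_box (a b : 'I_l -> R) (T : R) (g : 'I_l -> nat) :=
  [forall i, a i * T <= (g i)%:R < b i * T].

Definition box_count (B : nat) (P : pred ('I_l -> nat)) (a b : 'I_l -> R) (T : R) : nat :=
  #|[set f : {ffun 'I_l -> 'I_B} | P (fun i => f i) && in_box a b T (fun i => f i)]|.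

Definition periodic (Q : nat) (P : pred ('I_l -> nat)) :=
  forall g g', (forall i, g i = g' i %[mod Q]) -> P g = P g'.

Definition residue_dens (Q : nat) (P : pred ('I_l -> nat)) : nat :=
  #|[set r : {ffun 'I_l -> 'I_Q} | P (fun i => r i)]|.

Lemma box_count_residues B Q P a b T : (0 < Q)%N -> periodic Q P ->
  box_count B P a b T = (\sum_(r : {ffun 'I_l -> 'I_Q} | P (fun i => r i))
    \prod_i residue_count B Q (r i) (a i * T) (b i * T))%N.
Proof.
move=> Q0 perP.
rewrite (eq_bigr (fun r : {ffun 'I_l -> 'I_Q} => \sum_(f : {ffun 'I_l -> 'I_B})
   [forall i, (a i * T <= (f i)%:R < b i * T)%R && (f i %% Q == r i)])%N); last first.
  move=> r _; rewrite -(@card_ffun_forall l B (fun i m => (a i * T <= m%:R < b i * T) && (m %% Q == r i)%N)).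
  by rewrite -sum1dep_card big_mkcond.
rewrite exchange_big /= /box_count -sum1dep_card big_mkcond; apply: eq_bigr => f _.
pose r0 : {ffun 'I_l -> 'I_Q} := [ffun i => Ordinal (ltn_pmod (f i) Q0)].
have Pr0 : P (fun i => f i) = P (fun i => r0 i).
  by apply: perP => i; rewrite ffunE /= modn_mod.
case: ifP => [/andP[Pf bf]|nPf].
  rewrite (bigD1 r0) -?Pr0 //= big1 ?addn0.
    rewrite (_ : [forall i, _]) //; apply/forallP => i.
    by rewrite (forallP bf i) ffunE /= eqxx.
  move=> r /andP[_ nr]; apply/eqP; rewrite eqb0; apply: contra nr => /forallP H.
  by apply/eqP/ffunP => i; apply/val_inj; have /andP[_ /eqP E] := H i; rewrite ffunE.
rewrite big1 // => r Pr; apply/eqP; rewrite eqb0; apply/negP => /forallP H.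
move/negP: nPf; apply; apply/andP; split.
  rewrite -(perP (fun i => r i)) // => i; have /andP[_ /eqP <-] := H i.
  by rewrite modn_mod.
by apply/forallP => i; have /andP[] := H i.
Qed.

Lemma tends_periodic (B : R -> nat) Q P (a b : 'I_l -> R) : (0 < Q)%N -> periodic Q P ->
  (forall i, 0 <= a i) -> (forall i, a i <= b i) ->
  (forall K : R, exists T0, forall T, T0 <= T -> K * T <= (B T)%:R) ->
  tends (fun T => (box_count (B T) P a b T)%:R / T ^+ l)
    ((residue_dens Q P)%:R / Q%:R ^+ l * \prod_i (b i - a i)).
Proof.
move=> Q0 perP a0 ab bB.
apply: (@tends_ext (fun T => \sum_(r : {ffun 'I_l -> 'I_Q} | P (fun i => r i))
    \prod_i ((residue_count (B T) Q (r i) (a i * T) (b i * T))%:R / T)) _ _ 0).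
  move=> T _; rewrite (box_count_residues _ _ _ _ Q0 perP) natr_sum mulr_suml.
  apply: eq_bigr => r _; rewrite natr_prod prodf_div; congr (_ / _).
  by rewrite prodr_const card_ord.
have -> : (residue_dens Q P)%:R / Q%:R ^+ l * \prod_i (b i - a i) =
    \sum_(r : {ffun 'I_l -> 'I_Q} | P (fun i => r i)) \prod_i ((b i - a i) / Q%:R).
  rewrite sumr_const prodf_div prodr_const card_ord -[RHS]mulr_natl mulrA mulrAC.
  congr (_ * _ / _); congr (_%:R); by apply: eq_card => r; rewrite !inE.
apply: tends_sum => r _; apply: tends_prod => i _.
exact: tends_residue_count.
Qed.

End Residues.

(** * Local densities *)

Section LocalDensity.
Variable R : realType.

Section CRT.
Variables (l m k : nat) (P P' : pred ('I_l -> nat)).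
Hypotheses (m0 : (0 < m)%N) (k0 : (0 < k)%N) (mk : coprime m k).
Hypotheses (perP : periodic m P) (perP' : periodic k P').

Lemma residue_dens_crt :
  residue_dens (m * k) (fun g => P g && P' g) = (residue_dens m P * residue_dens k P')%N.
Proof.
have mk0 : (0 < m * k)%N by rewrite muln_gt0 m0.
pose phi (r : {ffun 'I_l -> 'I_(m * k)}) :=
  ([ffun i => Ordinal (ltn_pmod (r i) m0)], [ffun i => Ordinal (ltn_pmod (r i) k0)]).
have inj : injective phi.
  move=> r r' [/ffunP E1 /ffunP E2]; apply/ffunP => i; apply/val_inj => /=.
  have /(congr1 val) := E1 i; have /(congr1 val) := E2 i; rewrite !ffunE /= => H2 H1.
  rewrite -(modn_small (ltn_ord (r i))) -(modn_small (ltn_ord (r' i))).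
  by apply/eqP; rewrite (chinese_remainder mk); apply/andP; split; apply/eqP.
rewrite /residue_dens -cardsX -(card_imset _ inj); apply: eq_card => -[u v].
rewrite !inE; apply/imsetP/andP => [[r]|[Pu Pv]].
  rewrite inE => /andP[Pr P'r] [-> ->]; split; [rewrite -(perP (g := fun i => r i)) // | rewrite -(perP' (g := fun i => r i)) //] => i.
    by rewrite ffunE /= modn_mod.
  by rewrite ffunE /= modn_mod.
pose r : {ffun 'I_l -> 'I_(m * k)} :=
  [ffun i => Ordinal (ltn_pmod (chinese m k (u i) (v i)) mk0)].
have r1 i : r i = u i %[mod m].
  rewrite ffunE /= modn_dvdm ?dvdn_mulr // chinese_modl //.
have r2 i : r i = v i %[mod k].
  rewrite ffunE /= modn_dvdm ?dvdn_mull // chinese_modr //.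
exists r.
  by rewrite inE (perP (g' := fun i => u i)) // (perP' (g' := fun i => v i)) // Pu.
congr (_, _); apply/ffunP => i; apply/val_inj; rewrite ffunE /=.
  by rewrite r1 modn_small.
by rewrite r2 modn_small.
Qed.

End CRT.

Lemma residue_dens_ext l Q (P P' : pred ('I_l -> nat)) : P =1 P' ->
  residue_dens Q P = residue_dens Q P'.
Proof. by move=> E; apply: eq_card => r; rewrite !inE E. Qed.

Variable n : nat.
Local Notation l := (ell n).
Implicit Types (g : 'I_l -> nat).

Definition mod4_ok : pred ('I_l -> nat) := fun g => [forall t : 'I_n, tuple_gens g t %% 4 == 1]%N.

Definition local_ok (p : nat) : pred ('I_l -> nat) := fun g =>
  [forall i, ~~ (p ^ 2 %| g i)%N] &&
  [forall i, forall j, (i != j) ==> ~~ ((p %| g i) && (p %| g j))%N].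

Definition odd_prime (p : nat) := prime p && (2 < p)%N.

Definition adm_upto (z : nat) : pred ('I_l -> nat) := fun g =>
  mod4_ok g && [forall p : 'I_z, odd_prime p ==> local_ok p g].

Lemma modn_prod (I : finType) (P : pred I) (f f' : I -> nat) Q :
  (forall i, f i = f' i %[mod Q]) ->
  (\prod_(i | P i) f i = \prod_(i | P i) f' i %[mod Q])%N.
Proof.
move=> E; elim/big_rec2: _ => // i x y _ H.
by rewrite -modnMm E H modnMm.
Qed.

Lemma periodic_mod4 : periodic 4 mod4_ok.
Proof.
move=> g g' E; apply: eq_forallb => t; congr (_ == _).
exact: modn_prod.
Qed.

Lemma periodic_local p : periodic (p ^ 2) (local_ok p).
Proof.
move=> g g' E.
have E2 i : (p ^ 2 %| g i)%N = (p ^ 2 %| g' i)%N by rewrite /dvdn E.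
have E1 i : (p %| g i)%N = (p %| g' i)%N.
  have pp : (p %| p ^ 2)%N by rewrite dvdn_exp.
  by rewrite /dvdn -(modn_dvdm (g i) pp) E modn_dvdm.
congr (_ && _); first by apply: eq_forallb => i; rewrite E2.
by apply: eq_forallb => i; apply: eq_forallb => j; rewrite !E1.
Qed.

Fixpoint modulus (z : nat) : nat :=
  if z is z'.+1 then (modulus z' * (if odd_prime z' then z' ^ 2 else 1))%N else 4%N.

Lemma modulus_gt0 z : (0 < modulus z)%N.
Proof.
elim: z => //= z IH; rewrite muln_gt0 IH /=; case: ifP => // /andP[pz _].
by rewrite expn_gt0 prime_gt0.
Qed.

Lemma coprime_modulus z p : odd_prime p -> (z <= p)%N -> coprime (modulus z) p.
Proof.
move=> op; have /andP[pp p2] := op; elim: z => [|z IH] /= zp.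
  rewrite -[4%N]/(2 ^ 2)%N coprime_pexpl // prime_coprime //.
  by rewrite dvdn_prime2 // neq_ltn p2.
rewrite coprimeMl IH ?(ltnW zp) //=; case: ifP => [/andP[pz _]|_]; last exact: coprime1n.
rewrite coprime_pexpl // prime_coprime // dvdn_prime2 //.
by rewrite neq_ltn zp.
Qed.

Lemma adm_upto_succ z g : adm_upto z.+1 g =
  adm_upto z g && (odd_prime z ==> local_ok z g).
Proof.
rewrite /adm_upto -andbA; congr (_ && _); apply/forallP/andP => [H|[/forallP H Hz] p].
  by split; [apply/forallP => p; exact: (H (widen_ord (leqnSn z) p)) | exact: (H ord_max)].
case: (ltnP p z) => [pz|zp]; first exact: (H (Ordinal pz)).
have -> : (p : nat) = z by apply/eqP; rewrite eqn_leq zp -ltnS ltn_ord.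
exact: Hz.
Qed.

Lemma eq_modn_dvd Q Q' a b : (Q %| Q')%N -> (a = b %[mod Q'] -> a = b %[mod Q])%N.
Proof. by move=> d E; rewrite -(modn_dvdm a d) E modn_dvdm. Qed.

Lemma periodic_adm z : periodic (modulus z) (adm_upto z).
Proof.
elim: z => [|z IH].
  move=> g g' E; rewrite /adm_upto (periodic_mod4 E); congr (_ && _).
  by apply/forallP/forallP => _ [].
move=> g g' E; rewrite !adm_upto_succ.
have -> : (odd_prime z ==> local_ok z g) = (odd_prime z ==> local_ok z g').
  case: (boolP (odd_prime z)) E => // oz; rewrite /= oz => E.
  by apply: periodic_local => i; apply: eq_modn_dvd (E i); apply: dvdn_mull.
congr (_ && _); apply: IH => i; apply: eq_modn_dvd (E i); exact: dvdn_mulr.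
Qed.

Lemma card_dvd_square p : prime p -> #|[set m : 'I_(p ^ 2) | (p %| m)%N]| = p.
Proof.
move=> pp; have p0 := prime_gt0 pp.
rewrite -sum1dep_card big_mkcond /=.
rewrite (eq_bigr (fun m : 'I_(p ^ 2) => (m %% p == 0) : nat)%N) => [|m _]; last first.
  by rewrite /dvdn; case: eqP.
by rewrite count_residue // -mulnn modnMr mulnK // addn0.
Qed.

Lemma card_ndvd_square p : prime p -> #|[set m : 'I_(p ^ 2) | ~~ (p %| m)%N]| = (p ^ 2 - p)%N.
Proof.
move=> pp; have := cardsC [set m : 'I_(p ^ 2) | (p %| m)%N]; rewrite card_ord card_dvd_square //.
move=> H; rewrite -[X in (X - _)%N]H addKn; apply: eq_card => m; by rewrite !inE.
Qed.

Lemma card_exact_dvd_square p : prime p ->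
  #|[set m : 'I_(p ^ 2) | (p %| m)%N && ~~ (p ^ 2 %| m)%N]| = p.-1.
Proof.
move=> pp; have p20 : (0 < p ^ 2)%N by rewrite expn_gt0 prime_gt0.
have := cardsD1 (Ordinal p20) [set m : 'I_(p ^ 2) | (p %| m)%N].
rewrite card_dvd_square // inE dvdn0 add1n => /(congr1 predn) /= ->.
apply: eq_card => m; rewrite !inE andbC; congr (_ && _).
apply/idP/idP; apply: contra.
  by move=> /eqP ->; exact: dvdn0.
by move=> d; apply/eqP/val_inj => /=; move: d; rewrite /dvdn modn_small // => /eqP.
Qed.

(** The condition is a disjoint union of [l + 1] cases, each a product of conditions on single
    components. *)
Lemma local_ok_split p g : prime p ->
  (local_ok p g = [forall i, ~~ (p %| g i)] +
  \sum_(i < l) [forall j, if j == i then (p %| g j) && ~~ (p ^ 2 %| g j) else ~~ (p %| g j)] :> nat)%N.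
Proof.
move=> pp; have [/forallP np|/forallPn[i]] := boolP [forall i, ~~ (p %| g i)%N].
  rewrite big1 ?addn0; last first.
    move=> i _; apply/eqP; rewrite eqb0; apply/negP => /forallP/(_ i).
    by rewrite eqxx (negPf (np i)).
  rewrite /local_ok (_ : [forall i, _]) /=; last first.
    apply/forallP => i; apply: contra (np i); apply: dvdn_trans; exact: dvdn_exp.
  rewrite (_ : [forall i, forall j, _]) //; apply/forallP => i; apply/forallP => j.
  by rewrite (negPf (np i)) implybT.
rewrite negbK => pi; rewrite add0n (bigD1 i) //= big1 ?addn0; last first.
  move=> j ji; apply/eqP; rewrite eqb0; apply/negP => /forallP/(_ i).
  by rewrite eq_sym (negPf ji) pi.
congr nat_of_bool; apply/andP/forallP => [[/forallP H1 /forallP H2] j|H].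
  case: eqVneq => [->|ji]; first by rewrite pi H1.
  by have /forallP/(_ j) := H2 i; rewrite eq_sym ji pi.
have Hn j : j != i -> ~~ (p %| g j)%N by move=> /negPf ji; have := H j; rewrite ji.
split; apply/forallP => j.
  have := H j; case: eqVneq => [->|ji]; first by case/andP.
  by apply: contra; apply: dvdn_trans; exact: dvdn_exp.
apply/forallP => k; apply/implyP => jk; rewrite negb_and.
have [ji|/Hn ->//] := eqVneq j i; rewrite [X in _ || X]Hn ?orbT //.
by rewrite -ji eq_sym.
Qed.

(** No component divisible by [p]: [(p ^ 2 - p) ^ l] residues. Component [i] divisible exactly once:
    [(p - 1) (p ^ 2 - p) ^ (l - 1)], for each of the [l] values of [i]. *)
Lemma residue_dens_local p : prime p ->
  (residue_dens (p ^ 2) (local_ok p))%:R / (p ^ 2)%N%:R ^+ l =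
  (1 - p%:R^-1) ^+ l * (1 + l%:R / p%:R) :> R.
Proof.
move=> pp; have p0 := prime_gt0 pp.
have E : residue_dens (p ^ 2) (local_ok p) =
    ((p ^ 2 - p) ^ l + l * (p.-1 * (p ^ 2 - p) ^ l.-1))%N.
  rewrite /residue_dens -sum1dep_card big_mkcond /=.
  rewrite (eq_bigr (fun r : {ffun 'I_l -> 'I_(p ^ 2)} =>
    [forall i, ~~ (p %| r i)] + \sum_(i < l) [forall j, if j == i then
      (p %| r j) && ~~ (p ^ 2 %| r j) else ~~ (p %| r j)])%N); last first.
    by move=> r _; rewrite -local_ok_split //; case: local_ok.
  rewrite big_split /=; congr (_ + _)%N.
    rewrite -big_mkcond sum1dep_card (card_ffun_forall _ (fun _ m => ~~ (p %| m)%N)).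
    by rewrite prod_nat_const card_ord card_ndvd_square.
  rewrite exchange_big /= (eq_bigr (fun=> p.-1 * (p ^ 2 - p) ^ l.-1)%N).
    by rewrite sum_nat_const card_ord.
  move=> i _; rewrite -big_mkcond sum1dep_card.
  rewrite (card_ffun_forall _ (fun j m => if j == i then (p %| m) && ~~ (p ^ 2 %| m) else ~~ (p %| m))%N).
  rewrite (bigD1 i) //= eqxx card_exact_dvd_square //; congr (_ * _)%N.
  rewrite (eq_bigr (fun=> p ^ 2 - p)%N) => [|j /negPf ->]; last exact: card_ndvd_square.
  by rewrite prod_nat_const cardC1 card_ord.
have pR : (p%:R : R) != 0 by rewrite pnatr_eq0 -lt0n.
have Eu : (p ^ 2 - p)%N%:R = p%:R ^+ 2 * (1 - p%:R^-1) :> R.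
  rewrite natrB ?natrX; last by rewrite -{1}(expn1 p) leq_exp2l // prime_gt1.
  by field.
have Ew : p.-1%:R * p%:R = (p ^ 2 - p)%N%:R :> R.
  by rewrite -natrM; congr (_%:R); case: p p0 {pp E pR Eu} => // p _ /=; rewrite expnS expn1 mulSn addKn.
rewrite E natrD !natrM !natrX.
case: (posnP l) => [->|l0]; first by rewrite mul0r mul0r !expr0; field.
have -> : p.-1%:R * (p ^ 2 - p)%N%:R ^+ l.-1 = (p ^ 2 - p)%N%:R ^+ l / p%:R :> R.
  by apply: (mulIf pR); rewrite divfK // mulrAC Ew -exprS prednK.
rewrite Eu !exprMn; have := expf_neq0 l (expf_neq0 2 pR).
move: ((p%:R ^+ 2) ^+ l) ((1 - p%:R^-1) ^+ l) => a b a0; field.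
by rewrite pR expf_neq0.
Qed.

Lemma residue_dens_mod4 : residue_dens 4 mod4_ok = omega1 n.
Proof.
apply: eq_card => r; rewrite !inE; apply: eq_forallb => t.
have E : Dprod r (2 ^ t) = (tuple_gens (fun i => r i) t)%:R :> 'Z_4.
  rewrite /Dprod /tuple_gens /radprod natr_prod.
  apply: eq_big => [i|i _]; first by rewrite dotvE vbits_pow.
  by rewrite natr_Zp.
rewrite E -(inj_eq val_inj) /= val_Zp_nat //.
Qed.

Definition euler_partial (z : nat) : R :=
  \prod_(0 <= p < z | odd_prime p) ((1 - p%:R^-1) ^+ l * (1 + l%:R / p%:R)).

Lemma residue_dens_adm z : (residue_dens (modulus z) (adm_upto z))%:R / (modulus z)%:R ^+ l =
  (omega1 n)%:R / 4 ^+ l * euler_partial z :> R.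
Proof.
elim: z => [|z IH].
  rewrite /euler_partial big_geq // mulr1 /= -residue_dens_mod4; congr (_%:R / _).
  apply: residue_dens_ext => g; rewrite /adm_upto andbC.
  by case: forallP => // H; case: H => -[].
rewrite /euler_partial big_mkcond big_nat_recr //= -big_mkcond mulrA -/(euler_partial z) -IH.
rewrite (residue_dens_ext _ (adm_upto_succ z)).
case: (boolP (odd_prime z)) => oz; last first.
  by rewrite muln1 mulr1; congr (_%:R / _); apply: residue_dens_ext => g; rewrite andbT.
have zp : prime z by case/andP: oz.
rewrite residue_dens_crt ?modulus_gt0 ?expn_gt0 ?prime_gt0 //.
- rewrite -residue_dens_local // !natrM exprMn invfM mulrACA.
  by [].
- by rewrite coprime_pexpr // coprime_modulus.
- exact: periodic_adm.
- exact: periodic_local.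
Qed.

End LocalDensity.

(** * Failures of admissibility at large primes *)

Section Tail.
Variable R : realType.

(** Excluding [m = 0] leaves no rounding term, so the resulting bounds [x ^+ l / p ^+ 2] can be
    summed over all large primes. *)
Lemma count_dvd_le (B d : nat) (x : R) : (0 < d)%N -> 0 <= x ->
  (#|[set m : 'I_B | (0 < m)%N && (m%:R < x) && (d %| m)%N]|)%:R <= x / d%:R.
Proof.
move=> d0 x0; have dR : 0 < d%:R :> R by rewrite ltr0n.
rewrite ler_pdivlMr // -natrM.
set A := [set _ | _].
have [A0|/set0Pn[m0 m0A]] := eqVneq A finset.set0; first by rewrite A0 cards0 mul0n.
have [m mA maxm] := @arg_maxnP _ m0 (mem A) val m0A.
have : (#|A| <= m %/ d)%N.
  have inj : {in A &, injective (fun k : 'I_B => k %/ d)%N}.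
    move=> k k'; rewrite !inE => /andP[_ dk] /andP[_ dk'] E; apply/val_inj => /=.
    by rewrite -(divnK dk) E divnK.
  rewrite -(card_in_imset (f := fun k : 'I_B => inord (k %/ d).-1 : 'I_(m %/ d).-1.+1)); last first.
    move=> k k' kA k'A; move=> /(congr1 val) /=.
    have hk (j : 'I_B) : j \in A -> (0 < j %/ d)%N /\ (j %/ d <= m %/ d)%N.
      move=> jA; split; last by apply: leq_div2r; exact: maxm.
      by move: jA; rewrite inE divn_gt0 // => /andP[/andP[j0 _] dj]; exact: dvdn_leq.
    have [k1 k2] := hk _ kA; have [k1' k2'] := hk _ k'A.
    rewrite !inordK; try lia.
    by move=> E; apply: inj => //; lia.
  have m1 : (0 < m %/ d)%N.
    by move: mA; rewrite !inE divn_gt0 // => /andP[/andP[j0 _] dj]; exact: dvdn_leq.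
  by apply: leq_trans (max_card _) _; rewrite card_ord; lia.
move=> H; have mx : m%:R < x by move: mA; rewrite !inE => /andP[/andP[]].
apply: le_trans (ltW mx); rewrite ler_nat.
by apply: leq_trans (leq_divM m d); rewrite leq_mul2r H orbT.
Qed.

Lemma card_bigcup_le (I T : finType) (P : pred I) (F : I -> {set T}) :
  (#|\bigcup_(i | P i) F i| <= \sum_(i | P i) #|F i|)%N.
Proof.
elim/big_rec2: _ => [|i m A _ H]; first by rewrite cards0.
by apply: leq_trans (leq_card_setU _ _) _; rewrite leq_add2l.
Qed.

(** Telescoping, from [1 / p ^ 2 <= 1 / (p - 1) - 1 / p]. *)
Lemma sum_inv_square (z B : nat) : (1 < z)%N ->
  \sum_(z <= p < B) (p%:R ^+ 2)^-1 <= (z.-1%:R)^-1 :> R.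
Proof.
move=> z1; have [zB|Bz] := leqP z B; last by rewrite big_geq ?invr_ge0 // ltnW.
suff : \sum_(z <= p < B) (p%:R ^+ 2)^-1 <= (z.-1%:R)^-1 - (B.-1%:R)^-1 :> R.
  by move=> /le_trans; apply; rewrite gerBl invr_ge0.
elim: B zB => [|B IH]; first by rewrite leqn0 => /eqP z0; rewrite z0 in z1.
rewrite leq_eqVlt => /orP[/eqP <-|]; first by rewrite big_geq // subrr.
rewrite ltnS => zB; rewrite big_nat_recr //=.
have -> : (z.-1%:R)^-1 - B%:R^-1 = (z.-1%:R)^-1 - (B.-1%:R)^-1 + ((B.-1%:R)^-1 - B%:R^-1) :> R by ring.
apply: lerD; first exact: IH.
have B1 : (1 < B)%N by apply: leq_trans zB.
have [b Eb] : exists b, B = b.+2 by case: B B1 {IH zB} => [|[|b]] // _; exists b.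
have b0 : 0 < b.+1%:R :> R by [].
rewrite {}Eb /= -(natr1 b.+1); move: b0; move: b.+1%:R => b' b0.
have b1 : 0 < b' + 1 by lra.
have -> : b'^-1 - (b' + 1)^-1 = (b' * (b' + 1))^-1 by field; lra.
by rewrite lef_pV2 ?posrE ?mulr_gt0 ?exprn_gt0 //; nra.
Qed.

Variable n : nat.
Local Notation l := (ell n).

Definition good : pred ('I_l -> nat) := fun g => `[< tuple_adm g >] && mod4_ok g.

Lemma mod4_ok_odd g : mod4_ok g -> forall i : 'I_l, odd (g i).
Proof.
move=> /forallP H i.
have [t ti] : exists t : 'I_n, dot (vbit i) (delta_mx 0 t) == 1.
  apply: contrapT => /forallNP H0; have /eqP := vbit_neq0 i; apply; apply/rowP => t.
  by case: (F2_cases (vbit i 0 t)) => E; [rewrite E mxE | case: (H0 t); rewrite dot_delta E].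
have := H t; rewrite /tuple_gens /radprod (bigD1 i ti) /= => /eqP E.
have : odd ((g i * \prod_(i0 | (dot (vbit i0) (delta_mx 0 t) == 1) && (i0 != i)) g i0) %% 4) by rewrite E.
by rewrite odd_mod // oddM => /andP[].
Qed.

Lemma good_adm_upto z g : good g -> adm_upto z g.
Proof.
move=> /andP[/asboolP[sg cg] m4]; rewrite /adm_upto m4; apply/forallP => p.
apply/implyP => /andP[pp p2]; apply/andP; split.
  by apply/forallP => i; apply/negP => /(sg i) E; rewrite E in pp.
apply/forallP => i; apply/forallP => j; apply/implyP => ij; apply/negP => /andP[pi pj].
have : (p %| gcdn (g i) (g j))%N by rewrite dvdn_gcd pi.
by rewrite (eqP (cg _ _ ij)) dvdn1 => /eqP E; rewrite E in pp.
Qed.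

(** One encoding for both failures: if [i <> j], [p] is a common factor of two components; if
    [i = j], the two factors multiply to [p ^ 2], which divides component [i]. *)
Definition pair_mod (i j : 'I_l) (p : nat) (k : 'I_l) : nat :=
  ((if k == i then p else 1) * (if k == j then p else 1))%N.

Lemma adm_upto_not_good z g : adm_upto z g -> ~~ good g ->
  exists i j p, [/\ prime p, (z <= p)%N & forall k, (pair_mod i j p k %| g k)%N].
Proof.
move=> /andP[m4 /forallP az]; rewrite /good m4 andbT => /asboolPn nadm.
have og := mod4_ok_odd m4.
(* All components are odd by the condition modulo 4, so an offending prime is odd; below [z] it is
   excluded by [adm_upto z]. *)
have big p i : prime p -> (p %| g i)%N -> ~~ local_ok p g -> (z <= p)%N.
  move=> pp pi nl; rewrite leqNgt; apply/negP => pz; have := az (Ordinal pz).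
  have op : odd p by apply: dvdn_odd pi (og i).
  have p2 : (2 < p)%N by have := prime_gt1 pp; move: op; clear; case: p => [|[|[|p]]].
  by rewrite /= /odd_prime pp p2 (negPf nl).
have [H|/forallPn[i]] := boolP [forall i, `[< squarefree (g i) >]].
  have [i [j [ij ncop]]] : exists i j, i != j /\ ~~ coprime (g i) (g j).
    apply: contrapT => H0; apply: nadm; split; first by move=> i; apply/asboolP; exact: (forallP H i).
    move=> i j ij; apply: contrapT => /negP nc; apply: H0; by exists i, j.
  have gi0 : (0 < g i)%N by apply: odd_gt0.
  have G1 : (1 < gcdn (g i) (g j))%N.
    by rewrite ltn_neqAle eq_sym ncop gcdn_gt0 gi0.
  pose p := pdiv (gcdn (g i) (g j)); have pp : prime p := pdiv_prime G1.
  have := pdiv_dvd (gcdn (g i) (g j)); rewrite -/p dvdn_gcd => /andP[pi pj].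
  exists i, j, p; split=> //.
    apply: (big p i) => //; apply/negP => /andP[_ /forallP/(_ i)/forallP/(_ j)].
    by rewrite ij pi pj.
  move=> k; rewrite /pair_mod; case: (eqVneq k i) => [->|_].
    by rewrite (negPf ij) muln1.
  by rewrite mul1n; case: eqP => // ->.
move=> /asboolPn/existsNP[d /not_implyP[dg d1]].
have gi0 : (0 < g i)%N by apply: odd_gt0.
have d0 : (0 < d)%N.
  by case: d dg d1 => // H; move: gi0; rewrite lt0n; case/dvdnP: H => q ->; rewrite muln0.
have dgt1 : (1 < d)%N by rewrite ltn_neqAle d0 eq_sym andbT; apply/eqP.
pose p := pdiv d; have pp : prime p := pdiv_prime dgt1.
have p2 : (p ^ 2 %| g i)%N by apply: dvdn_trans dg; rewrite dvdn_exp2r // pdiv_dvd.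
exists i, i, p; split => //.
  apply: (big p i) => //; first by apply: dvdn_trans p2; exact: dvdn_exp.
  by apply/negP => /andP[/forallP/(_ i)]; rewrite p2.
by move=> k; rewrite /pair_mod; case: eqVneq => [->|]; rewrite ?muln1 // mulnn.
Qed.

Lemma card_pair_mod B i j p (x : R) : (0 < p)%N -> 0 <= x ->
  (#|[set f : {ffun 'I_l -> 'I_B} | [forall k, (0 < f k)%N && ((f k)%:R < x) && (pair_mod i j p k %| f k)%N]]|)%:R
  <= x ^+ l / p%:R ^+ 2.
Proof.
move=> p0 x0.
rewrite (card_ffun_forall _ (fun k m => (0 < m)%N && (m%:R < x) && (pair_mod i j p k %| m)%N)).
rewrite natr_prod.
have q0 k : (0 < pair_mod i j p k)%N by rewrite /pair_mod muln_gt0; do 2!case: ifP => _; rewrite ?p0.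
apply: (@le_trans _ _ (\prod_(k < l) (x / (pair_mod i j p k)%:R))).
  by apply: ler_prod => k _; rewrite ler0n count_dvd_le.
rewrite prodf_div prodr_const card_ord -natr_prod; rewrite le_eqVlt; apply/orP; left; apply/eqP.
congr (_ / _); rewrite /pair_mod big_split /= -natrX; congr (_%:R).
have E (u : 'I_l) : (\prod_(k < l) (if k == u then p else 1) = p)%N.
  by rewrite (bigD1 u) //= eqxx big1 ?muln1 // => k /negPf ->.
by rewrite !E mulnn.
Qed.

Lemma box_count_tail (B z : nat) (a b : 'I_l -> R) (T x : R) : (1 < z)%N -> 0 <= x ->
  (forall i, b i * T <= x) ->
  (box_count B (adm_upto z) a b T)%:R <=
  (box_count B good a b T)%:R + (l * l)%:R * x ^+ l / z.-1%:R.
Proof.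
move=> z1 x0 bx.
pose bad i j p := [set f : {ffun 'I_l -> 'I_B} |
  [forall k, (0 < f k)%N && ((f k)%:R < x) && (pair_mod i j p k %| f k)%N]].
have H : (box_count B (adm_upto z) a b T <= box_count B good a b T +
    \sum_i \sum_j \sum_(z <= p < B) #|bad i j p|)%N.
  have sub : [set f : {ffun 'I_l -> 'I_B} | adm_upto z (fun i => f i) && in_box a b T (fun i => f i)]
     \subset [set f : {ffun 'I_l -> 'I_B} | good (fun i => f i) && in_box a b T (fun i => f i)] :|:
       \bigcup_i \bigcup_j \bigcup_(p < B | (z <= p)%N) bad i j p.
    apply/fintype.subsetP => f; rewrite !inE => /andP[az bf].
    case: (boolP (good _)) => [gf|ng]; first by rewrite bf.
    have [i [j [p [pp zp dp]]]] := adm_upto_not_good az ng.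
    have og := mod4_ok_odd (proj1 (andP az)).
    have pB : (p < B)%N.
      apply: leq_ltn_trans (ltn_ord (f i)); apply: dvdn_leq; first exact: odd_gt0.
      by apply: dvdn_trans (dp i); rewrite /pair_mod eqxx dvdn_mulr.
    rewrite /=; apply/bigcupP; exists i => //; apply/bigcupP; exists j => //.
    apply/bigcupP; exists (Ordinal pB) => //; rewrite inE; apply/forallP => k.
    rewrite (odd_gt0 (og k)) dp andbT /=; apply: lt_le_trans (bx k).
    by have /andP[] := forallP bf k.
  apply: leq_trans (subset_leq_card sub) _; apply: leq_trans (leq_card_setU _ _) _.
  rewrite leq_add2l; apply: leq_trans (card_bigcup_le _ _) _; apply: leq_sum => i _.
  apply: leq_trans (card_bigcup_le _ _) _; apply: leq_sum => j _.
  apply: leq_trans (card_bigcup_le _ _) _.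
  by rewrite (@big_nat_widenl _ _ _ z 0) // big_mkord.
move: H; rewrite -(ler_nat R) natrD => /le_trans; apply; rewrite lerD2l.
rewrite natr_sum.
have -> : (l * l)%:R * x ^+ l / z.-1%:R = \sum_(i < l) \sum_(j < l) (x ^+ l / z.-1%:R) :> R.
  by rewrite !sumr_const card_ord -mulrnA -[RHS]mulr_natl mulrA.
apply: ler_sum => i _; rewrite natr_sum; apply: ler_sum => j _; rewrite natr_sum.
apply: le_trans (_ : \sum_(z <= p < B) x ^+ l * (p%:R ^+ 2)^-1 <= _).
  rewrite !big_nat; apply: ler_sum => p /andP[zp _]; apply: card_pair_mod => //.
  by apply: leq_trans zp; apply: ltnW.
rewrite -mulr_sumr ler_wpM2l ?exprn_ge0 //; exact: sum_inv_square.
Qed.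

End Tail.

(** * The Euler product and the density of admissible tuples *)

Section Euler.
Variables (R : realType) (n : nat).
Local Notation l := (ell n).

Definition euler_factor (p : nat) : R := (1 - p%:R^-1) ^+ l * (1 + l%:R / p%:R).

Lemma bernoulli (x : R) m : -1 <= x -> 1 + m%:R * x <= (1 + x) ^+ m.
Proof.
move=> x1; elim: m => [|m IH]; first by rewrite mul0r addr0 expr0.
rewrite exprS; apply: le_trans (_ : (1 + x) * (1 + m%:R * x) <= _).
  rewrite -natr1; have : 0 <= m%:R :> R by []; move: m%:R => M; nra.
by rewrite ler_wpM2l //; lra.
Qed.

Lemma euler_factor_gt0 p : (1 < p)%N -> 0 < euler_factor p.
Proof.
move=> p1; have p0 : 0 < p%:R :> R by rewrite ltr0n ltnW.
rewrite mulr_gt0 ?exprn_gt0 //.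
  by rewrite subr_gt0 invf_lt1 // ltr1n.

Qed.

(** With [u = 1 / p], Bernoulli's inequality bounds the factor by [(1 - u ^ 2) ^ l]. *)
Lemma euler_factor_le1 p : (1 < p)%N -> euler_factor p <= 1.
Proof.
move=> p1; have p0 : 0 < p%:R :> R by rewrite ltr0n ltnW.
have u0 : 0 < p%:R^-1 :> R by rewrite invr_gt0.
have u1 : p%:R^-1 < 1 :> R by rewrite invf_lt1 // ltr1n.
rewrite /euler_factor; move: p%:R^-1 u0 u1 => u u0 u1.
apply: le_trans (_ : (1 - u) ^+ l * (1 + u) ^+ l <= _).
  rewrite ler_wpM2l ?exprn_ge0 //; first by lra.
  by apply: bernoulli; lra.
by rewrite -exprMn; apply: exprn_ile1; nra.
Qed.

Lemma euler_factor_ge p : (1 < p)%N -> (l <= p)%N -> 1 - (l * l)%:R * (p%:R ^+ 2)^-1 <= euler_factor p.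
Proof.
move=> p1 lp; have p0 : 0 < p%:R :> R by rewrite ltr0n ltnW.
have u0 : 0 < p%:R^-1 :> R by rewrite invr_gt0.
have u1 : p%:R^-1 < 1 :> R by rewrite invf_lt1 // ltr1n.
have lu : l%:R * p%:R^-1 <= 1 :> R by rewrite ler_pdivrMr // mul1r ler_nat.
have := @bernoulli (- p%:R^-1) l _; rewrite /euler_factor -exprVn natrM.
have : 0 <= l%:R :> R by [].
move: (l%:R : R) lu => L; move: p%:R^-1 u0 u1 => u u0 u1 lu L0 => /(_ ltac:(lra)) H.
have H1 : 0 <= 1 + L * u by apply: addr_ge0 => //; apply: mulr_ge0 => //; exact: ltW.
apply: le_trans (ler_wpM2r H1 H); nra.
Qed.

Lemma odd_prime_gt1 p : odd_prime p -> (1 < p)%N.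
Proof. by case/andP=> _; apply: ltn_trans. Qed.

Lemma prod_ge_1Bsum (I : Type) (s : seq I) (P : pred I) (f a : I -> R) :
  (forall i, P i -> 0 <= a i) -> (forall i, P i -> 0 <= f i <= 1) -> (forall i, P i -> 1 - a i <= f i) ->
  1 - \sum_(i <- s | P i) a i <= \prod_(i <- s | P i) f i.
Proof.
move=> a0 f01 fa; suff [] : 0 <= \prod_(i <- s | P i) f i <= 1 /\
   1 - \sum_(i <- s | P i) a i <= \prod_(i <- s | P i) f i by [].
elim: s => [|i s [/andP[IH1 IH2] IH3]]; first by rewrite !big_nil subr0 ler01 !lexx.
rewrite !big_cons; case: ifP => Pi; last by rewrite IH1.
have /andP[f0 f1] := f01 _ Pi; have ai := a0 _ Pi; have := fa _ Pi.
move: (\prod_(_ <- _ | _) _) IH1 IH2 IH3 => p p0 p1; move: (\sum_(_ <- _ | _) _) => S Sp fi.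
by split; [apply/andP; split; nra | nra].
Qed.

Lemma euler_partial_gt0 z : 0 < euler_partial R n z.
Proof. by apply: prodr_gt0 => p /odd_prime_gt1 /euler_factor_gt0. Qed.

Lemma euler_partial_cat z w : (z <= w)%N ->
  euler_partial R n w = euler_partial R n z * \prod_(z <= p < w | odd_prime p) euler_factor p.
Proof. by move=> zw; rewrite /euler_partial (@big_cat_nat _ _ _ z). Qed.

Lemma euler_tail_le1 z w : \prod_(z <= p < w | odd_prime p) euler_factor p <= 1.
Proof.
suff /andP[] : 0 <= \prod_(z <= p < w | odd_prime p) euler_factor p <= 1 by [].
elim/big_ind: _ => [|x y /andP[x0 x1] /andP[y0 y1]|p /odd_prime_gt1 p1].
- by rewrite ler01 lexx.
- by rewrite mulr_ge0 //= mulr_ile1.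
- by rewrite ltW ?euler_factor_gt0 //= euler_factor_le1.
Qed.

Lemma euler_tail_ge z w : (1 < z)%N -> (l <= z)%N ->
  1 - (l * l)%:R / z.-1%:R <= \prod_(z <= p < w | odd_prime p) euler_factor p.
Proof.
move=> z1 lz; rewrite big_nat_cond.
apply: le_trans (prod_ge_1Bsum (a := fun p => (l * l)%:R * (p%:R ^+ 2)^-1) _ _ _ _).
- rewrite lerD2l lerN2 -mulr_sumr ler_wpM2l //.
  apply: le_trans (sum_inv_square R w z1); rewrite [leRHS]big_nat_cond.
  rewrite big_mkcond [leRHS]big_mkcond; apply: ler_sum => p _.
  by case: (_ <= _ < _)%N => //=; case: ifP => // _; rewrite invr_ge0 exprn_ge0.
- by move=> p _; rewrite mulr_ge0 // invr_ge0 exprn_ge0.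
- by move=> p /andP[_ /odd_prime_gt1 p1]; rewrite ltW ?euler_factor_gt0 //= euler_factor_le1.
- move=> p /andP[/andP[zp _] /odd_prime_gt1 p1]; apply: euler_factor_ge => //; exact: leq_trans zp.
Qed.

Lemma euler_partial_noninc z w : (z <= w)%N -> euler_partial R n w <= euler_partial R n z.
Proof.
move=> zw; rewrite (euler_partial_cat zw) ger_pMr ?euler_partial_gt0 //; exact: euler_tail_le1.
Qed.

Lemma euler_partial_cvg : (euler_partial R n @ \oo --> euler_product n R)%classic.
Proof.
rewrite -[euler_product n R]/(limn (euler_partial R n)).
apply: nonincreasing_is_cvgn; first exact: euler_partial_noninc.
by exists 0 => _ [z _ <-]; rewrite ltW ?euler_partial_gt0.
Qed.

Lemma euler_product_le z : euler_product n R <= euler_partial R n z.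
Proof.
apply: (nonincreasing_cvgn_ge euler_partial_noninc).
by apply: cvgP; exact: euler_partial_cvg.
Qed.

Lemma euler_product_ge z : (1 < z)%N -> (l <= z)%N ->
  euler_partial R n z * (1 - (l * l)%:R / z.-1%:R) <= euler_product n R.
Proof.
move=> z1 lz; rewrite -(cvg_lim _ euler_partial_cvg) //; apply: limr_ge.
  by apply: cvgP; exact: euler_partial_cvg.
near=> w.
rewrite (@euler_partial_cat z w); last by near: w; exact: nbhs_infty_ge.
by rewrite ler_wpM2l ?(ltW (euler_partial_gt0 _)) // euler_tail_ge.
Unshelve. all: by end_near. Qed.

Lemma euler_product_gt0 : 0 < euler_product n R.
Proof.
(* Chosen to make [l ^ 2 / (z - 1) < 1], so that the tail beyond [z] stays away from 0. *)
pose z := (2 * (l * l) + l + 2)%N.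
have z1 : (1 < z)%N by rewrite /z; lia.
apply: lt_le_trans (euler_product_ge z1 _); last by rewrite /z; lia.
rewrite mulr_gt0 ?euler_partial_gt0 // subr_gt0 ltr_pdivrMr ?mul1r ?ltr_nat; rewrite ?ltr0n /z; lia.
Qed.

Definition density : R := (omega1 n)%:R / 4 ^+ l * euler_product n R.

Lemma tends_good (B : R -> nat) (a b : 'I_l -> R) :
  (forall i, 0 <= a i) -> (forall i, a i <= b i) ->
  (forall K : R, exists T0, forall T, T0 <= T -> K * T <= (B T)%:R) ->
  tends (fun T => (box_count (B T) (@good n) a b T)%:R / T ^+ l)
    (density * \prod_i (b i - a i)).
Proof.
move=> a0 ab bB e e0; pose K := \sum_i b i.
have b0 i : 0 <= b i by apply: le_trans (ab i).
have K0 : 0 <= K by apply: sumr_ge0.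
have bK i : b i <= K by rewrite /K (bigD1 i) //= ler_wpDr // sumr_ge0.
set P := \prod_i _; have P0 : 0 <= P by apply: prodr_ge0 => i _; rewrite subr_ge0.
pose W : R := (omega1 n)%:R / 4 ^+ l; have W0 : 0 <= W by rewrite divr_ge0 // exprn_ge0.
(* [z] is fixed before [T]: it brings the truncated product close to its limit and makes the
   contribution of the primes beyond [z] small uniformly in [T]. *)
have [z [z1 [Hz1 Hz2]]] : exists z, (1 < z)%N /\
    (W * P * (euler_partial R n z - euler_product n R) <= e / 3 /\
    (l * l)%:R * K ^+ l / z.-1%:R <= e / 3).
  have WP : 0 < W * P + 1 by rewrite ltr_wpDl // mulr_ge0.
  have /cvgrPdist_le/(_ (e / 3 / (W * P + 1)))[|N _ HN] := euler_partial_cvg.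
    by rewrite !divr_gt0.
  pose M := Num.bound ((l * l)%:R * K ^+ l / (e / 3)).
  pose z := (maxn N M.+2); exists z; split; [by rewrite /z; lia | split].
    have := HN z; rewrite /= leq_maxl => /(_ isT); rewrite distrC.
    rewrite ger0_norm ?subr_ge0 ?euler_product_le // ler_pdivlMr // => H.
    apply: le_trans H; rewrite [leRHS]mulrC ler_wpM2r ?subr_ge0 ?euler_product_le //.
    by rewrite lerDl.
  have Mz : (M < z.-1)%N by rewrite /z; lia.
  have z0 : 0 < z.-1%:R :> R by rewrite ltr0n; lia.
  rewrite ler_pdivrMr // -ler_pdivrMl ?divr_gt0 // [leLHS]mulrC ltW //.
  apply: lt_trans (_ : M%:R < _); last by rewrite ltr_nat.
  by apply: archi_boundP; rewrite divr_ge0 ?mulr_ge0 ?exprn_ge0 ?divr_ge0 // ltW.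
have e3 : 0 < e / 3 by rewrite divr_gt0.
have [T0 HT] := @tends_periodic R l B (modulus z) (adm_upto z) a b (modulus_gt0 z) (@periodic_adm _ z) a0 ab bB _ e3.
exists (Num.max T0 1) => T; rewrite ge_max => /andP[/HT {}HT T1].
have Tp : 0 < T by apply: lt_le_trans T1.
have Tl : 0 < T ^+ l by rewrite exprn_gt0.
have up := @box_count_tail R n (B T) z a b T (K * T) z1 (mulr_ge0 K0 (ltW Tp)) (fun i => ler_wpM2r (ltW Tp) (bK i)).
have dn : (box_count (B T) (@good n) a b T <= box_count (B T) (@adm_upto n z) a b T)%N.
  apply: subset_leq_card; apply/fintype.subsetP => f; rewrite !inE => /andP[gf ->].
  by rewrite good_adm_upto.
move: dn HT; rewrite -(ler_nat R) residue_dens_adm -/W -/P.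
have {}up : (box_count (B T) (@adm_upto n z) a b T)%:R / T ^+ l <=
   (box_count (B T) (@good n) a b T)%:R / T ^+ l + e / 3.
  apply: le_trans (ler_wpM2r _ up) _; first by rewrite invr_ge0 ltW.
  rewrite mulrDl lerD2l; apply: le_trans Hz2; rewrite exprMn.
  rewrite le_eqVlt; apply/orP; left; apply/eqP.
  by field; rewrite (gt_eqF Tl) pnatr_eq0; lia.
move: up; rewrite -[_ <= (box_count _ (adm_upto z) _ _ _)%:R](ler_pM2r (_ : 0 < (T ^+ l)^-1)) ?invr_gt0 //.
rewrite /density -/W !ler_norml; move: (_ / T ^+ l) (_ / T ^+ l) => x y xy yx.
have -> : W * euler_partial R n z * P = W * P * (euler_partial R n z - euler_product n R) + W * euler_product n R * P by ring.
have : 0 <= W * P * (euler_partial R n z - euler_product n R).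
  by rewrite !mulr_ge0 // subr_ge0 euler_product_le.
move: Hz1; move: (W * P * _) => u ue u0 /andP[h1 h2]; apply/andP; split; lra.
Qed.

End Euler.

(** * The iterated integral and chains of integers *)

Section InnerInt.
Variables (R : realType) (Rs : nat -> R).
Hypothesis Rs1 : forall j, (2 <= j)%N -> 1 <= Rs j.
Notation mu := (@lebesgue_measure R).
Notation G := (inner_int Rs).

Lemma inner_intS k b :
  G k.+1 b = (\int[mu]_(a in `[Rs k.+2, b]%classic) (G k a / a))%R.
Proof. by []. Qed.

(** A joint induction: monotonicity makes the integrand measurable and bounded, hence integrable,
    and integrability gives the additivity that makes the next iterate monotone. *)
Lemma inner_int_facts k : [/\ forall b, 0 <= G k b, {homo G k : a b / a <= b} &
  forall r b, 1 <= r -> mu.-integrable `[r, b]%classic (EFin \o (fun a => G k a / a))].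
Proof.
suff step : forall k, (forall b, 0 <= G k b) -> {homo G k : a b / a <= b} ->
  forall r b, 1 <= r -> mu.-integrable `[r, b]%classic (EFin \o (fun a => G k a / a)).
  elim: k => [|k [G0 Gm Gi]].
    by have h1 : {homo G 0 : a b / a <= b} by []; split => //; apply: step => // b.
  have G0' b : 0 <= G k.+1 b.
    rewrite inner_intS; apply: Rintegral_ge0 => a /=; rewrite in_itv /= => /andP[ra _].
    by rewrite divr_ge0 //; apply: le_trans ra; apply: le_trans (Rs1 _).
  have Gm' : {homo G k.+1 : a b / a <= b}.
    move=> a b ab; rewrite !inner_intS.
    have r1 := Rs1 (isT : (2 <= k.+2)%N).
    have [ra|ar] := leP (Rs k.+2) a; last first.
      rewrite set_itv_ge ?Rintegral_set0; last by rewrite bnd_simp -ltNge.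
      by apply: Rintegral_ge0 => x /=; rewrite in_itv /= => /andP[rx _]; rewrite divr_ge0 //; lra.
    rewrite -subr_ge0 Rintegral_itvB //; last exact: Gi.
    by apply: Rintegral_ge0 => x /=; rewrite in_itv /= => /andP[rx _]; rewrite divr_ge0 //; lra.
  by split => //; exact: step.
move=> {}k G0 Gm r b r1; apply: measurable_bounded_integrable => //.
- by rewrite /= lebesgue_measure_itv /=; case: ifP => _; rewrite ?ltry // -EFinB ltry.
- apply: measurable_funM; first exact: nondecreasing_measurable.
  apply: subspace_continuous_measurable_fun => //.
  apply: continuous_in_subspaceT => x; rewrite inE /= in_itv /= => /andP[rx _].
  by apply: inv_continuous; rewrite gt_eqF //; lra.
- exists (G k b); split; first exact: num_real.
  move=> M bM x /=; rewrite in_itv /= => /andP[rx xb].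
  have x1 : 1 <= x by lra.
  rewrite ger0_norm ?divr_ge0 //; last by lra.
  apply: le_trans (ltW bM); rewrite ler_pdivrMr; last by lra.
  apply: le_trans (Gm _ _ xb) _; by rewrite ler_peMr.
Qed.

Lemma inner_int_ge0 k b : 0 <= G k b.
Proof. by have [] := inner_int_facts k. Qed.

Lemma inner_int_homo k : {homo G k : a b / a <= b}.
Proof. by have [] := inner_int_facts k. Qed.

Lemma inner_int_eq0 k b : b <= Rs k.+2 -> G k.+1 b = 0.
Proof.
rewrite inner_intS le_eqVlt => /orP[/eqP ->|br]; first by rewrite set_itv1 Rintegral_set1.
by rewrite set_itv_ge ?Rintegral_set0 // bnd_simp -ltNge.
Qed.

Lemma inner_int_incE k A B : Rs k.+2 <= A -> A <= B ->
  G k.+1 B - G k.+1 A = (\int[mu]_(a in `]A, B]%classic) (G k a / a))%R.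
Proof.
move=> rA AB; rewrite !inner_intS Rintegral_itvB //.
by have [_ _ ->] := inner_int_facts k; rewrite // Rs1.
Qed.

Lemma Rintegral_cst_itv (c A B : R) : A <= B ->
  (\int[mu]_(a in `]A, B]%classic) c)%R = c * (B - A).
Proof.
move=> AB; rewrite Rintegral_cst //= lebesgue_measure_itv /= lte_fin.
move: AB; rewrite le_eqVlt => /orP[/eqP ->|-> //]; by rewrite ltxx subrr.
Qed.

Lemma inner_int_integrable k A B : Rs k.+2 <= A ->
  mu.-integrable `]A, B]%classic (EFin \o (fun a => G k a / a)).
Proof.
move=> rA; have [_ _ H] := inner_int_facts k.
apply: (@integrableS _ _ _ mu `[A, B]%classic) => //; first exact: subset_itv_oc_cc.
by apply: H; apply: le_trans rA; exact: Rs1.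
Qed.

Lemma cst_integrable (c A B : R) : mu.-integrable `]A, B]%classic (EFin \o (fun=> c)).
Proof.
apply: measurable_bounded_integrable => //.
- by rewrite /= lebesgue_measure_itv /=; case: ifP => _; rewrite ?ltry // -EFinB ltry.
- by exists `|c|; split; [exact: num_real | move=> M /ltW cM x _].
Qed.

(** Between [A] and [B] the integrand is at least [G k A / B]. *)
Lemma inner_int_inc_ge k A B : Rs k.+2 <= A -> A <= B ->
  (1 - A / B) * G k A <= G k.+1 B - G k.+1 A.
Proof.
move=> rA AB; have A1 : 1 <= A by apply: le_trans rA; exact: Rs1.
have -> : (1 - A / B) * G k A = (\int[mu]_(a in `]A, B]%classic) (G k A / B))%R.
  by rewrite Rintegral_cst_itv //; field; apply/eqP; lra.
rewrite inner_int_incE //; apply: le_Rintegral => //.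
- exact: cst_integrable.
- exact: inner_int_integrable.
move=> x /=; rewrite in_itv /= => /andP[Ax xB]; rewrite ler_pM ?inner_int_ge0 //.
- by rewrite invr_ge0; lra.
- by apply: inner_int_homo; lra.
- by rewrite lef_pV2 ?posrE //; lra.
Qed.

(** The integrand is at most [G k B / A]. An [A] below the threshold is raised to it: [G k.+1] is 0
    at both points, and the right-hand side decreases. *)
Lemma inner_int_inc_le k A B : 0 < A -> A <= B ->
  G k.+1 B - G k.+1 A <= (B / A - 1) * G k B.
Proof.
move=> A0 AB; wlog rA : A A0 AB / Rs k.+2 <= A => [H|].
  have [|Ar] := leP (Rs k.+2) A; first exact: H.
  rewrite (inner_int_eq0 (ltW Ar)) subr0.
  have BA : 0 <= B / A - 1 by rewrite subr_ge0 ler_pdivlMr // mul1r.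
  have [Br|rB] := leP B (Rs k.+2); first by rewrite inner_int_eq0 // mulr_ge0 // inner_int_ge0.
  have r0 : 0 < Rs k.+2 by apply: lt_le_trans (Rs1 _).
  have := H (Rs k.+2) r0 (ltW rB) (lexx _).
  rewrite (@inner_int_eq0 k (Rs k.+2)) // subr0 => /le_trans; apply.
  rewrite ler_wpM2r ?inner_int_ge0 // lerD2r ler_wpM2l //; first by lra.
  by rewrite lef_pV2 ?posrE // ltW.
have -> : (B / A - 1) * G k B = (\int[mu]_(a in `]A, B]%classic) (G k B / A))%R.
  by rewrite Rintegral_cst_itv //; field; apply/eqP; lra.
rewrite inner_int_incE //; apply: le_Rintegral => //.
- exact: inner_int_integrable.
- exact: cst_integrable.
move=> x /=; rewrite in_itv /= => /andP[Ax xB]; rewrite ler_pM ?inner_int_ge0 //.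
- by rewrite invr_ge0; lra.
- exact: inner_int_homo.
- by rewrite lef_pV2 ?posrE //; lra.
Qed.

Lemma inner_int_lipschitz k A B : A <= B ->
  G k.+1 B - G k.+1 A <= (B - A) * G k B.
Proof.
move=> AB; have r1 := Rs1 (isT : (2 <= k.+2)%N).
wlog A1 : A AB / 1 <= A => [H|].
  have [|A1] := leP 1 A; first exact: H.
  have [B1|B1] := leP B 1.
    by rewrite !inner_int_eq0 ?subrr ?mulr_ge0 ?inner_int_ge0 ?subr_ge0 //; lra.
  have := H 1 (ltW B1) (lexx _); rewrite !(@inner_int_eq0 k 1) // (@inner_int_eq0 k A); last by lra.
  by move/le_trans; apply; rewrite ler_wpM2r ?inner_int_ge0 //; lra.
apply: le_trans (inner_int_inc_le k _ AB) _; first by lra.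
rewrite ler_wpM2r ?inner_int_ge0 //.
have -> : B / A - 1 = (B - A) / A by field; lra.
by rewrite ler_pdivrMr; [nra | lra].
Qed.

Lemma inner_int_continuous k : continuous (G k).
Proof.
case: k => [|k]; first exact: cst_continuous.
move=> b; apply/cvgrPdist_le => e e0.
have g0 := inner_int_ge0 k (b + 1).
have d0 : 0 < Num.min 1 (e / (G k (b + 1) + 1)) by rewrite lt_min ltr01 divr_gt0 //; lra.
near=> x.
have : `|b - x| < Num.min 1 (e / (G k (b + 1) + 1)).
  by near: x; apply: (@cvgr_dist_lt _ R^o R (nbhs b) _ id b); [exact: cvg_id | ].
rewrite lt_min ltr_pdivlMr; last by lra.
move=> /andP[bx1 bx2].
have aux u v : u <= v -> v <= b + 1 -> `|u - v| = `|b - x| -> `|G k.+1 u - G k.+1 v| <= e.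
  move=> uv vb E; rewrite distrC ger0_norm ?subr_ge0 ?inner_int_homo //.
  apply: le_trans (inner_int_lipschitz k uv) _; apply: le_trans (ltW bx2).
  rewrite -E distrC ger0_norm ?subr_ge0 // ler_wpM2l ?subr_ge0 //.
  by apply: le_trans (inner_int_homo k vb) _; lra.
have [bx|xb] := leP b x; first by apply: aux => //; move: bx1; rewrite ltr_norml; lra.
by rewrite distrC; apply: aux; rewrite ?ltW // 1?distrC //; lra.
Unshelve. all: by end_near. Qed.

Section Chains.
Variable E : R.
Hypothesis E1 : 1 < E.

(* Chains c_1, ..., c_k < v: strictly increasing for [s = 0], weakly for [s = 1]. *)
Fixpoint chains (p : nat -> pred nat) (s k v : nat) : seq (seq nat) :=
  if k is k'.+1 then
    flatten [seq [seq rcons c w | c <- chains p s k' (w + s)] | w <- iota 0 v & p k' w]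
  else [:: [::]].

Lemma size_chains p s k v : size (chains p s k.+1 v) =
  (\sum_(0 <= w < v | p k w) size (chains p s k (w + s)))%N.
Proof.
rewrite /= size_flatten /shape -map_comp sumnE big_map big_filter /index_iota subn0.
by apply: eq_bigr => w _; rewrite /= size_map.
Qed.

Lemma mem_chains p s k v c : c \in chains p s k v <->
  [/\ size c = k, forall i, (i < k)%N -> p i (nth 0%N c i),
      forall i, (i.+1 < k)%N -> (nth 0%N c i < nth 0%N c i.+1 + s)%N &
      (0 < k)%N -> (last 0%N c < v)%N].
Proof.
elim: k v c => [|k IH] v c /=.
  by rewrite inE; split => [/eqP ->|[/eqP]]; rewrite ?size_eq0.
split.
  move=> /flatten_mapP[w]; rewrite mem_filter mem_iota => /andP[pw /andP[_ wv]].
  move=> /mapP[d /IH[sd pd dd ld] ->]; split.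
  - by rewrite size_rcons sd.
  - move=> i; rewrite ltnS leq_eqVlt nth_rcons sd => /orP[/eqP ->|ik].
      by rewrite ltnn eqxx.
    by rewrite ik pd.
  - move=> i; rewrite ltnS => ik; rewrite !nth_rcons sd ik.
    move: ik; rewrite leq_eqVlt => /orP[/eqP Ei|ik]; last by rewrite ik dd.
    by rewrite -Ei ltnn eqxx -nth_last sd -Ei /= in ld *; apply: ld.
  - by rewrite last_rcons => _; move: wv; rewrite add0n.
case/lastP: c => [|c w] [] //; rewrite size_rcons => -[sc] pc dc /(_ isT).
rewrite last_rcons => wv; apply/flatten_mapP; exists w.
  rewrite mem_filter mem_iota add0n wv andbT.
  by have := pc k (leqnn _); rewrite nth_rcons sc ltnn eqxx leq0n andbT.
apply/mapP; exists c => //; apply/IH; split => //.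
- by move=> i ik; have := pc i (ltnW ik); rewrite nth_rcons sc ik.
- by move=> i ik; have := dc i (leqW ik); rewrite !nth_rcons sc ik (ltnW ik).
- move=> k0; have := dc k.-1; rewrite prednK // => /(_ (leqnn _)).
  by rewrite !nth_rcons sc ltnn eqxx prednK // leqnn -nth_last sc.
Qed.

Lemma uniq_chains p s k v : uniq (chains p s k v).
Proof.
elim: k v => [//|k IH] v /=; apply: allpairs_uniq_dep.
- by rewrite filter_uniq // iota_uniq.
- by move=> w _; exact: IH.
- by move=> [w c] [w' c'] _ _ /= /rcons_inj[-> ->].
Qed.

(** The cell of [w] goes from [E ^+ w] to [E ^+ w.+1]. [thr_lower] asks it to lie above the
    threshold, [thr_upper] only to reach beyond it; with strict, respectively weak, chains they
    bound the integral from below and from above. *)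
Definition thr_lower : nat -> pred nat := fun k w => Rs k.+2 <= E ^+ w.
Definition thr_upper : nat -> pred nat := fun k w => Rs k.+2 < E ^+ w.+1.

Lemma inner_int_one k : G k.+1 1 = 0.
Proof. by apply: inner_int_eq0; exact: Rs1. Qed.

(** Induction on [v]: over one cell the integral grows by at least [1 - E^-1] times the inner value
    at the lower end [E ^+ v], whose chains are those continued by [v]. *)
Lemma chains_lower k v :
  (1 - E^-1) ^+ k * (size (chains thr_lower 0 k v))%:R <= G k (E ^+ v).
Proof.
have e1 := E1; have q0 : 0 <= 1 - E^-1 by rewrite subr_ge0 invf_le1; lra.
elim: k v => [|k IH] v; first by rewrite /= expr0 mul1r.
rewrite size_chains exprS -mulrA.
elim: v => [|v IHv]; first by rewrite big_geq // mulr0 mulr0 inner_int_ge0.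
rewrite big_mkcond big_nat_recr // -big_mkcond natrD mulrDr mulrDr -(subrKC (G k.+1 (E ^+ v)) (G k.+1 (E ^+ v.+1))).
apply: lerD => //; rewrite /thr_lower; case: ifP => [rv|_].
  rewrite addn0; have Ev : 0 < E ^+ v by rewrite exprn_gt0 //; lra.
  apply: le_trans (inner_int_inc_ge _ _); rewrite // ?ler_eXn2l //.
  have -> : E ^+ v / E ^+ v.+1 = E^-1 by rewrite exprS; field; apply/andP; split; apply/eqP; lra.
  by rewrite ler_wpM2l.
by rewrite !mulr0 subr_ge0 inner_int_homo // ler_eXn2l.
Qed.

(** Over one cell the inner value is bounded by that at the upper end [E ^+ v.+1], hence the
    repeated entries; a cell below the threshold adds nothing. *)
Lemma chains_upper k v :
  G k (E ^+ v) <= (E - 1) ^+ k * (size (chains thr_upper 1 k v))%:R.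
Proof.
have e1 := E1; have q0 : 0 <= E - 1 by lra.
elim: k v => [|k IH] v; first by rewrite /= expr0 mul1r.
rewrite size_chains exprS -mulrA.
elim: v => [|v IHv]; first by rewrite big_geq // mulr0 mulr0 expr0 inner_int_one.
rewrite big_mkcond big_nat_recr // -big_mkcond natrD mulrDr mulrDr -(subrKC (G k.+1 (E ^+ v)) (G k.+1 (E ^+ v.+1))).
have Ev : 0 < E ^+ v by rewrite exprn_gt0 //; lra.
apply: lerD => //; rewrite /thr_upper; case: ifP => [rv|].
  apply: le_trans (inner_int_inc_le _ _ _) _; rewrite // ?ler_eXn2l //.
  have -> : E ^+ v.+1 / E ^+ v - 1 = E - 1 by rewrite exprS; field; apply/eqP; lra.
  by rewrite ler_wpM2l // addn1.
move/negbT; rewrite -leNgt => Er; rewrite !mulr0 (inner_int_eq0 Er) sub0r oppr_le0.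
exact: inner_int_ge0.
Qed.

End Chains.
End InnerInt.

(** * Tuples in the shape region *)

Section Cosets.
Variable l : nat.
Variable C : 'M[int]_l.
Hypothesis detC : \det C != 0.

Lemma lattice_cosets : exists (X : finType) (xi : X -> 'cV[int]_l),
  #|X| = `|\det C|%N /\
  forall w, exists x k, w = xi x + C *m k /\
    forall x' k', w = xi x' + C *m k' -> x' = x /\ k' = k.
Proof.
have [L uL [U uU [d dd CE]]] := int_Smith_normal_form C.
pose e (i : 'I_l) : int := d`_i.
have CE' : C = L *m diag_mx (\row_i e i) *m U.
  rewrite CE; congr (_ *m _ *m _); apply/matrixP => i j; rewrite !mxE.
  by rewrite mulrb eq_sym.
have dL : `|\det L|%N = 1%N by move: uL; rewrite unitmxE => /orP[] /eqP ->.
have dU : `|\det U|%N = 1%N by move: uU; rewrite unitmxE => /orP[] /eqP ->.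
have detE : (`|\det C| = \prod_i `|e i|)%N.
  rewrite CE' !det_mulmx !abszM dL dU mul1n muln1 det_diag.
  by rewrite (big_morph absz abszM absz1); apply: eq_bigr => i _; rewrite mxE.
have e0 i : e i != 0.
  have : (0 < \prod_i `|e i|)%N by rewrite -detE absz_gt0.
  by rewrite (bigD1 i) //= muln_gt0 absz_gt0 => /andP[].
(* A common bound that puts the residues modulo all the [e i] in one finite type. *)
pose B := (\prod_i `|e i|).+1%N.
have eB i : (`|e i| < B)%N.
  rewrite ltnS (@dvdn_leq _ (\prod_j `|e j|)) //; last by rewrite (bigD1 i) //= dvdn_mulr.
  by rewrite -detE absz_gt0.
pose X := {x : {ffun 'I_l -> 'I_B} | [forall i, x i < `|e i|]%N}.
pose rep (x : X) : 'cV[int]_l := \col_i (sval x i : nat)%:Z.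
exists X, (fun x => L *m rep x); split.
  rewrite card_sig detE.
  have := @card_ffun_forall l B (fun i (m : nat) => m < `|e i|)%N.
  rewrite cardsE => ->; apply: eq_bigr => i _.
  rewrite -sum1dep_card -(big_ord_widen _ (fun=> 1%N)) ?sum1_card ?card_ord //.
  exact: ltnW.
(* In these coordinates the lattice is diagonal: dividing each [v i] by [e i], the remainders give
   the coset and the quotients give [k]. *)
move=> w; pose v := invmx L *m w.
have mB i : (`|(v i 0%R %% e i)%Z| < B)%N.
  apply: ltn_trans (eB i); rewrite -ltz_nat gez0_abs ?modz_ge0 //.
  by rewrite ltz_mod.
have xP : [forall i, [ffun i => Ordinal (mB i)] i < `|e i|]%N.
  apply/forallP => i; rewrite ffunE /= -ltz_nat gez0_abs ?modz_ge0 //.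
  by rewrite ltz_mod.
pose x : X := exist _ [ffun i => Ordinal (mB i)] xP.
pose k : 'cV[int]_l := invmx U *m (\col_i (v i 0%R %/ e i)%Z).
have dE (y : 'cV[int]_l) i : (diag_mx (\row_i e i) *m y) i 0 = e i * y i 0.
  by rewrite mul_diag_mx !mxE.
have key x' k' : w = L *m rep x' + C *m k' <->
    forall i, v i 0 = (sval x' i : nat)%:Z + e i * (U *m k') i 0.
  have -> : w = L *m v by rewrite mulKVmx.
  rewrite CE' -!mulmxA -mulmxDr; split => [/(congr1 (mulmx (invmx L)))|H].
    by rewrite !mulKmx // => -> i; rewrite mxE dE mxE.
  by congr (_ *m _); apply/colP => i; rewrite H [RHS]mxE dE [X in _ = X + _]mxE.
exists x, k; split.
  apply/key => i; rewrite /k mulKVmx // [(\col_i0 _) _ _]mxE /x /= ffunE /= gez0_abs ?modz_ge0 //.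
  by rewrite {1}(divz_eq (v i 0) (e i)) addrC mulrC.
move=> x' k' /key H.
have H1 i : (sval x' i : nat)%:Z = (v i 0%R %% e i)%Z /\ (U *m k') i 0 = (v i 0%R %/ e i)%Z.
  have lt : 0 <= (sval x' i : nat)%:Z < `|e i|.
    by rewrite -abszE !lez_nat ltz_nat (forallP (svalP x') i).
  have q : (v i 0%R %/ e i)%Z = (U *m k') i 0.
    by rewrite H mulrC addrC divzMDl // divz_small ?addr0.
  by split=> //; rewrite /modz q H mulrC addrK.
split.
  apply: val_inj => /=; apply/ffunP => i; apply: val_inj; rewrite ffunE /=.
  by have [<- _] := H1 i.
rewrite /k; apply: (canRL (mulKmx uU)); apply/colP => i; rewrite [RHS]mxE.
by have [_ ->] := H1 i.
Qed.

End Cosets.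

Section Region.
Variables (R : realType) (m : nat) (C : 'M[int]_m.+1).
Local Notation l := m.+1.
Hypotheses (C0 : forall i, C 0 i = 1) (Cs : forall j, j != 0 -> \sum_i C j i = 0).
Hypothesis m0 : (0 < m)%N.
Variables (Rs : nat -> R) (b : R).
Hypotheses (Rs1 : forall j, (2 <= j)%N -> 1 <= Rs j) (b1 : 1 <= b).
Implicit Types (g : 'I_l -> nat) (T : R).

(** For the matrices to come, row 0 is the logarithm of the product of the tuple and row [j] that of
    the parameter [lambda] of index [j.+1]. *)
Definition zrow g (j : nat) : R := \sum_i (C (inord j) i)%:~R * ln (g i)%:R.

Definition region T g :=
  [/\ zrow g 0 <= l%:R * ln T, 0 < zrow g 1,
      forall j, (0 < j < m)%N -> zrow g j < zrow g j.+1,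
      zrow g m <= ln b & forall j, (0 < j <= m)%N -> ln (Rs j.+1) <= zrow g j].

Section Boxes.
Variable eps : R.
Hypothesis eps0 : 0 < eps.

Definition box_lo (k : 'cV[int]_l) (i : 'I_l) : R := expR (eps * (k i 0)%:~R).
Definition box_hi (k : 'cV[int]_l) (i : 'I_l) : R := expR (eps * (k i 0 + 1)%:~R).

Definition box_index T g : 'cV[int]_l := \col_i Num.floor ((ln (g i)%:R - ln T) / eps).

Lemma in_box_index T g k : 0 < T -> (forall i, (0 < g i)%N) ->
  in_box (box_lo k) (box_hi k) T g = (k == box_index T g).
Proof.
move=> T0 g0; have e0 := eps0.
have E i : (box_lo k i * T <= (g i)%:R < box_hi k i * T) = (Num.floor ((ln (g i)%:R - ln T) / eps) == k i 0).
  have gi : 0 < (g i)%:R :> R by rewrite ltr0n.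
  have aux (z : R) : expR (eps * z) * T = expR (eps * z + ln T) by rewrite expRD lnK.
  rewrite floor_eq ler_pdivlMr // ltr_pdivrMr // lerBrDr ltrBlDr /box_lo /box_hi !aux.
  by rewrite -{1 2}(lnK (x := (g i)%:R)) ?posrE // ler_expR ltr_expR ![eps * _]mulrC.
apply/forallP/eqP => [H|kE i].
  by apply/colP => i; rewrite mxE; apply/esym/eqP; rewrite -E.
by rewrite E kE mxE.
Qed.

Variables (X : finType) (xi : X -> 'cV[int]_l) (c : nat).
Hypothesis xi_le : forall x j, `|(xi x j 0)%:~R| <= c%:R :> R.
Hypothesis C_le : forall j, \sum_i `|(C j i)%:~R| <= c%:R :> R.

(** [ln T] enters row 0 only, the other rows of [C] having sum 0. The error consists of [c] steps
    for the coset representative and [c] for the fractional parts of the box coordinates weighted by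
    a row of [C]. *)
Lemma zrow_box T g x j : (j <= m)%N -> `|zrow g j - (j == 0)%N%:R * (l%:R * ln T) -
   eps * ((xi x + C *m box_index T g) (inord j) 0)%:~R| <= eps * (2 * c)%:R.
Proof.
move=> jm; have e0 := eps0; pose k := box_index T g.
pose th i : R := (ln (g i)%:R - ln T) / eps - (k i 0)%:~R.
have th1 i : `|th i| <= 1.
  have /andP[h1 h2] := floor_itv ((ln (g i)%:R - ln T) / eps).
  rewrite /th /k mxE ger0_norm ?subr_ge0 //; move: h2; rewrite intrD; lra.
have lnE i : ln (g i)%:R = ln T + eps * ((k i 0)%:~R + th i).
  by rewrite /th; field; lra.
have rowT : \sum_i (C (inord j) i)%:~R * ln T = (j == 0)%N%:R * (l%:R * ln T).
  rewrite -mulr_suml mulrA; congr (_ * _); case: eqVneq => [->|j0].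
    have -> : inord 0 = 0 :> 'I_l by apply: val_inj; rewrite /= inordK.
    by rewrite mul1r (eq_bigr (fun=> 1)) ?sumr_const ?card_ord // => i _; rewrite C0.
  rewrite mul0r -(rmorph_sum (intmul 1)) Cs //.
  by apply/eqP => /(congr1 val); rewrite /= inordK ?ltnS // => E; rewrite E in j0.
have -> : zrow g j - (j == 0)%N%:R * (l%:R * ln T) -
   eps * ((xi x + C *m k) (inord j) 0)%:~R =
   eps * (\sum_i (C (inord j) i)%:~R * th i - (xi x (inord j) 0)%:~R).
  have -> : ((xi x + C *m k) (inord j) 0)%:~R =
      (xi x (inord j) 0)%:~R + \sum_i (C (inord j) i)%:~R * (k i 0)%:~R :> R.
    by rewrite !mxE intrD (rmorph_sum (intmul 1)); congr (_ + _); apply: eq_bigr => i _; rewrite /= intrM ?mxE.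
  have -> : zrow g j = \sum_i (C (inord j) i)%:~R * ln T +
     eps * (\sum_i (C (inord j) i)%:~R * (k i 0)%:~R + \sum_i (C (inord j) i)%:~R * th i).
    rewrite -big_split mulr_sumr -big_split /=.
    by apply: eq_bigr => i _; rewrite lnE; ring.
  by rewrite rowT; ring.
rewrite normrM gtr0_norm // ler_pM2l // natrM.
apply: le_trans (ler_normB _ _) _; have -> : 2 * c%:R = c%:R + c%:R :> R by ring.
apply: lerD => //; apply: le_trans (ler_norm_sum _ _ _) _; apply: le_trans (C_le (inord j)).
by apply: ler_sum => i _; rewrite normrM ler_piMr.
Qed.

Hypothesis xi_coset : forall w, exists x k, w = xi x + C *m k /\
  forall x' k', w = xi x' + C *m k' -> x' = x /\ k' = k.

Definition coset_rep w : X := projT1 (cid (xi_coset w)).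
Definition coset_coord w : 'cV[int]_l := projT1 (cid (projT2 (cid (xi_coset w)))).

Lemma coset_decomp w : w = xi (coset_rep w) + C *m coset_coord w.
Proof. by rewrite /coset_rep /coset_coord; case: cid => x p /=; case: cid => k []. Qed.

Lemma coset_coordE x k : coset_rep (xi x + C *m k) = x /\ coset_coord (xi x + C *m k) = k.
Proof.
rewrite /coset_rep /coset_coord; case: cid => x0 p /=; case: cid => k0 [_ H] /=.
by have [-> ->] := H x k erefl.
Qed.

Variables (A : pred ('I_l -> nat)) (B : nat).
Hypothesis A_gt0 : forall g, A g -> forall i, (0 < g i)%N.

Definition box_card T w : nat :=
  box_count B A (box_lo (coset_coord w)) (box_hi (coset_coord w)) T.

Definition box_mem T (f : {ffun 'I_l -> 'I_B}) w : bool :=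
  A (fun i => f i) && (coset_coord w == box_index T (fun i => f i)).

Lemma sum_box_card T (s : seq 'cV[int]_l) : 0 < T ->
  (\sum_(w <- s) box_card T w = \sum_(f : {ffun 'I_l -> 'I_B}) \sum_(w <- s) box_mem T f w)%N.
Proof.
move=> T0; rewrite exchange_big /=; apply: eq_bigr => w _.
rewrite /box_card /box_count -sum1dep_card big_mkcond; apply: eq_bigr => f _ /=.
rewrite /box_mem; case Af: (A _) => //=; rewrite in_box_index //; exact: A_gt0.
Qed.

(** The points [w] whose box contains a given tuple are the [xi x + C *m k] with [k] its box index,
    one for each coset. Summing over [w] thus counts a tuple at most [#|X|] times, the origin of the
    factor [c_ell]. *)
Lemma lattice_sum_le T (P : pred ('I_l -> nat)) (s : seq 'cV[int]_l) : 0 < T -> uniq s ->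
  (forall g, A g -> forall w, w \in s -> coset_coord w = box_index T g -> P g) ->
  (\sum_(w <- s) box_card T w <= #|X| * #|[set f : {ffun 'I_l -> 'I_B} | A (fun i => f i) && P (fun i => f i)]|)%N.
Proof.
move=> T0 us sP.
rewrite mulnC -sum_nat_const [X in (_ <= X)%N]big_mkcond /= sum_box_card //.
apply: leq_sum => f _; rewrite inE.
have -> : (\sum_(w <- s) box_mem T f w = size [seq w <- s | box_mem T f w])%N.
  by rewrite size_filter -sum1_count [RHS]big_mkcond; apply: eq_bigr => w _; case: (box_mem T f w).
have [|] := boolP (A (fun i => f i) && P (fun i => f i)) => [_|].
  rewrite -(size_map coset_rep) cardE; apply: uniq_leq_size; last by move=> x _; rewrite mem_enum.
  rewrite map_inj_in_uniq ?filter_uniq // => w w'; rewrite !mem_filter.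
  move=> /andP[/andP[_ /eqP k1] _] /andP[/andP[_ /eqP k2] _] E.
  by rewrite (coset_decomp w) (coset_decomp w') E k1 k2.
rewrite negb_and leqn0 size_eq0 => H; apply/eqP; rewrite -(filter_pred0 s); apply: eq_in_filter => w ws.
apply/negP => /andP[Af /eqP E]; move: H; rewrite Af /= => /negP; apply; exact: (sP _ Af w).
Qed.

Lemma lattice_sum_ge T (P : pred ('I_l -> nat)) (s : seq 'cV[int]_l) : 0 < T -> uniq s ->
  (forall g, A g -> P g -> forall x, xi x + C *m box_index T g \in s) ->
  (#|X| * #|[set f : {ffun 'I_l -> 'I_B} | A (fun i => f i) && P (fun i => f i)]| <= \sum_(w <- s) box_card T w)%N.
Proof.
move=> T0 us sP.
rewrite mulnC -sum_nat_const big_mkcond /= sum_box_card //.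
apply: leq_sum => f _; rewrite inE; case: ifP => // /andP[Af Pf].
have -> : (\sum_(w <- s) box_mem T f w = size [seq w <- s | box_mem T f w])%N.
  by rewrite size_filter -sum1_count [RHS]big_mkcond; apply: eq_bigr => w _; case: (box_mem T f w).
pose h x := xi x + C *m box_index T (fun i => f i).
rewrite cardE -(size_map h); apply: uniq_leq_size.
  rewrite map_inj_uniq ?enum_uniq // => x y E.
  by rewrite -(coset_coordE x (box_index T (fun i => f i))).1 -/(h x) E (coset_coordE y _).1.
move=> w /mapP[x _ ->]; rewrite mem_filter (sP _ Af Pf) andbT /box_mem Af /=.
by rewrite (coset_coordE x _).2.
Qed.

(* Stretching a chain by the steps [t] absorbs the rounding errors of [zrow_box]. *)
Definition shifted_col (a t : int) (p : nat * seq nat) : 'cV[int]_l :=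
  \col_j if j == 0 then a - p.1%:Z else (nth 0%N p.2 j.-1)%:Z + (j : nat)%:Z * t.

Definition shifted_cols a t U (cs : seq (seq nat)) :=
  [seq shifted_col a t p | p <- [seq (u, c) | u <- iota 0 U, c <- cs]].

Lemma shifted_col0 a t p : shifted_col a t p (inord 0) 0 = a - p.1%:Z.
Proof. by rewrite mxE -val_eqE /= inordK. Qed.

Lemma shifted_colS a t p j : (j < m)%N ->
  shifted_col a t p (inord j.+1) 0 = (nth 0%N p.2 j)%:Z + j.+1%:Z * t.
Proof. by move=> jm; rewrite mxE -val_eqE /= inordK. Qed.

Lemma shifted_cols_uniq a t U pr s v : uniq (shifted_cols a t U (chains pr s m v)).
Proof.
rewrite map_inj_in_uniq.
  by apply: allpairs_uniq; rewrite ?iota_uniq ?uniq_chains // => -[? ?] [? ?] _ _ /= [-> ->].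
move=> p q /allpairsP[[u cs] [_ /mem_chains[s1 _ _ _] ->]] /allpairsP[[u' cs'] [_ /mem_chains[s2 _ _ _] ->]] /= E.
rewrite /= in s1 s2; congr (_, _).
  have := congr1 (fun M : 'cV[int]_l => M (inord 0) 0) E; rewrite /= !shifted_col0 /= => H.
  by apply/eqP; rewrite -eqz_nat; apply/eqP; lia.
apply: (@eq_from_nth _ 0%N); first by rewrite s1 s2.
move=> j; rewrite s1 => jm.
have := congr1 (fun M : 'cV[int]_l => M (inord j.+1) 0) E; rewrite /= !shifted_colS //= => H.
by apply/eqP; rewrite -eqz_nat; apply/eqP; lia.
Qed.

Let e := expR eps.
Lemma expR_natX w : expR (eps * w%:R) = e ^+ w.
Proof. exact: expRM_natr. Qed.

(** Two neighbouring rows are each uncertain by [2 * c] steps; one step more makes an inequality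
    strict and pays for the width of a cell at the thresholds. *)
Definition gap : nat := (2 * (2 * c)).+1%N.

(** Row 0 is lowered by its possible error, and the chain is spread by [gap] per place, so that even
    repeated entries give strictly increasing rows. *)
Lemma lower_region T g U v w :
  0 < T -> eps * (v + m * gap + 2 * c)%:R <= ln b ->
  w \in shifted_cols (- (2 * c)%:Z) gap%:Z U (chains (thr_upper Rs e) 1 m v) ->
  coset_coord w = box_index T g -> region T g.
Proof.
move=> T0 vb /mapP[_ /allpairsP[[u cs] [_ /mem_chains[sz pc dc /(_ m0) lc] ->]] wE] kE; rewrite /= in sz pc dc lc.
have e0 := eps0; have T1 := T0.
have zw j : (j <= m)%N -> `|zrow g j - (j == 0)%N%:R * (l%:R * ln T) - eps * (w (inord j) 0)%:~R| <= eps * (2 * c)%:R.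
  by move=> jm; rewrite (coset_decomp w) kE zrow_box.
have wS j : (j < m)%N -> (w (inord j.+1) 0)%:~R = (nth 0%N cs j)%:R + j.+1%:R * gap%:R :> R.
  by move=> jm; rewrite wE shifted_colS // intrD intrM.
have gE : gap%:R = 2 * (2 * c)%:R + 1 :> R by rewrite /gap -natr1 natrM.
have zS j : (j < m)%N -> `|zrow g j.+1 - eps * ((nth 0%N cs j)%:R + j.+1%:R * gap%:R)| <= eps * (2 * c)%:R.
  by move=> jm; have := zw j.+1 jm; rewrite mul0r subr0 wS.
have c0 : 0 <= (2 * c)%:R :> R by [].
have ec : 0 <= eps * (2 * c)%:R by rewrite mulr_ge0 // ltW.
split.
- have := zw 0%N isT; rewrite wE shifted_col0 /= mul1r ler_norml => /andP[_].
  have -> : (- (2 * c)%:Z - u%:Z)%:~R = - (2 * c)%:R - u%:R :> R by rewrite intrD !intrN.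
  have : 0 <= eps * u%:R by rewrite mulr_ge0 // ltW.
  rewrite !mulrBr; move: ec; rewrite mulrN; lra.
- have := zS 0%N m0; rewrite ler_norml => /andP[h _]; move: h.
  have : 0 <= eps * (nth 0%N cs 0)%:R by rewrite mulr_ge0 // ltW.
  rewrite gE; nra.
- move=> [//|j] /andP[_ jm].
  have := zS j (ltnW jm); have := zS j.+1 jm; rewrite !ler_norml => /andP[h1 _] /andP[_ h2].
  have := dc j jm; rewrite addn1 ltnS -(ler_nat R) => h3.
  have : eps * (nth 0%N cs j)%:R <= eps * (nth 0%N cs j.+1)%:R by rewrite ler_pM2l.
  move: h1 h2; rewrite -(natr1 j.+1) gE; nra.
- have := zS m.-1; rewrite prednK // => /(_ (leqnn _)); rewrite ler_norml => /andP[_ h].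
  have : (nth 0%N cs m.-1)%:R <= v%:R :> R by rewrite ler_nat -sz nth_last ltnW.
  move=> /(ler_wpM2l (ltW e0)); move: h vb; rewrite !natrD (natrM _ m); nra.
- move=> [//|j] /andP[_ jm].
  have := zS j jm; rewrite ler_norml => /andP[h _].
  have := pc j jm; rewrite /thr_upper -expR_natX => h1.
  have r1 : 1 <= Rs j.+2 by apply: Rs1.
  have : ln (Rs j.+2) <= eps * (nth 0%N cs j).+1%:R.
    by rewrite -ler_expR lnK ?posrE; [exact: ltW | lra].
  have j1 : 1 <= j.+1%:R :> R by rewrite ler1n.
  move: h; rewrite -(natr1 (nth _ _ _)) gE => h h2; apply: le_trans h2 _.
  have h3 : eps * (2 * (2 * c)%:R + 1) <= eps * (j.+1%:R * (2 * (2 * c)%:R + 1)).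
    by rewrite ler_pM2l // ler_peMl //; lra.
  nra.
Qed.

(** The opposite shifts: adding [gap] per place to the rows of [w] makes them a strict chain of
    naturals. Row 0 of [w] lies between [- (U + 2 * c)] and [2 * c], which gives the [U + 4 * c]
    layers. *)
Lemma upper_region T g U v : 0 < T -> ln b < eps * (v%:R - (m * gap + 2 * c)%:R) ->
  region T g -> l%:R * ln T - eps * U%:R <= zrow g 0 -> forall x,
  xi x + C *m box_index T g \in shifted_cols (2 * c)%:Z (- gap%:Z) (U + 4 * c).+1
    (chains (thr_lower Rs e) 0 m v).
Proof.
move=> T0 vb [z0 z1 zlt zb zr] zU x; have e0 := eps0.
set w := xi x + _.
have zw j : (j <= m)%N -> `|zrow g j - (j == 0)%N%:R * (l%:R * ln T) - eps * (w (inord j) 0)%:~R| <= eps * (2 * c)%:R.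
  exact: zrow_box.
have gE : gap%:R = 2 * (2 * c)%:R + 1 :> R by rewrite /gap -natr1 natrM.
have c0 : 0 <= (2 * c)%:R :> R by [].
have zS j : (j < m)%N -> `|zrow g j.+1 - eps * (w (inord j.+1) 0)%:~R| <= eps * (2 * c)%:R.
  by move=> jm; have := zw j.+1 jm; rewrite mul0r subr0.
pose u := absz ((2 * c)%N%:Z - w (inord 0) 0%R)%R.
have uE : w (inord 0) 0 = (2 * c)%:Z - u%:Z /\ (u < (U + 4 * c).+1)%N.
  have := zw 0%N isT; rewrite mul1r ler_norml => /andP[h1 h2].
  have H1 : (w (inord 0) 0)%:~R <= (2 * c)%:R :> R by rewrite -(ler_pM2l e0); lra.
  have H2 : - (U + 2 * c)%:R <= (w (inord 0) 0)%:~R :> R by rewrite -(ler_pM2l e0) natrD; lra.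
  have {}H1 : w (inord 0) 0 <= (2 * c)%:Z by rewrite -(ler_int R).
  have {}H2 : - (U + 2 * c)%:Z <= w (inord 0) 0 by rewrite -(ler_int R) intrN.
  by rewrite /u; clear -H1 H2; lia.
pose cc j := absz (w (inord j.+1) 0%R + j.+1%:Z * gap%:Z)%R.
have wge j : (j < m)%N -> ln (Rs j.+2) <= eps * ((w (inord j.+1) 0)%:~R + (2 * c)%:R).
  move=> jm; have := zS j jm; have := zr j.+1 jm; rewrite ler_norml => h /andP[_ h1]; lra.
have ccE j : (j < m)%N -> (cc j)%:Z = w (inord j.+1) 0 + j.+1%:Z * gap%:Z.
  move=> jm; apply/gez0_abs.
  have : 0 <= (w (inord j.+1) 0)%:~R + (2 * c)%:R :> R.
    by rewrite -(pmulr_rge0 _ e0); apply: le_trans (wge j jm); rewrite ln_ge0 // Rs1.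
  rewrite -[(2 * c)%:R]/((2 * c)%:Z%:~R) -intrD ler0z /gap => H; nia.
have ccR j : (j < m)%N -> (cc j)%:R = (w (inord j.+1) 0)%:~R + j.+1%:R * gap%:R :> R.
  by move=> jm; rewrite -[(cc j)%:R]/((cc j)%:Z%:~R) ccE // intrD intrM.
apply/mapP; exists (u, mkseq cc m); last first.
  apply/colP => j; rewrite -(inord_val j); case: j => -[|j] /= jm.
    by rewrite shifted_col0 uE.1.
  by rewrite shifted_colS //= nth_mkseq // ccE // mulrN addrK.
apply/allpairsP; exists (u, mkseq cc m); split => //; first by rewrite mem_iota uE.2.
apply/mem_chains; rewrite size_mkseq; split => //.
- move=> j jm; rewrite nth_mkseq // /thr_lower -expR_natX.
  have r1 : 1 <= Rs j.+2 by apply: Rs1.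
  rewrite -[leLHS]lnK ?posrE ?ler_expR; last by lra.
  apply: le_trans (wge j jm) _; rewrite ler_pM2l // ccR // lerD2l.
  have j1 : 1 <= j.+1%:R :> R by rewrite ler1n.
  rewrite gE; nra.
- move=> j jm; rewrite !nth_mkseq ?(ltnW jm) // addn0 -(ltr_nat R) !ccR ?(ltnW jm) //.
  have := zS j (ltnW jm); have := zS j.+1 jm; rewrite !ler_norml => /andP[_ h1] /andP[h2 _].
  have := zlt j.+1 jm => h3; rewrite -(ltr_pM2l e0) !mulrDr.
  rewrite -(natr1 j.+1) gE; nra.
- move=> _; rewrite -nth_last size_mkseq nth_mkseq ?prednK // -(ltr_nat R) ccR ?prednK //.
  have := zS m.-1; rewrite prednK // => /(_ (leqnn _)); rewrite ler_norml => /andP[h _].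
  rewrite -(ltr_pM2l e0); move: vb; rewrite natrD natrM; lra.
Qed.

Definition region_card T : nat :=
  #|[set f : {ffun 'I_l -> 'I_B} | A (fun i => f i) && `[< region T (fun i => f i) >]]|.

Lemma lower_count T U v : 0 < T -> eps * (v + m * gap + 2 * c)%:R <= ln b ->
  (\sum_(w <- shifted_cols (- (2 * c)%:Z) gap%:Z U (chains (thr_upper Rs e) 1 m v)) box_card T w
   <= #|X| * region_card T)%N.
Proof.
move=> T0 vb; apply: (lattice_sum_le (P := fun g => `[< region T g >])) => //.
  exact: shifted_cols_uniq.
by move=> g _ w ws E; apply/asboolP; exact: (lower_region T0 vb ws E).
Qed.

Definition tail_card T U : nat :=
  #|[set f : {ffun 'I_l -> 'I_B} | A (fun i => f i) && `[< region T (fun i => f i) /\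
     zrow (fun i => f i) 0 <= l%:R * ln T - eps * U%:R >]]|.

Lemma upper_count T U v : 0 < T -> ln b < eps * (v%:R - (m * gap + 2 * c)%:R) ->
  (#|X| * region_card T <= \sum_(w <- shifted_cols (2 * c)%:Z (- gap%:Z) (U + 4 * c).+1
    (chains (thr_lower Rs e) 0 m v)) box_card T w + #|X| * tail_card T U)%N.
Proof.
move=> T0 vb.
pose S := [set f : {ffun 'I_l -> 'I_B} | A (fun i => f i) &&
   `[< region T (fun i => f i) /\ l%:R * ln T - eps * U%:R <= zrow (fun i => f i) 0 >]].
have H : (region_card T <= #|S| + tail_card T U)%N.
  apply: leq_trans (leq_card_setU _ _).
  apply: subset_leq_card; apply/fintype.subsetP => f; rewrite !inE => /andP[-> /asboolP rf] /=.
  have [h|h] := leP (l%:R * ln T - eps * U%:R) (zrow (fun i => f i) 0).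
    by apply/orP; left; apply/asboolP.
  by apply/orP; right; apply/asboolP; split => //; exact: ltW.
apply: leq_trans (leq_mul (leqnn #|X|) H) _; rewrite mulnDr leq_add2r.
apply: (lattice_sum_ge (P := fun g => `[< region T g /\ l%:R * ln T - eps * U%:R <= zrow g 0 >])) => //.
  exact: shifted_cols_uniq.
by move=> g _ /asboolP[rg zg] x; exact: upper_region.
Qed.

Definition box_vol w : R := \prod_i (box_hi (coset_coord w) i - box_lo (coset_coord w) i).

(** The exponents of the sides add up to row 0 of [C *m k], since that row of [C] is all ones. *)
Lemma box_volE w : box_vol w = expR (eps * (w 0 0 - xi (coset_rep w) 0 0)%:~R) * (e - 1) ^+ l.
Proof.
rewrite {2}(coset_decomp w) mxE [X in _ * X%:~R]addrAC subrr add0r mxE.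
rewrite (eq_bigr (fun i => coset_coord w i 0)); last by move=> i _; rewrite C0 mul1r.
have <- : \prod_(i < l) (e - 1) = (e - 1) ^+ l by rewrite prodr_const card_ord.
rewrite (rmorph_sum (intmul 1)) mulr_sumr expR_sum -big_split.
apply: eq_bigr => i _ /=; rewrite /box_hi /box_lo intrD mulrDr mulr1 expRD mulrBr mulr1 //.
Qed.

Lemma box_vol_shifted a t p :
  expR (eps * (a%:~R - p.1%:R - c%:R)) * (e - 1) ^+ l <= box_vol (shifted_col a t p) <=
  expR (eps * (a%:~R - p.1%:R + c%:R)) * (e - 1) ^+ l.
Proof.
set w := shifted_col _ _ _; have e0 := eps0; have e1 : 0 < (e - 1) ^+ l by rewrite exprn_gt0 // subr_gt0 expR_gt1.
rewrite box_volE !ler_pM2r // !ler_expR !ler_pM2l // intrD intrN.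
have -> : w 0 0 = a - p.1%:Z by rewrite mxE eqxx.
rewrite intrD intrN; have := xi_le (coset_rep w) 0; rewrite ler_norml => /andP[h1 h2].
by apply/andP; split; rewrite -[(p.1)%:~R]/(p.1%:R : R); lra.
Qed.

Lemma sum_shifted_cols a t U (cs : seq (seq nat)) (F : 'cV[int]_l -> R) :
  \sum_(w <- shifted_cols a t U cs) F w = \sum_(u < U) \sum_(d <- cs) F (shifted_col a t (u : nat, d)).
Proof.
by rewrite big_map big_allpairs -(big_mkord xpredT (fun u => \sum_(d <- cs) F (shifted_col a t (u, d)))) /index_iota subn0.
Qed.

Lemma geometric_expR U : (e - 1) * \sum_(u < U) expR (- (eps * u%:R)) = e * (1 - expR (- (eps * U%:R))).
Proof.
elim: U => [|U IH]; first by rewrite big_ord0 mulr0 mulr0 oppr0 expR0 subrr mulr0.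
have ee : e * expR (- eps) = 1 by rewrite /e -expRD subrr expR0.
have -> : expR (- (eps * U.+1%:R)) = expR (- (eps * U%:R)) * expR (- eps).
  by rewrite -expRD -natr1; congr expR; ring.
by rewrite big_ord_recr /= mulrDr IH; ring: ee.
Qed.

(** Bounded below by a function of the layer [u] alone, the volumes sum to a geometric series times
    the number of chains. The [3 * c] is the [2 * c] by which row 0 is lowered plus the [c] of the
    coset representative. *)
Lemma lower_vol U v :
  expR (- (eps * (3 * c)%:R)) * (1 - expR (- (eps * U%:R))) * inner_int Rs m (e ^+ v) <=
  \sum_(w <- shifted_cols (- (2 * c)%:Z) gap%:Z U (chains (thr_upper Rs e) 1 m v)) box_vol w.
Proof.
have e0 := eps0; have e1 : 1 < e by rewrite expR_gt1.
have em : 0 < e - 1 by lra.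
set cs := chains _ _ _ _.
rewrite sum_shifted_cols; apply: (@le_trans _ _ (\sum_(u < U) \sum_(d <- cs)
    expR (- (eps * (3 * c)%:R)) * expR (- (eps * u%:R)) * (e - 1) ^+ l)); last first.
  apply: ler_sum => u _; apply: ler_sum => d _.
  have /andP[h _] := box_vol_shifted (- (2 * c)%:Z) gap%:Z (u : nat, d); apply: le_trans h.
  rewrite ler_pM2r ?exprn_gt0 // -expRD ler_expR intrN -[(2 * c)%:~R]/((2 * c)%:R : R) /= !natrM.
  by rewrite le_eqVlt; apply/orP; left; apply/eqP; ring.
rewrite (eq_bigr (fun u : 'I_U => expR (- (eps * u%:R)) * (expR (- (eps * (3 * c)%:R)) * (e - 1) ^+ l * (size cs)%:R))); last first.
  by move=> u _; rewrite big_const_seq count_predT iter_addr_0 -mulr_natr; ring.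
rewrite -mulr_suml exprS.
have -> : (\sum_(u < U) expR (- (eps * u%:R))) * (expR (- (eps * (3 * c)%:R)) * ((e - 1) * (e - 1) ^+ m) * (size cs)%:R)
  = expR (- (eps * (3 * c)%:R)) * (((e - 1) * (\sum_(u < U) expR (- (eps * u%:R)))) * ((e - 1) ^+ m * (size cs)%:R)) by ring.
rewrite geometric_expR -mulrA ler_pM2l ?expR_gt0 //.
have U1 : 0 <= 1 - expR (- (eps * U%:R)) by rewrite subr_ge0 -expR0 ler_expR oppr_le0 mulr_ge0 // ltW.
apply: ler_pM => //; first exact: inner_int_ge0.
  by rewrite ler_peMl // ltW.
exact: chains_upper.
Qed.

(** The [l] extra steps are [e ^+ m], from [(e - 1) ^+ m = e ^+ m * (1 - e^-1) ^+ m], and one more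
    [e] from the geometric series. *)
Lemma upper_vol U v :
  \sum_(w <- shifted_cols (2 * c)%:Z (- gap%:Z) U (chains (thr_lower Rs e) 0 m v)) box_vol w <=
  expR (eps * (3 * c + l)%:R) * inner_int Rs m (e ^+ v).
Proof.
have e0 := eps0; have e1 : 1 < e by rewrite expR_gt1.
have em : 0 < e - 1 by lra.
set cs := chains _ _ _ _.
rewrite sum_shifted_cols; apply: (@le_trans _ _ (\sum_(u < U) \sum_(d <- cs)
    expR (eps * (3 * c)%:R) * expR (- (eps * u%:R)) * (e - 1) ^+ l)).
  apply: ler_sum => u _; apply: ler_sum => d _.
  have /andP[_ h] := box_vol_shifted (2 * c)%:Z (- gap%:Z) (u : nat, d); apply: (le_trans h).
  rewrite ler_pM2r ?exprn_gt0 // -expRD ler_expR -[(2 * c)%:~R]/((2 * c)%:R : R) /= !natrM.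
  by rewrite le_eqVlt; apply/orP; left; apply/eqP; ring.
rewrite (eq_bigr (fun u : 'I_U => expR (- (eps * u%:R)) * (expR (eps * (3 * c)%:R) * (e - 1) ^+ l * (size cs)%:R))); last first.
  by move=> u _; rewrite big_const_seq count_predT iter_addr_0 -mulr_natr; ring.
rewrite -mulr_suml exprS.
have -> : (\sum_(u < U) expR (- (eps * u%:R))) * (expR (eps * (3 * c)%:R) * ((e - 1) * (e - 1) ^+ m) * (size cs)%:R)
  = expR (eps * (3 * c)%:R) * (((e - 1) * (\sum_(u < U) expR (- (eps * u%:R)))) * ((e - 1) ^+ m * (size cs)%:R)) by ring.
have -> : expR (eps * (3 * c + l)%:R) = expR (eps * (3 * c)%:R) * (e * e ^+ m).
  by rewrite natrD mulrDr expRD (expR_natX l) exprS.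
rewrite geometric_expR -!mulrA ler_pM2l ?expR_gt0 //.
have ge := expR_gt0 (- (eps * U%:R)).
rewrite ler_pM2l; last by lra.
have -> : (e - 1) ^+ m = e ^+ m * (1 - e^-1) ^+ m.
  by rewrite -exprMn; congr (_ ^+ _); field; apply/eqP; lra.
rewrite -mulrA; have H := chains_lower Rs1 e1 m v.
apply: (@le_trans _ _ (1 * (e ^+ m * inner_int Rs m (e ^+ v)))); last by rewrite mul1r.
apply: ler_pM; last by rewrite ler_pM2l ?exprn_gt0 //; lra.
- by rewrite subr_ge0 -expR0 ler_expR oppr_le0 mulr_ge0 // ltW.
- rewrite mulr_ge0 ?exprn_ge0 //; first by lra.
  by rewrite mulr_ge0 // exprn_ge0 // subr_ge0 invf_le1; lra.
- by lra.
Qed.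

End Boxes.

Hypothesis detC : \det C != 0.

(** On the region the rows after the first lie between 0 and [ln b]; inverting [C] bounds the
    deviation of each [ln (g i)] from the mean [zrow g 0 / l]. *)
Lemma region_coord_le : exists2 K : R, 0 <= K & forall T g, region T g ->
  forall i, ln (g i)%:R <= zrow g 0 / l%:R + K.
Proof.
pose Cr : 'M[R]_l := map_mx intr C.
have uCr : Cr \in unitmx by rewrite unitmxE unitfE det_map_mx intr_eq0.
exists (\sum_i \sum_j `|invmx Cr i j| * ln b).
  by apply: sumr_ge0 => i _; apply: sumr_ge0 => j _; rewrite mulr_ge0 // ln_ge0.
move=> T g [z0 z1 zlt zb zr] i.
have zpos j : (0 < j <= m)%N -> 0 <= zrow g j.
  move=> jm; apply: le_trans (zr j jm); rewrite ln_ge0 // Rs1 //; lia.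
have zle k : (k < m)%N -> zrow g (m - k) <= ln b.
  elim: k => [|k IH] km; first by rewrite subn0.
  apply: le_trans (IH (ltnW km)); apply: ltW.
  have -> : (m - k = (m - k.+1).+1)%N by lia.
  by apply: zlt; lia.
have zle' j : (0 < j <= m)%N -> `|zrow g j| <= ln b.
  move=> jm; rewrite ger0_norm ?zpos //.
  have E : (m - (m - j) = j)%N by lia.
  by rewrite -E; apply: zle; lia.
have zE j : \sum_k Cr j k * ln (g k)%:R = zrow g j.
  by apply: eq_bigr => k _; rewrite mxE inord_val.
pose y : 'cV[R]_l := \col_k (ln (g k)%:R - zrow g 0 / l%:R).
have l0 : l%:R != 0 :> R by rewrite pnatr_eq0.
have yE j : (Cr *m y) j 0 = if j == 0 then 0 else zrow g j.
  rewrite mxE (eq_bigr (fun k => Cr j k * ln (g k)%:R - Cr j k * (zrow g 0 / l%:R))); last first.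
    by move=> k _; rewrite [y _ _]mxE mulrBr.
  rewrite big_split /= sumrN -mulr_suml zE.
  case: eqVneq => [->|j0].
    rewrite (eq_bigr (fun=> 1)) => [|k _]; last by rewrite mxE C0.
    by rewrite sumr_const card_ord; field.
  rewrite (eq_bigr (fun k => (C j k)%:~R)) => [|k _]; last by rewrite mxE.
  by rewrite -(rmorph_sum (intmul 1)) Cs // mul0r subr0.
have : y i 0 <= \sum_i \sum_j `|invmx Cr i j| * ln b.
  rewrite -{1}(mulKmx uCr y) mxE.
  apply: (@le_trans _ _ (\sum_j `|invmx Cr i j| * ln b)); last first.
    rewrite [leRHS](bigD1 i) //= lerDl.
    by apply: sumr_ge0 => k _; apply: sumr_ge0 => j _; rewrite mulr_ge0 // ln_ge0.
  apply: ler_sum => j _; apply: le_trans (ler_norm _) _; rewrite normrM.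
  rewrite ler_wpM2l // yE; case: eqVneq => [_|j0]; first by rewrite normr0 ln_ge0.
  apply: zle'; rewrite lt0n; apply/andP; split; last by rewrite -ltnS.
  by apply: contra j0 => /eqP E; apply/eqP/val_inj.
by rewrite mxE lerBlDl.
Qed.

(** A small product keeps every component below [x], so the tuples lie in a cube with at most
    [x ^+ l] points; the [+ 1] makes the inequality strict. [K] does not depend on [eps], which
    allows [eps] to be chosen in terms of it. *)
Lemma tail_bound (A : pred ('I_l -> nat)) : (forall g, A g -> forall i, (0 < g i)%N) ->
  exists2 K : R, 0 <= K & forall eps (B : nat) T U, 0 < T ->
  (tail_card eps A B T U)%:R <= K * T ^+ l * expR (- (eps * U%:R)).
Proof.
move=> A0; have [K K0 HK] := region_coord_le; exists (expR (K + 1) ^+ l); first by rewrite exprn_ge0 // expR_ge0.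
move=> eps B T U T0; pose x := expR (ln T - eps * U%:R / l%:R + (K + 1)).
have l0 : 0 < l%:R :> R by rewrite ltr0n.
have -> : expR (K + 1) ^+ l * T ^+ l * expR (- (eps * U%:R)) = x ^+ l.
  rewrite -{1}(lnK (x := T)) ?posrE // -!expRM_natr -!expRD; congr expR; field.
  by rewrite gt_eqF.
apply: (@le_trans _ _ (\prod_(i < l) (x / 1%:R))); last by rewrite prodr_const card_ord divr1.
apply: (@le_trans _ _ (\prod_(i < l) (#|[set k : 'I_B | (0 < k)%N && (k%:R < x) && (1 %| k)%N]|)%:R)); last first.
  by apply: ler_prod => i _; rewrite ler0n count_dvd_le // expR_ge0.
rewrite -natr_prod ler_nat -(@card_ffun_forall l B (fun _ k => (0 < k)%N && (k%:R < x) && (1 %| k)%N)).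
apply: subset_leq_card; apply/fintype.subsetP => f; rewrite !inE => /andP[Af /asboolP[rf zf]].
apply/forallP => i; rewrite dvd1n (A0 _ Af) /= andbT.
have fi : 0 < (f i)%:R :> R by rewrite ltr0n (A0 _ Af i).
rewrite -(lnK (x := (f i)%:R)) ?posrE // ltr_expR; apply: le_lt_trans (HK _ _ rf i) _.
have : zrow (fun i => f i) 0 / l%:R <= ln T - eps * U%:R / l%:R.
  by rewrite ler_pdivrMr // mulrBl divfK ?gt_eqF // [_ * l%:R]mulrC.
by move=> h; apply: le_lt_trans (lerD h (lexx K)) _; rewrite addrA ltrDl.
Qed.

Section Limit.
Variables (X : finType) (xi : X -> 'cV[int]_l) (c : nat).
Hypothesis xi_le : forall x j, `|(xi x j 0)%:~R| <= c%:R :> R.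
Hypothesis C_le : forall j, \sum_i `|(C j i)%:~R| <= c%:R :> R.
Hypothesis xi_coset : forall w, exists x k, w = xi x + C *m k /\
  forall x' k', w = xi x' + C *m k' -> x' = x /\ k' = k.
Variables (A : pred ('I_l -> nat)) (B : R -> nat) (delta : R).
Hypothesis A_gt0 : forall g, A g -> forall i, (0 < g i)%N.
Hypothesis delta0 : 0 <= delta.
Hypothesis A_box : forall lo hi : 'I_l -> R, (forall i, 0 <= lo i) -> (forall i, lo i <= hi i) ->
  tends (fun T => (box_count (B T) A lo hi T)%:R / T ^+ l) (delta * \prod_i (hi i - lo i)).

Lemma tends_box_sum eps (s : seq 'cV[int]_l) : 0 < eps ->
  tends (fun T => (\sum_(w <- s) box_card eps xi_coset A (B T) T w)%:R / T ^+ l)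
    (delta * \sum_(w <- s) box_vol eps xi_coset w).
Proof.
move=> e0; apply: (@tends_ext _ (fun T => \sum_(w <- s) (box_card eps xi_coset A (B T) T w)%:R / T ^+ l) _ _ 0).
  by move=> T _; rewrite natr_sum mulr_suml.
rewrite mulr_sumr; apply: tends_sum => w _; apply: A_box => i; first exact: expR_ge0.
by rewrite ler_expR ler_pM2l // intrD lerDl.
Qed.

Let N T := region_card A (B T) T.
Let shift := (m * gap c + 2 * c).+1%N.

Lemma region_card_lower eps U e' : 0 < eps -> 0 < e' -> exists T0, forall T, T0 <= T ->
  delta * (expR (- (eps * (3 * c)%:R)) * (1 - expR (- (eps * U%:R))) *
     inner_int Rs m (b * expR (- (eps * shift%:R)))) - e' <= #|X|%:R * ((N T)%:R / T ^+ l).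
Proof.
move=> e0 e'0; have lb0 : 0 <= ln b by rewrite ln_ge0.
have U1 : 0 <= 1 - expR (- (eps * U%:R)) by rewrite subr_ge0 -expR0 ler_expR oppr_le0 mulr_ge0 // ltW.
have NT0 T : 0 < T -> 0 <= #|X|%:R * ((N T)%:R / T ^+ l).
  by move=> T0; rewrite mulr_ge0 // divr_ge0 // exprn_ge0 // ltW.
have b1' := b1; have bE t : b * expR t = expR (ln b + t) by rewrite expRD lnK ?posrE //; lra.
pose y := ln b / eps - (m * gap c + 2 * c)%:R.
(* If [b] leaves no room for the shifts, the reduced upper limit is at most 1 and the iterated
   integral is 0. *)
have [y0|y0] := ltP y 0.
  exists 1 => T T1; apply: (@le_trans _ _ 0); last by apply: NT0; lra.
  suff -> : inner_int Rs m (b * expR (- (eps * shift%:R))) = 0 by rewrite !mulr0; lra.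
  have [k Ek] : exists k, m = k.+1 by exists m.-1; rewrite prednK.
  rewrite [in inner_int _ m]Ek; apply: inner_int_eq0; apply: le_trans (@Rs1 k.+2 isT).
  rewrite bE -[leRHS]expR0 ler_expR; move: y0; rewrite /y subr_lt0 ltr_pdivrMr // => h.
  rewrite -natr1 mulrDr; lra.
pose v := Num.truncn y.
have /andP[v1 v2] : v%:R <= y < v.+1%:R by apply: truncn_itv.
have vb : eps * (v + m * gap c + 2 * c)%:R <= ln b.
  move: v1; rewrite /y lerBrDr ler_pdivlMr // mulrC -natrD; by rewrite addnA.
have [T0 HT] := @tends_box_sum eps (shifted_cols (- (2 * c)%:Z) (gap c)%:Z U (chains (thr_upper Rs (expR eps)) 1 m v)) e0 _ e'0.
exists (Num.max T0 1) => T; rewrite ge_max => /andP[/HT {}HT T1].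
have Tp : 0 < T by lra.
have := lower_count e0 xi_le C_le xi_coset (B T) A_gt0 U Tp vb.
rewrite -(ler_nat R) natrM => H.
have {}H := ler_wpM2r (_ : 0 <= (T ^+ l)^-1) H; rewrite -mulrA in H.
apply: le_trans (H _); last by rewrite invr_ge0 exprn_ge0 // ltW.
move: HT; rewrite ler_norml => /andP[HT _].
have := lower_vol e0 xi_le xi_coset U v.
move=> /(ler_wpM2l delta0) V.
suff G : inner_int Rs m (b * expR (- (eps * shift%:R))) <= inner_int Rs m (expR eps ^+ v).
  have {}G : delta * (expR (- (eps * (3 * c)%:R)) * (1 - expR (- (eps * U%:R))) *
     inner_int Rs m (b * expR (- (eps * shift%:R)))) <= delta * (expR (- (eps * (3 * c)%:R)) * (1 - expR (- (eps * U%:R))) *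
     inner_int Rs m (expR eps ^+ v)).
    by rewrite ler_wpM2l // ler_wpM2l // mulr_ge0 ?expR_ge0.
  lra.
apply: (inner_int_homo Rs1); rewrite -expRM_natr bE ler_expR.
have : eps * y < eps * v.+1%:R by rewrite ltr_pM2l.
have -> : eps * y = ln b - eps * (m * gap c + 2 * c)%:R by rewrite /y; field; lra.
rewrite -!natr1; lra.
Qed.

Lemma region_card_upper K eps U e' : 0 < eps -> 0 < e' ->
  (forall (B : nat) T U, 0 < T -> (tail_card eps A B T U)%:R <= K * T ^+ l * expR (- (eps * U%:R))) ->
  exists T0, forall T, T0 <= T ->
  #|X|%:R * ((N T)%:R / T ^+ l) <= delta * (expR (eps * (3 * c + l)%:R) *
     inner_int Rs m (b * expR (eps * shift%:R))) + #|X|%:R * (K * expR (- (eps * U%:R))) + e'.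
Proof.
move=> e0 e'0 HK; have lb0 : 0 <= ln b by rewrite ln_ge0.
have b1' := b1; have bE t : b * expR t = expR (ln b + t) by rewrite expRD lnK ?posrE //; lra.
pose y := ln b / eps + (m * gap c + 2 * c)%:R.
have y0 : 0 <= y by rewrite addr_ge0 // divr_ge0 // ltW.
pose v := (Num.truncn y).+1.
have /andP[v1 v2] : (Num.truncn y)%:R <= y < v%:R by apply: truncn_itv.
have vb : ln b < eps * (v%:R - (m * gap c + 2 * c)%:R).
  by rewrite mulrC -ltr_pdivrMr // ltrBrDr.
have [T0 HT] := @tends_box_sum eps (shifted_cols (2 * c)%:Z (- (gap c)%:Z) (U + 4 * c).+1 (chains (thr_lower Rs (expR eps)) 0 m v)) e0 _ e'0.
exists (Num.max T0 1) => T; rewrite ge_max => /andP[/HT {}HT T1].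
have Tp : 0 < T by lra.
have Tl : 0 < T ^+ l by rewrite exprn_gt0.
have := upper_count e0 xi_le C_le xi_coset (B T) A_gt0 U Tp vb.
rewrite -(ler_nat R) natrD !natrM => H.
have {}H := ler_wpM2r (_ : 0 <= (T ^+ l)^-1) H; rewrite -mulrA in H.
apply: le_trans (H _) _; first by rewrite invr_ge0 ltW.
move: HT; rewrite ler_norml => /andP[_ HT].
have V := ler_wpM2l delta0 (upper_vol e0 xi_le xi_coset (U + 4 * c).+1 v).
have tl : #|X|%:R * (tail_card eps A (B T) T U)%:R / T ^+ l <= #|X|%:R * (K * expR (- (eps * U%:R))).
  rewrite -mulrA ler_wpM2l // ler_pdivrMr // mulrAC; exact: HK.
have G : inner_int Rs m (expR eps ^+ v) <= inner_int Rs m (b * expR (eps * shift%:R)).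
  apply: (inner_int_homo Rs1); rewrite -expRM_natr bE ler_expR.
  have : eps * (Num.truncn y)%:R <= eps * y by rewrite ler_pM2l.
  have -> : eps * y = ln b + eps * (m * gap c + 2 * c)%:R by rewrite /y; field; lra.
  rewrite -!natr1; lra.
have {}G : delta * (expR (eps * (3 * c + l)%:R) * inner_int Rs m (expR eps ^+ v)) <=
   delta * (expR (eps * (3 * c + l)%:R) * inner_int Rs m (b * expR (eps * shift%:R))).
  by rewrite ler_wpM2l // ler_wpM2l // expR_ge0.
rewrite mulrDl; lra.
Qed.

Let G := inner_int Rs m.

Lemma lower_continuous : {for (0 : R), continuous (fun eps : R =>
  expR (- (eps * (3 * c)%:R)) * (1 - eps) * G (b * expR (- (eps * shift%:R))))}.
Proof.
have lin (k : nat) : continuous (fun eps : R => - (eps * k%:R)).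
  by move=> x; apply: cvgN; apply: cvgM; [exact: cvg_id | exact: cvg_cst].
have ce (k : nat) : continuous (fun eps : R => expR (- (eps * k%:R))).
  by move=> x; apply: (@continuous_comp _ _ _ (fun eps : R => - (eps * k%:R)) expR); [exact: lin | exact: continuous_expR].
apply: cvgM; first apply: cvgM.
- exact: ce.
- by apply: cvgB; [exact: cvg_cst | exact: cvg_id].
- apply: (@continuous_comp _ _ _ (fun eps : R => b * expR (- (eps * shift%:R))) G).
    by apply: cvgM; [exact: cvg_cst | exact: ce].
  exact: inner_int_continuous.
Qed.

Lemma upper_continuous : {for (0 : R), continuous (fun eps : R =>
  expR (eps * (3 * c + l)%:R) * G (b * expR (eps * shift%:R)))}.
Proof.
have ce (k : nat) : continuous (fun eps : R => expR (eps * k%:R)).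
  move=> x; apply: (@continuous_comp _ _ _ (fun eps : R => eps * k%:R) expR); last exact: continuous_expR.
  by apply: cvgM; [exact: cvg_id | exact: cvg_cst].
apply: cvgM; first exact: ce.
apply: (@continuous_comp _ _ _ (fun eps : R => b * expR (eps * shift%:R)) G).
  by apply: cvgM; [exact: cvg_cst | exact: ce].
exact: inner_int_continuous.
Qed.

Lemma continuous_at0_small (f : R -> R) e : {for (0 : R), continuous f} -> 0 < e ->
  exists2 d, 0 < d & forall x, 0 < x -> x < d -> `|f 0 - f x| <= e.
Proof.
move=> /cvgrPdist_le /(_ e) H e0; have [d /= d0 Hd] := H e0; exists d => // x x0 xd.
by apply: Hd; rewrite /ball /= sub0r normrN gtr0_norm.
Qed.

Lemma tends_region_card : (0 < #|X|)%N -> tends (fun T => (N T)%:R / T ^+ l) (delta / #|X|%:R * G b).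
Proof.
move=> X0 e e0; pose D : R := #|X|%:R; have D0 : 0 < D by rewrite ltr0n.
have [K K0 HK] := tail_bound A_gt0.
pose e3 := D * e / 3; have e30 : 0 < e3 by rewrite divr_gt0 // mulr_gt0.
pose e4 := e3 / (delta + 1); have e40 : 0 < e4 by rewrite divr_gt0 // ltr_wpDl.
have [d1 d10 H1] := continuous_at0_small lower_continuous e40.
have [d2 d20 H2] := continuous_at0_small upper_continuous e40.
pose d3 := e3 / (D * K + 1); have d30 : 0 < d3 by rewrite divr_gt0 // ltr_wpDl // mulr_ge0 // ltW.
pose eps := Num.min (Num.min d1 d2) (Num.min d3 1) / 2.
have m0' : 0 < Num.min (Num.min d1 d2) (Num.min d3 1) by rewrite !lt_min d10 d20 d30 ltr01.
have eps0 : 0 < eps by rewrite divr_gt0.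
have : eps < Num.min (Num.min d1 d2) (Num.min d3 1) by rewrite /eps; lra.
rewrite !lt_min => /andP[/andP[{}/H1 H1 {}/H2 H2] /andP[ed3 e1]].
have {}H1 := H1 eps0; have {}H2 := H2 eps0.
(* Large enough for [expR (- (eps * U))] to be at most [eps], so that all the errors are controlled
   by [eps]. *)
pose U := (Num.truncn (- ln eps / eps)).+1.
have eU : expR (- (eps * U%:R)) <= eps.
  rewrite -[leRHS]lnK ?posrE // ler_expR lerNl mulrC -ler_pdivrMr //; apply: ltW.
  exact: truncnS_gt.
have [T1 L1] := region_card_lower U eps0 e30.
have [T2 L2] := region_card_upper U eps0 e30 (HK eps).
exists (Num.max T1 T2) => T; rewrite ge_max => /andP[/L1 {}L1 /L2 {}L2].
move: H1 H2; rewrite !mul0r !oppr0 expR0 !mulr1 addr0 !mul1r -/D.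
move: L1 L2; rewrite -/D -/G; move: ((N T)%:R / T ^+ l) => z.
have -> : z - delta / D * G b = (D * z - delta * G b) / D by field; rewrite gt_eqF.
rewrite normrM normfV (gtr0_norm D0) ler_pdivrMr //.
have Gx := inner_int_ge0 Rs1 m (b * expR (- (eps * shift%:R))); rewrite -/G in Gx.
set g1 := G (b * expR (- _)) in Gx *; set g2 := G (b * expR _).
set x1 := expR (- (eps * (3 * c)%:R)); set x2 := expR (eps * _).
have x10 : 0 < x1 by exact: expR_gt0.
have e4E : delta * e4 <= e3.
  rewrite /e4 mulrA ler_pdivrMr; last by rewrite ltr_wpDl.
  by rewrite mulrDr mulr1 mulrC lerDl ltW.
have DK : D * (K * expR (- (eps * U%:R))) <= e3.
  apply: (@le_trans _ _ (D * K * d3)).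
    by rewrite mulrA ler_wpM2l ?mulr_ge0 ?(ltW D0) //; apply: le_trans eU (ltW ed3).
  rewrite /d3 mulrA ler_pdivrMr ?ltr_wpDl ?mulr_ge0 ?(ltW D0) //.
  by rewrite mulrDr mulr1 mulrC lerDl ltW.
have g1U : delta * (x1 * (1 - eps) * g1) <= delta * (x1 * (1 - expR (- (eps * U%:R))) * g1).
  by rewrite ler_wpM2l // ler_wpM2r // ler_pM2l // lerD2l lerN2.
move=> L1 L2; rewrite !ler_norml => /andP[a1 a2] /andP[a3 a4].
have a2' : delta * (G b - x1 * (1 - eps) * g1) <= delta * e4 by rewrite ler_wpM2l.
have a3' : delta * (- e4) <= delta * (G b - x2 * g2) by rewrite ler_wpM2l.
have e3E : e * D = e3 + e3 + e3 by rewrite /e3; field.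
move: a2' a3'; rewrite !mulrBr mulrN => a2' a3'; apply/andP; rewrite e3E; split; lra.
Qed.

End Limit.

Lemma region_asymptotics (A : pred ('I_l -> nat)) (B : R -> nat) (delta : R) : 0 <= delta ->
  (forall g, A g -> forall i, (0 < g i)%N) ->
  (forall lo hi : 'I_l -> R, (forall i, 0 <= lo i) -> (forall i, lo i <= hi i) ->
    tends (fun T => (box_count (B T) A lo hi T)%:R / T ^+ l) (delta * \prod_i (hi i - lo i))) ->
  tends (fun T => (region_card A (B T) T)%:R / T ^+ l) (delta / `|\det C|%:~R * inner_int Rs m b).
Proof.
move=> d0 A0 Abox; have [X [xi [cX xiC]]] := lattice_cosets detC.
pose c := (\sum_x \sum_j `|xi x j 0%R| + \sum_j \sum_i `|C j i|)%N.
have abs (z : int) : `|z%:~R| = (absz z)%:R :> R by rewrite -intr_norm -abszE.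
have X0 : (0 < #|X|)%N by rewrite cX absz_gt0.
have -> : `|\det C|%:~R = #|X|%:R :> R by rewrite cX -abszE.
apply: (tends_region_card (xi := xi) (c := c)) => //.
  move=> x j; rewrite abs ler_nat /c (bigD1 x) //= (bigD1 j) //= -!addnA leq_addr //.
move=> j; rewrite (eq_bigr (fun i => (absz (C j i))%:R)) => [|i _]; last exact: abs.
rewrite -natr_sum ler_nat /c [X in (_ <= _ + X)%N](bigD1 j) //=; lia.
Qed.

End Region.

(** * The sorting permutations and their matrices *)

Section IncidenceMatrix.
Variable n : nat.
Hypothesis hn : (2 <= n)%N.
Local Notation l := (ell n).
Local Notation V := 'rV['F_2]_n.

Definition incid (w : V) (i : 'I_l) : int := (dot (vbit i) w == 1 : nat)%:Z.

Lemma card_vbit (P : pred V) : ~~ P 0 -> #|[set i : 'I_l | P (vbit i)]| = #|[set w | P w]|.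
Proof.
move=> P0; rewrite -(card_imset _ (@vbit_inj n)); apply: eq_card => w; rewrite inE.
apply/imsetP/idP => [[i]|Pw]; first by rewrite inE => ? ->.
have w0 : w != 0 by apply: contraNneq P0 => <-.
by have [i E] := vbit_onto w0; exists i; rewrite ?inE E.
Qed.

Lemma sum_card_int (I : finType) (P : pred I) : \sum_(i : I) (P i : nat)%:Z = #|[set i | P i]|%:Z.
Proof.
rewrite -sum1dep_card (big_morph Posz PoszD (erefl _)) [RHS]big_mkcond.
by apply: eq_bigr => i _; case: (P i).
Qed.

Lemma sum_incid w : w != 0 -> \sum_i incid w i = (2 ^ n.-1)%N%:Z.
Proof.
move=> w0; rewrite sum_card_int (card_vbit (P := fun u => dot u w == 1)) ?dot0l //.
by rewrite -(card_dot1 w0); congr Posz; apply: eq_card => u; rewrite !inE dotC.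
Qed.

Lemma incidC i j : incid (vbit j) i = incid (vbit i) j.
Proof. by rewrite /incid dotC. Qed.

Lemma sum_incid_col i : \sum_j incid (vbit j) i = (2 ^ n.-1)%N%:Z.
Proof.
by rewrite -(sum_incid (vbit_neq0 i)); apply: eq_bigr => j _; exact: incidC.
Qed.

(** A nonzero vector has dot product 1 with half of the space, and two distinct ones have it
    simultaneously with a quarter. The Gram matrix is [2 ^ (n - 2)] times the identity plus the
    all-ones matrix. *)
Lemma sum_incid2 i k : \sum_j incid (vbit j) i * incid (vbit j) k =
  (2 ^ n.-2)%N%:Z * (1 + (i == k)%:R).
Proof.
have E : \sum_j incid (vbit j) i * incid (vbit j) k =
    #|[set w : V | (dot (vbit i) w == 1) && (dot (vbit k) w == 1)]|%:Z.
  rewrite -(card_vbit (P := fun w => (dot (vbit i) w == 1) && (dot (vbit k) w == 1))) ?dot0r //.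
  rewrite -sum_card_int; apply: eq_bigr => j _.
  by rewrite /incid; case: (_ == _); case: (_ == _).
have n2 : n.-1 = n.-2.+1 by case: n hn => [|[|?]].
rewrite {}E; have [->|ik] := eqVneq i k.
  rewrite (_ : #|_| = (2 ^ n.-1)%N).
    by rewrite n2 expnS mulrC PoszM.
  by rewrite -(card_dot1 (vbit_neq0 k)); apply: eq_card => w; rewrite !inE andbb.
rewrite addr0 mulr1; congr Posz; apply: double_inj.
have vv : vbit k != vbit i by apply: contra_neq ik => /vbit_inj.
have := cardsID [set w : V | dot (vbit i) w == 1] [set w : V | dot (vbit k) w == 1].
rewrite (card_dot1 (vbit_neq0 k)) n2 expnS mul2n => <-; rewrite -addnn.
congr (_ + _)%N; first by apply: eq_card => w; rewrite !inE andbC.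
rewrite (card_dot_half (vbit_neq0 i) vv (vbit_neq0 k)).
by apply: eq_card => w; rewrite !inE.
Qed.

(** [ell n] is not literally a successor, so the first index is a variable of value 0. *)
Variable o : 'I_l.
Hypothesis o0 : o = 0%N :> nat.

(** When [s] sorts the radicands, row [j] other than [o] gives the logarithm of the ratio of the
    [j]-th radicand to the smallest one. *)
Definition Csigma (s : {perm 'I_l}) : 'M[int]_l :=
  \matrix_(j, i) if j == o then 1 else incid (vbit (s j)) i - incid (vbit (s o)) i.

Lemma Csigma_sum s j : j != o -> \sum_i Csigma s j i = 0.
Proof.
move=> /negPf jo; rewrite (eq_bigr (fun i => incid (vbit (s j)) i - incid (vbit (s o)) i)).
  by rewrite big_split /= sumrN !sum_incid ?vbit_neq0 // subrr.
by move=> i _; rewrite mxE jo.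
Qed.

Lemma Cmx_Csigma : Cmx n = Csigma 1.
Proof.
have dZ i j : dotZ n i.+1 j.+1 = (dot (vbits n i.+1) (vbits n j.+1) == 1 : nat)%:Z.
  by rewrite /dotZ dotvE; case: (F2_cases (dot (vbits n i.+1) (vbits n j.+1))) => ->.
apply/matrixP => j i; rewrite !mxE -(inj_eq val_inj) /= o0; case: ifP => // _.
by rewrite !perm1 /incid /vbit !dZ o0.
Qed.

(** Every column of the incidence matrix [M] has sum [2 ^ n.-1], so scaling row [o] by this number
    makes it the sum of the rows of [M]. The scaled matrix is a fixed [E] times a permutation matrix
    times [M], and [s] affects only the sign of its determinant. *)
Lemma det_Csigma_scaled : exists d : int, forall s,
  (2 ^ n.-1)%N%:Z * `|\det (Csigma s)| = d.
Proof.
pose E : 'M[int]_l := \matrix_(j, k) if j == o then 1 else (k == j)%:R - (k == o)%:R.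
pose M : 'M[int]_l := \matrix_(j, i) incid (vbit j) i.
exists (`|\det E| * `|\det M|) => s.
pose D : 'M[int]_l := diag_mx (\row_j if j == o then (2 ^ n.-1)%N%:Z else 1).
have DE : \det D = (2 ^ n.-1)%N%:Z.
  rewrite det_diag (bigD1 o) //= mxE eqxx big1 ?mulr1 // => j /negPf jo.
  by rewrite mxE jo.
have H : D *m Csigma s = E *m (perm_mx s *m M).
  rewrite -row_permE; apply/matrixP => j i; rewrite mul_diag_mx !mxE.
  case: (eqVneq j o) => [jo|jo].
    rewrite mulr1 (eq_bigr (fun k => incid (vbit (s k)) i)); last first.
      by move=> k _; rewrite !mxE jo eqxx mul1r.
    rewrite -(reindex_inj (P := xpredT) (F := fun k => incid (vbit k) i) (@perm_inj _ s)).
    by rewrite sum_incid_col.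
  rewrite mul1r (bigD1 j) //= (bigD1 o) 1?eq_sym //= big1 => [|k /andP[kj ko]].
    by rewrite !mxE (negPf jo) !eqxx (eq_sym o j) (negPf jo) subr0 sub0r mul1r mulN1r addr0.
  by rewrite !mxE (negPf jo) (negPf kj) (negPf ko) subrr mul0r.
have := congr1 (fun A => `|\det A|) H; rewrite /= !det_mulmx DE det_perm !normrM.
by rewrite normrX normrN1 expr1n mul1r [X in X * _ = _]ger0_norm.
Qed.

Lemma det_Csigma s : `|\det (Csigma s)| = `|\det (Cmx n)|.
Proof.
have [d Hd] := det_Csigma_scaled; have := Hd s; rewrite -(Hd 1%g) -Cmx_Csigma.
by apply: mulfI; rewrite eqz_nat -lt0n expn_gt0.
Qed.

(** A vector killed by all rows has sum 0 and the same product [t] with each row of the incidence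
    matrix. Adding these rows gives [t = 0], and then [sum_incid2] gives that the vector is 0. *)
Lemma det_Cmx_neq0 : \det (Cmx n) != 0.
Proof.
rewrite Cmx_Csigma -(intr_eq0 rat) -det_map_mx -det_tr; apply/det0P => -[v v0 vC].
have vCj j : \sum_i v 0 i * (Csigma 1 j i)%:~R = 0.
  by have := congr1 (fun u : 'rV[rat]_l => u 0 j) vC; rewrite !mxE => H; rewrite -[RHS]H; apply: eq_bigr => i _; rewrite !mxE.
have s0 : \sum_i v 0 i = 0.
  by rewrite -[RHS](vCj o); apply: eq_bigr => i _; rewrite mxE eqxx mulr1.
pose t := \sum_i v 0 i * (incid (vbit o) i)%:~R.
have tE j : \sum_i v 0 i * (incid (vbit j) i)%:~R = t.
  have [->//|jo] := eqVneq j o; apply/eqP; rewrite -subr_eq0 -sumrB; apply/eqP.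
  rewrite -[RHS](vCj j); apply: eq_bigr => i _.
  by rewrite mxE (negPf jo) !perm1 intrB mulrBr.
have t0 : t = 0.
  have : \sum_(j < l) t = 0.
    rewrite -(eq_bigr _ (fun j _ => tE j)) exchange_big /=.
    rewrite (eq_bigr (fun i => (2 ^ n.-1)%N%:R * v 0 i)) -?mulr_sumr ?s0 ?mulr0 // => i _.
    by rewrite -mulr_sumr -(rmorph_sum (intmul 1)) sum_incid_col mulrC.
  move/eqP; rewrite sumr_const card_ord mulrn_eq0 => /orP[/eqP l0|/eqP //].
  by have := leq_ltn_trans (leq0n o) (ltn_ord o); rewrite l0.
case/eqP: v0; apply/rowP => k; rewrite mxE; apply/eqP.
have : \sum_j (\sum_i v 0 i * (incid (vbit j) i)%:~R) * (incid (vbit j) k)%:~R = 0 :> rat.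
  by rewrite big1 // => j _; rewrite tE t0 mul0r.
rewrite (eq_bigr (fun j => \sum_i v 0 i * (incid (vbit j) i * incid (vbit j) k)%:~R)); last first.
  by move=> j _; rewrite mulr_suml; apply: eq_bigr => i _; rewrite intrM mulrA.
rewrite exchange_big /= (eq_bigr (fun i => (2 ^ n.-2)%N%:R * (v 0 i + v 0 i * (i == k)%:R))).
  rewrite -mulr_sumr big_split /= s0 add0r (bigD1 k) //= eqxx mulr1 big1 ?addr0 => [|i /negPf ->].
    by move/eqP; rewrite mulf_eq0 pnatr_eq0 -leqn0 leqNgt expn_gt0.
  by rewrite mulr0.
move=> i _; rewrite -mulr_sumr -(rmorph_sum (intmul 1)) sum_incid2 /= intrM intrD.
rewrite -[(2 ^ n.-2)%N%:~R]/((2 ^ n.-2)%N%:R : rat) -[1%:~R]/(1 : rat).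
have -> : (i == k)%:R%:~R = (i == k)%:R :> rat by case: (i == k).
ring.
Qed.

End IncidenceMatrix.

Section SortingPermutation.
Variables (R : realType) (n : nat).
Hypothesis hn : (2 <= n)%N.
Local Notation l := (ell n).
Variable Rs : nat -> R.
Implicit Types (g : 'I_l -> nat) (s : {perm 'I_l}).

Definition rad_seq s g : seq nat := [seq radprod g (vbit (s i)) | i <- enum 'I_l].

Lemma size_rad_seq s g : size (rad_seq s g) = l.
Proof. by rewrite size_map size_enum_ord. Qed.

Lemma nth_rad_seq s g (i : 'I_l) : nth 0%N (rad_seq s g) i = radprod g (vbit (s i)).
Proof. by rewrite (nth_map i) ?size_enum_ord // nth_ord_enum. Qed.

Lemma mem_rad_seq s g D : D \in rad_seq s g <-> exists i : 'I_l, D = radprod g (vbit i).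
Proof.
split=> [/mapP[i _ ->]|[i ->]]; first by exists (s i).
by apply/mapP; exists (s^-1%g i); rewrite ?mem_enum // permKV.
Qed.

Definition sorted_shape s g :=
  sorted ltn (rad_seq s g) /\ shape_in n Rs (lambda R (rad_seq s g)).

Lemma sorted_shape_shape s g : sorted_shape s g -> tuple_shape Rs g.
Proof.
by move=> [so sh]; exists (rad_seq s g); split; rewrite ?size_rad_seq // => D; exact: mem_rad_seq.
Qed.

Lemma tuple_shape_sorted g : (forall i, (0 < g i)%N) -> tuple_shape Rs g ->
  exists s, sorted_shape s g.
Proof.
move=> g0 sh; have inj := radprod_distinct hn g0 sh; case: sh => t [so st Dt sh].
have ex (i : 'I_l) : exists j : 'I_l, nth 0%N t i = radprod g (vbit j).
  by apply/Dt; rewrite mem_nth // st.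
pose h i := projT1 (cid (ex i)).
have hE (i : 'I_l) : nth 0%N t i = radprod g (vbit (h i)) by rewrite /h; case: cid.
have hinj : injective h.
  move=> i j E; apply/val_inj/eqP; rewrite /= -(nth_uniq 0%N (s := t)) ?st ?ltn_ord //.
    by rewrite !hE E.
  exact: (sorted_uniq ltn_trans ltnn).
exists (perm hinj); rewrite /sorted_shape.
suff -> : rad_seq (perm hinj) g = t by [].
apply: (@eq_from_nth _ 0%N); first by rewrite size_rad_seq st.
rewrite size_rad_seq => i il; by rewrite (nth_rad_seq _ _ (Ordinal il)) permE -hE.
Qed.

Lemma sorted_shape_unique g s s' : (forall i, (0 < g i)%N) ->
  sorted_shape s g -> sorted_shape s' g -> s = s'.
Proof.
move=> g0 hs hs'; have inj := radprod_distinct hn g0 (sorted_shape_shape hs).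
have E : rad_seq s g = rad_seq s' g.
  apply: (irr_sorted_eq ltn_trans ltnn); [exact: hs.1|exact: hs'.1|].
  by move=> D; apply/idP/idP => /mem_rad_seq/mem_rad_seq.
apply/permP => i; apply: (@vbit_inj n); apply: inj.
by rewrite -!nth_rad_seq E.
Qed.

Definition perm_card (X : R) (B : nat) s : nat :=
  #|[set f : {ffun 'I_l -> 'I_B} | @good n (fun i => f i) &&
     `[< ((\prod_i f i) ^ (2 ^ n.-1))%N%:R <= X /\ sorted_shape s (fun i => f i) >]]|.

Lemma card_tuples_perm X B : #|tuples_set n Rs X B| = (\sum_s perm_card X B s)%N.
Proof.
rewrite (eq_bigr (fun s => \sum_(f : {ffun 'I_l -> 'I_B}) (@good n (fun i => f i) &&
     `[< (((\prod_i f i) ^ (2 ^ n.-1))%N%:R <= X)%R /\ sorted_shape s (fun i => f i) >] : nat))%N); last first.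
  by move=> s _; rewrite /perm_card -sum1dep_card big_mkcond; apply: eq_bigr => f _; case: ifP.
rewrite exchange_big /= /tuples_set -sum1dep_card big_mkcond; apply: eq_bigr => f _ /=.
case: ifP => [/asboolP[af m4 bf sh]|/asboolP nv].
  have g0 := tuple_adm_gt0 af.
  have gf : @good n (fun i => f i).
    by rewrite /good; apply/andP; split; [apply/asboolP | apply/forallP => t; rewrite m4].
  have [s hs] := tuple_shape_sorted g0 sh.
  rewrite (bigD1 s) //= [X in (_ + X)%N]big1 ?addn0.
    by rewrite gf; case: asboolP => // -[].
  move=> s' ns; apply/eqP; rewrite eqb0; apply: contra ns => /andP[_ /asboolP[_ hs']].
  by apply/eqP; exact: sorted_shape_unique hs' hs.
rewrite big1 // => s _; apply/eqP; rewrite eqb0; apply/negP => /andP[/andP[/asboolP af /forallP m4] /asboolP[bf hs]].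
by apply: nv; split => //; [move=> t; apply/eqP; exact: m4 | exact: sorted_shape_shape hs].
Qed.

End SortingPermutation.

(** * The asymptotic formula *)

Section InnerIntExtra.
Variable R : realType.

Lemma inner_int_ext (Rs Rs' : nat -> R) k : (forall j, (2 <= j <= k.+1)%N -> Rs j = Rs' j) ->
  inner_int Rs k = inner_int Rs' k.
Proof.
elim: k => [//|k IH] H; apply/funext => b; rewrite !inner_intS IH => [|j /andP[j2 jk]].
  by rewrite H // leqnn.
by apply: H; rewrite j2 leqW.
Qed.

(** The midpoint [A] leaves room below it for the inner iterate and above it for an interval of
    integration. A positive constant is what turns a limit of quotients into an asymptotic
    equivalence. *)
Lemma inner_int_gt0 (Rs : nat -> R) r b k : (forall j, (2 <= j)%N -> 1 <= Rs j) ->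
  (forall j, (2 <= j)%N -> Rs j <= r) -> 1 <= r -> r < b -> 0 < inner_int Rs k b.
Proof.
move=> R1 Rr r1; elim: k b => [|k IH] b rb //.
pose A := (r + b) / 2.
have rA : r < A by rewrite /A; lra.
have Ab : A < b by rewrite /A; lra.
have RA : Rs k.+2 <= A by apply: le_trans (Rr k.+2 isT) _; exact: ltW.
apply: lt_le_trans (_ : 0 < (1 - A / b) * inner_int Rs k A) _.
  by rewrite mulr_gt0 ?IH // subr_gt0 ltr_pdivrMr ?mul1r //; lra.
apply: le_trans (inner_int_inc_ge R1 RA (ltW Ab)) _.
by rewrite gerBl inner_int_ge0.
Qed.

End InnerIntExtra.

(** A form of [region_asymptotics] for a size that is not literally a successor, with the region
    given by any equivalent condition. *)
Lemma region_asymptotics_ord (R : realType) (l : nat) (C : 'M[int]_l) (o : 'I_l)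
    (Rs : nat -> R) (b : R) (A : pred ('I_l -> nat)) (B : R -> nat) (delta : R)
    (Reg : R -> ('I_l -> nat) -> Prop) (z : ('I_l -> nat) -> nat -> R) :
  (1 < l)%N -> o = 0%N :> nat -> (forall i, C o i = 1) ->
  (forall j, j != o -> \sum_i C j i = 0) -> \det C != 0 ->
  (forall j, (2 <= j)%N -> 1 <= Rs j) -> 1 <= b -> 0 <= delta ->
  (forall g, A g -> forall i, (0 < g i)%N) ->
  (forall lo hi : 'I_l -> R, (forall i, 0 <= lo i) -> (forall i, lo i <= hi i) ->
    tends (fun T => (box_count (B T) A lo hi T)%:R / T ^+ l) (delta * \prod_i (hi i - lo i))) ->
  (forall g (j : 'I_l), z g j = \sum_i (C j i)%:~R * ln (g i)%:R) ->
  (forall T g, 1 <= T -> A g -> Reg T g <->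
    [/\ z g 0%N <= l%:R * ln T, 0 < z g 1%N, forall j, (0 < j < l.-1)%N -> z g j < z g j.+1,
      z g l.-1 <= ln b & forall j, (0 < j <= l.-1)%N -> ln (Rs j.+1) <= z g j]) ->
  tends (fun T => (#|[set f : {ffun 'I_l -> 'I_(B T)} | A (fun i => f i) &&
      `[< Reg T (fun i => f i) >]]|)%:R / T ^+ l)
    (delta / `|\det C|%:~R * inner_int Rs l.-1 b).
Proof.
case: l => [//|m] in C o A Reg z *; rewrite ltnS => m0 o0 C0 Cs dC R1 b1 d0 A0 Abox zE RegE.
have oE : o = 0 by apply: val_inj.
subst o.
apply: (tends_ext (T1 := 1) _ (region_asymptotics C0 Cs m0 R1 b1 dC d0 A0 Abox)) => T T1.
congr (_%:R / _); apply: eq_card => f; rewrite !inE; case Af: (A _) => //=.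
have zr j : (j <= m)%N -> z (fun i => f i) j = zrow R C (fun i => f i) j.
  by move=> jm; rewrite -[j in LHS](@inordK m) ?ltnS // zE.
apply: asbool_equiv_eq; rewrite RegE //; split=> -[/= h0 h1 h2 h3 h4]; split.
- by rewrite zr.
- by rewrite zr.
- by move=> j /andP[j0 jm]; rewrite !zr ?h2 ?j0 // ltnW.
- by rewrite zr.
- by move=> j /andP[j0 jm]; rewrite zr ?h4 ?j0.
- by rewrite -zr.
- by rewrite -zr.
- by move=> j /andP[j0 jm]; rewrite -!zr ?h2 ?j0 // ltnW.
- by rewrite -zr.
- by move=> j /andP[j0 jm]; rewrite -zr ?h4 ?j0.
Qed.

Section Final.
Variables (R : realType) (n : nat).
Hypothesis hn : (2 <= n)%N.
Local Notation l := (ell n).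
Variable Rs : nat -> R.
Hypotheses (hR1 : 1 <= Rs 2%N) (hRs : forall j : nat, (2 <= j < l)%N -> Rs j <= Rs j.+1).
Implicit Types (g : 'I_l -> nat) (s : {perm 'I_l}).

Lemma ell_ge3 : (2 < l)%N.
Proof.
have : (2 ^ 2 <= 2 ^ n)%N by rewrite leq_exp2l.
by rewrite /ell; lia.
Qed.

Lemma thr_mono i j : (2 <= i)%N -> (i <= j)%N -> (j <= l)%N -> Rs i <= Rs j.
Proof.
move=> i2; elim: j => [|j IH]; first by rewrite leqn0 => /eqP ->.
rewrite leq_eqVlt => /orP[/eqP <- //|]; rewrite ltnS => ij jl.
by apply: le_trans (IH ij (ltnW jl)) _; apply: hRs; rewrite (leq_trans i2).
Qed.

(* The threshold for the last coordinate is redundant; this choice turns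
   [F_int] into a value of [inner_int]. *)
Definition thr j := Rs (minn j l.-1).

Lemma thr_ge1 j : (2 <= j)%N -> 1 <= thr j.
Proof.
move=> j2; have l3 := ell_ge3; apply: le_trans hR1 _; apply: thr_mono => //.
  by rewrite leq_min j2 -ltnS prednK //; lia.
by rewrite geq_min leq_pred orbT.
Qed.

Lemma F_intE : F_int n Rs = inner_int thr l.-1 (Rs l).
Proof.
have l3 := ell_ge3; have E : l.-1 = (l - 2).+1 by lia.
rewrite /F_int {2}E inner_intS.
have -> : thr (l - 2).+2 = Rs l.-1 by congr Rs; apply/minn_idPr; lia.
rewrite (@inner_int_ext _ _ thr) // => j /andP[j2 jl]; congr Rs; symmetry; apply/minn_idPl; lia.
Qed.

Lemma F_int_gt0 : Rs l.-1 < Rs l -> 0 < F_int n Rs.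
Proof.
move=> lt; rewrite F_intE; have l3 := ell_ge3; apply: (inner_int_gt0 (r := Rs l.-1)) => //.
- exact: thr_ge1.
- move=> j j2; apply: thr_mono; rewrite ?geq_min ?leq_pred ?leqnn ?orbT //.
  by rewrite leq_min j2 -ltnS prednK //; lia.
- by apply: le_trans hR1 _; apply: thr_mono; rewrite ?leq_pred // -ltnS prednK //; lia.
Qed.

Lemma F_int_eq0 : Rs l.-1 = Rs l -> F_int n Rs = 0.
Proof. by move=> E; rewrite /F_int E set_itv1 Rintegral_set1. Qed.

Definition log_coord s g (j : nat) : R :=
  if j == 0%N then \sum_i ln (g i)%:R
  else ln (nth 0%N (rad_seq s g) j)%:R - ln (nth 0%N (rad_seq s g) 0)%:R.

Lemma ln_radprod g w : (forall i, (0 < g i)%N) ->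
  ln (radprod g w)%:R = \sum_i (incid w i)%:~R * ln (g i)%:R :> R.
Proof.
move=> g0; rewrite /radprod natr_prod.
have -> : \prod_(i < l | dot (vbit i) w == 1) (g i)%:R =
    expR (\sum_(i < l | dot (vbit i) w == 1) ln (g i)%:R) :> R.
  by rewrite expR_sum; apply: eq_bigr => i _; rewrite lnK // posrE ltr0n.
rewrite expRK big_mkcond; apply: eq_bigr => i _; rewrite /incid.
by case: eqP => _; rewrite ?mul1r ?mul0r.
Qed.

Lemma log_coordE (o : 'I_l) s g (j : 'I_l) : o = 0%N :> nat -> (forall i, (0 < g i)%N) ->
  log_coord s g j = \sum_i (Csigma o s j i)%:~R * ln (g i)%:R.
Proof.
move=> o0 g0; rewrite /log_coord.
have -> : (j == 0%N :> nat) = (j == o) by rewrite -(inj_eq val_inj) /= o0.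
have -> : nth 0%N (rad_seq s g) 0 = radprod g (vbit (s o)) by rewrite -nth_rad_seq o0.
case: eqVneq => [->|jo].
  by apply: eq_bigr => i _; rewrite mxE eqxx mul1r.
rewrite nth_rad_seq !ln_radprod // -sumrB; apply: eq_bigr => i _.
by rewrite mxE (negPf jo) intrB mulrBl.
Qed.

(** Logarithms turn the conditions on the product and on the [lambda] into linear ones. The last
    threshold under [thr] equals that of the preceding coordinate, and follows from the order of the
    two. *)
Lemma sorted_shape_region s g T : (forall i, (0 < g i)%N) -> 1 <= T ->
  ((\prod_i g i) ^ (2 ^ n.-1))%N%:R <= T ^+ (l * 2 ^ n.-1) /\ sorted_shape Rs s g <->
  [/\ log_coord s g 0 <= l%:R * ln T, 0 < log_coord s g 1,
      forall j, (0 < j < l.-1)%N -> log_coord s g j < log_coord s g j.+1,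
      log_coord s g l.-1 <= ln (Rs l) &
      forall j, (0 < j <= l.-1)%N -> ln (thr j.+1) <= log_coord s g j].
Proof.
move=> g0 T1; have l3 := ell_ge3; have T0 : 0 < T by lra.
pose t j : R := (nth 0%N (rad_seq s g) j)%:R.
have t0 j : (j < l)%N -> 0 < t j.
  move=> jl; rewrite ltr0n -[j]/(nat_of_ord (Ordinal jl)) nth_rad_seq.
  exact: radprod_gt0.
have l0 : (0 < l)%N by lia.
have lamE j : (0 < j < l)%N -> 0 < lambda R (rad_seq s g) j.+1 /\
    log_coord s g j = ln (lambda R (rad_seq s g) j.+1).
  move=> /andP[j0 jl]; rewrite /lambda /= -/(t j) -/(t 0%N); split; first by rewrite divr_gt0 ?t0.
  by rewrite ln_div ?posrE ?t0 // /log_coord gtn_eqF.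
have bE : ((\prod_i g i) ^ (2 ^ n.-1))%N%:R <= T ^+ (l * 2 ^ n.-1) <-> log_coord s g 0 <= l%:R * ln T.
  rewrite exprM natrX ler_pXn2r ?nnegrE ?exprn_ge0 ?(ltW T0) ?expn_gt0 //.
  rewrite /log_coord /= -ler_expR expR_sum expRM_natl lnK ?posrE // natr_prod.
  have -> : \prod_i expR (ln (g i)%:R) = \prod_i (g i)%:R :> R.
    by apply: eq_bigr => i _; rewrite lnK // posrE ltr0n.
  by [].
have sE j : (j.+1 < l)%N -> (nth 0%N (rad_seq s g) j < nth 0%N (rad_seq s g) j.+1)%N <->
    (if j == 0%N then 0 else log_coord s g j) < log_coord s g j.+1.
  move=> jl; rewrite -(ltr_nat R) -/(t j) -/(t j.+1) -(ltr_ln (t0 j (ltnW jl)) (t0 _ jl)).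
  rewrite /log_coord /=; case: eqVneq => [->|_]; first by rewrite subr_gt0.
  by rewrite ltrD2r.
have thrE j : (0 < j < l.-1)%N -> thr j.+1 = Rs j.+1 by move=> jl; congr Rs; apply/minn_idPl; lia.
have r1 j : (2 <= j <= l)%N -> 1 <= Rs j.
  by move=> /andP[j2 jl]; apply: le_trans hR1 _; exact: thr_mono.
have lE : l.-1.+1 = l by rewrite prednK.
split.
  move=> [/bE b0 [/(sortedP 0%N) so [_ sh2 sh3]]]; rewrite size_rad_seq in so.
  have inc j : (j.+1 < l)%N -> (if j == 0%N then 0 else log_coord s g j) < log_coord s g j.+1.
    by move=> jl; apply/sE => //; exact: so.
  have incS j : (0 < j < l.-1)%N -> log_coord s g j < log_coord s g j.+1.
    by move=> /andP[j0 jl]; have := inc j; rewrite gtn_eqF //; apply; lia.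
  have low j : (0 < j < l.-1)%N -> ln (thr j.+1) <= log_coord s g j.
    move=> jl; rewrite thrE //; have [p ->] := lamE j ltac:(lia).
    rewrite ler_ln ?posrE //; first by apply: sh3; lia.
    by apply: lt_le_trans (r1 j.+1 _) => //; lia.
  split => //.
  - by apply: (inc 0%N); lia.
  - have [p ->] := lamE l.-1 ltac:(lia); rewrite lE in p *.
    rewrite ler_ln ?posrE //; apply: lt_le_trans (r1 l _) => //; lia.
  - move=> j /andP[j0]; rewrite leq_eqVlt => /orP[/eqP Ej|jl]; last by apply: low; rewrite j0.
    have -> : thr j.+1 = thr l.-2.+1 by congr Rs; rewrite /minn; do 2!case: ifP; lia.
    apply: le_trans (low l.-2 _) _; first by lia.
    have -> : j = l.-2.+1 by lia.
    by apply: ltW; apply: incS; lia.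
move=> [b0 z1 zlt zb zr]; split; first exact/bE.
have lnle x y : 0 < x -> 0 < y -> ln x <= ln y -> x <= y :> R.
  by move=> x0 y0; rewrite ler_ln ?posrE.
split.
  apply/(sortedP 0%N) => j; rewrite size_rad_seq => jl; apply/sE => //.
  by case: eqVneq => [-> //|j0]; apply: zlt; lia.
split.
- move=> j /andP[j2 jl]; have [p1 E1] := lamE j.-1 ltac:(lia); have [p2 E2] := lamE j ltac:(lia).
  rewrite prednK in p1 E1; last by lia.
  rewrite -ltr_ln ?posrE // -E1 -E2.
  by have := zlt j.-1; rewrite prednK; [apply; lia | lia].
- have [p E] := lamE l.-1 ltac:(lia); rewrite lE in p E; rewrite E in zb.
  apply: lnle => //; apply: lt_le_trans (r1 l _) => //; lia.
- move=> j /andP[j2 jl]; have [p E] := lamE j.-1 ltac:(lia).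
  rewrite prednK in p E; last by lia.
  apply: lnle => //; first by apply: lt_le_trans (r1 j _) => //; lia.
  have := zr j.-1; rewrite thrE prednK; try lia.
  by rewrite E; apply; lia.
Qed.

Lemma good_gt0 g : good g -> forall i, (0 < g i)%N.
Proof. by move=> /andP[/asboolP ag _]; exact: tuple_adm_gt0. Qed.

(** For [X = T ^+ E] the discriminant bound reads [\prod_i g i <= T ^+ l], and [T ^+ l] is the
    expected power of [X]. *)
Let E := (l * 2 ^ n.-1)%N.
Let B (T : R) := (Num.truncn (T ^+ E)).+1.

Lemma B_large K : exists T0, forall T, T0 <= T -> K * T <= (B T)%:R.
Proof.
exists (Num.max 1 K) => T; rewrite ge_max => /andP[T1 KT].
have T0 : 0 <= T by lra.
apply: (@le_trans _ _ (T ^+ E)); last exact/ltW/truncnS_gt.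
apply: (@le_trans _ _ (T ^+ 2)); first by rewrite expr2 ler_wpM2r.
apply: ler_weXn2l => //; have l3 := ell_ge3; have : (0 < 2 ^ n.-1)%N by rewrite expn_gt0.
by rewrite /E; nia.
Qed.

Lemma density_ge0 : 0 <= density R n.
Proof.
by rewrite /density mulr_ge0 ?divr_ge0 ?exprn_ge0 // ltW // euler_product_gt0.
Qed.

Lemma tends_perm_card s : tends (fun T => (perm_card Rs (T ^+ E) (B T) s)%:R / T ^+ l)
  (density R n * c_ell n R * F_int n Rs).
Proof.
have l3 := ell_ge3; have l0 : (0 < l)%N by lia.
pose o : 'I_l := Ordinal l0.
(* The coordinates must be linear in the [ln (g i)] for all [g], including tuples with a component
   0, where [log_coord] need not be; there the linear form itself is used. Good tuples are
   positive. *)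
have := @region_asymptotics_ord R l (Csigma o s) o thr (Rs l) (@good n) B (density R n)
  (fun T g => ((\prod_i g i) ^ (2 ^ n.-1))%N%:R <= T ^+ E /\ sorted_shape Rs s g)
  (fun g j => if `[< forall i, (0 < g i)%N >] then log_coord s g j
              else if insub j is Some j' then \sum_i (Csigma o s j' i)%:~R * ln (g i)%:R else 0).
rewrite -F_intE; have -> : density R n / `|\det (Csigma o s)|%:~R = density R n * c_ell n R.
  by rewrite (det_Csigma (o := o)) // /c_ell intr_norm.
apply => //.
- by lia.
- by move=> i; rewrite mxE eqxx.
- exact: Csigma_sum.
- rewrite -normr_gt0 (det_Csigma (o := o)) // normr_gt0.
  exact: (det_Cmx_neq0 hn (o := o)).
- exact: thr_ge1.
- by apply: le_trans hR1 _; apply: thr_mono => //; lia.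
- exact: density_ge0.
- exact: good_gt0.
- by move=> lo hi lo0 lohi; apply: tends_good => //; exact: B_large.
- move=> g j; case: asboolP => [g0|_]; first exact: log_coordE.
  by rewrite valK.
- move=> T g T1 /good_gt0 g0; case: asboolP => // _; exact: sorted_shape_region.
Qed.

Lemma C_ellE : C_ell n R = (density R n * c_ell n R * (l`!)%:R) / #|'GL_n(2)%g|%:R.
Proof. by rewrite /C_ell /density invfM; ring. Qed.

Lemma card_GL_gt0 : (0 < #|'GL_n(2)%g|)%N.
Proof. exact: cardG_gt0. Qed.

Lemma tends_field_count : tends (fun T => (field_count n Rs (T ^+ E))%:R / T ^+ l)
  (C_ell n R * F_int n Rs).
Proof.
have GL0 : #|'GL_n(2)%g|%:R != 0 :> R by rewrite pnatr_eq0 -lt0n card_GL_gt0.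
apply: (@tends_ext _ (fun T => (\sum_(s : {perm 'I_l}) (perm_card Rs (T ^+ E) (B T) s)%:R / T ^+ l) *
   (#|'GL_n(2)%g|%:R)^-1) _ _ 0).
  move=> T _; rewrite -mulr_suml -natr_sum -(card_tuples_perm hn).
  rewrite field_count_tuples //; last exact: truncnS_gt.
  by rewrite natrM mulrAC mulfK.
have -> : C_ell n R * F_int n Rs =
    (\sum_(s : {perm 'I_l}) density R n * c_ell n R * F_int n Rs) * (#|'GL_n(2)%g|%:R)^-1.
  rewrite sumr_const card_Sn C_ellE -[X in _ = X / _]mulr_natr.
  by rewrite mulrAC; congr (_ / _); rewrite mulrAC.
apply: tendsM; last exact: tends_cst.
by apply: tends_sum => s _; exact: tends_perm_card.
Qed.

Lemma omega1_gt0 : (0 < omega1 n)%N.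
Proof.
apply/card_gt0P; exists [ffun=> 1]; rewrite inE; apply/forallP => j; apply/eqP.
by rewrite /Dprod big1 // => i _; rewrite ffunE.
Qed.

Lemma C_ell_gt0 : 0 < C_ell n R.
Proof.
rewrite /C_ell mulr_gt0 ?euler_product_gt0 // divr_gt0 ?mulr_gt0 ?exprn_gt0 ?ltr0n ?fact_gt0 ?card_GL_gt0 ?omega1_gt0 //.
have l3 := ell_ge3; have l0 : (0 < l)%N by lia.
rewrite invr_gt0 normr_gt0 intr_eq0; exact: (det_Cmx_neq0 hn (o := Ordinal l0)).
Qed.

(** The shape condition would give [lambda_(l-1) < lambda_l <= R_l = R_(l-1) <= lambda_(l-1)]. *)
Lemma field_count_eq0 X : Rs l.-1 = Rs l -> field_count n Rs X = 0%N.
Proof.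
move=> EQ; have l3 := ell_ge3.
have H := @field_count_tuples R n hn Rs X _ (truncnS_gt X).
suff T0 : tuples_set n Rs X (Num.truncn X).+1 = finset.set0.
  move: H; rewrite T0 cards0 => /esym/eqP; rewrite muln_eq0 => /orP[/eqP //|].
  by rewrite eqn0Ngt card_GL_gt0.
apply/setP => f; rewrite !inE; apply/negP => /asboolP[_ _ _ [t [_ _ _ [h1 h2 h3]]]].
have := h1 l.-1; rewrite prednK ?(ltnW (ltnW l3)) // => /(_ ltac:(lia)) h.
have := h3 l.-1; rewrite EQ => /(_ ltac:(lia)) h'; lra.
Qed.

Lemma field_count_asymptotics :
  (fun X : R => (field_count n Rs X)%:R : R) ~_(+oo_R)
  (fun X : R => C_ell n R * F_int n Rs * X `^ ((2 ^ n.-1)%:R^-1)).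
Proof.
have l3 := ell_ge3; have l0 : (0 < l)%N by lia.
apply/eqaddoP => e e0; have r2 : (2 <= l.-1)%N by lia.
have := @thr_mono l.-1 l r2 (leq_pred l) (leqnn l); rewrite le_eqVlt => /orP[/eqP EQ|lt].
  near=> X; rewrite -[leLHS]/(`|(field_count n Rs X)%:R - C_ell n R * F_int n Rs * X `^ ((2 ^ n.-1)%:R^-1)|).
  by rewrite (field_count_eq0 _ EQ) F_int_eq0 // mulr0 mul0r subrr normr0 mulr0.
have L0 : 0 < C_ell n R * F_int n Rs by rewrite mulr_gt0 ?C_ell_gt0 ?F_int_gt0.
have E0 : (0 < E)%N by rewrite muln_gt0 l0 expn_gt0.
have ER : 0 < E%:R :> R by rewrite ltr0n.
have [T0 HT] := tends_field_count (mulr_gt0 e0 L0).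
near=> X; have X1 : 1 <= X by near: X; exact: nbhs_pinfty_ge.
have X0 : 0 < X by lra.
pose T := X `^ (E%:R^-1); have Tp : 0 < T by rewrite powR_gt0.
have TE : T ^+ E = X by rewrite /T -powR_mulrn ?powR_ge0 // -powRrM mulVf ?gt_eqF // powRr1 // ltW.
have Tl : T ^+ l = X `^ ((2 ^ n.-1)%:R^-1).
  rewrite /T -powR_mulrn ?powR_ge0 // -powRrM; congr powR; rewrite /E natrM; field.
  by rewrite !pnatr_eq0 -!lt0n l0 expn_gt0.
have TT : T0 <= T.
  have XM : Num.max T0 1 ^+ E <= X by near: X; apply: nbhs_pinfty_ge; exact: num_real.
  apply: (@le_trans _ _ (Num.max T0 1)); first by rewrite le_max lexx.
  by rewrite -(ler_pXn2r E0) ?nnegrE ?TE // ?ltW // lt_max ltr01 orbT.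
have := HT T TT; rewrite TE => {}HT.
rewrite -[leLHS]/(`|(field_count n Rs X)%:R - C_ell n R * F_int n Rs * X `^ ((2 ^ n.-1)%:R^-1)|) -Tl.
have Tl0 : 0 < T ^+ l by rewrite exprn_gt0.
rewrite normrM (gtr0_norm Tl0) (gtr0_norm L0) mulrA -ler_pdivrMr //; apply: le_trans HT.
have -> : (field_count n Rs X)%:R / T ^+ l - C_ell n R * F_int n Rs =
    ((field_count n Rs X)%:R - C_ell n R * F_int n Rs * T ^+ l) / T ^+ l.
  by rewrite mulrBl mulfK // gt_eqF.
by rewrite normrM normfV (gtr0_norm Tl0).
Unshelve. all: by end_near. Qed.

End Final.

Theorem theorem1p1 (R : realType) (n : nat) (hn : (2 <= n)%N)
    (Rs : nat -> R) (hR1 : 1 <= Rs 2%N)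
    (hRs : forall j : nat, (2 <= j < ell n)%N -> Rs j <= Rs j.+1) :
  (fun X : R => (field_count n Rs X)%:R : R) ~_(+oo_R)
  (fun X : R => C_ell n R * F_int n Rs * X `^ ((2 ^ n.-1)%:R^-1)).
Proof. exact: field_count_asymptotics. Qed.
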